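(* Let $u_0\in H^{1/2}_+(\mathbb T)$ and let $u\in C(\mathbb R,H^{1/2}_+(\mathbb T))$ be the solution of the cubic Szeg\H{o} equation $$i\,\partial_t u=\Pi(|u|^2u)$$ with $u(0)=u_0$. Then for every $t\in\mathbb R$ and every $z\in D=\{z\in\mathbb C:|z|<1\}$, $$\underline u(t,z)=\Big(\big(I-z\,e^{-itH_{u_0}^2}e^{itK_{u_0}^2}S^*\big)^{-1}e^{-itH_{u_0}^2}u_0\,\Big|\,1\Big).$$
   Context: $\mathbb T=\mathbb R/2\pi\mathbb Z$ with normalized measure; $(f|g)=\frac1{2\pi}\int_0^{2\pi}f\bar g$ is the inner product on $L^2(\mathbb T)$, and $\hat f(k)=(f|e^{ikx})$. $L^2_+(\mathbb T)=\{u\in L^2:\hat u(k)=0\ \forall k<0\}$, $\Pi$ is the orthogonal (Szeg\H{o}) projector of $L^2$ onto $L^2_+$, and $H^s_+=H^s(\mathbb T)\cap L^2_+$. For $u\in L^2_+$, $\underline u(z)=\sum_{k\ge0}\hat u(k)z^k$, $z\in D$. The shift is $Su=e^{ix}u$ on $L^2_+$, with adjoint $S^*$. For $u\in H^{1/2}_+$, the Hankel operator $H_u$ is the antilinear operator $H_u(h)=\Pi(u\bar h)$ on $L^2_+$, and $K_u=H_uS=S^*H_u$; $H_u^2$ and $K_u^2$ are linear, positive, self-adjoint, trace class operators on $L^2_+$. The cubic Szeg\H{o} equation defines a continuous flow on $H^{1/2}_+$ (smooth on $H^s_+$, $s>1/2$); $u$ denotes the corresponding solution. *)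

(* Defs.v *)
(* concrete reals R, Coquelicot complex numbers C.
   Elements of L^2_+(T) are represented by their Fourier coefficient
   sequences a : nat -> C  (u = sum_{k>=0} a k e^{ikx}). *)
From Stdlib Require Import Reals Factorial.
From Coquelicot Require Import Coquelicot.
Open Scope R_scope.

Definition seqC := nat -> C.

Definition CSeries (a : nat -> C) : C :=
  (Series (fun n => Re (a n)), Series (fun n => Im (a n))).

Definition l2 (a : seqC) : Prop := ex_series (fun n => (Cmod (a n)) ^ 2).

Definition h12 (a : seqC) : Prop :=
  ex_series (fun n => (1 + INR n) * (Cmod (a n)) ^ 2).

Definition h12norm (a : seqC) : R :=
  sqrt (Series (fun n => (1 + INR n) * (Cmod (a n)) ^ 2)).

Definition seq_sub (a b : seqC) : seqC := fun n => Cminus (a n) (b n).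

Definition cont_h12 (u : R -> seqC) : Prop :=
  (forall t, h12 (u t)) /\
  forall t eps, 0 < eps -> exists delta, 0 < delta /\
    forall s, Rabs (s - t) < delta -> h12norm (seq_sub (u s) (u t)) < eps.

Definition ip (f g : seqC) : C := CSeries (fun k => Cmult (f k) (Cconj (g k))).

Definition one_fn : seqC := fun k => match k with O => RtoC 1 | S _ => RtoC 0 end.

(* n-th Fourier coefficient of Pi(|u|^2 u) = Pi(u * conj u * u):
   sum over k - l + m = n, i.e. sum_l conj(a_l) sum_{k=0}^{n+l} a_k a_{n+l-k} *)
Fixpoint Csum_upto (f : nat -> C) (N : nat) : C :=
  match N with
  | O => f O
  | S N' => Cplus (Csum_upto f N') (f N)
  end.

Definition szego_nl (a : seqC) (n : nat) : C :=
  CSeries (fun l => Cmult (Cconj (a l))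
                          (Csum_upto (fun k => Cmult (a k) (a (n + l - k)%nat)) (n + l))).

Definition Cderiv (f : R -> C) (t : R) (d : C) : Prop :=
  is_derive (fun s => Re (f s)) t (Re d) /\ is_derive (fun s => Im (f s)) t (Im d).

Definition szego_solution (u0 : seqC) (u : R -> seqC) : Prop :=
  cont_h12 u /\ u 0 = u0 /\
  forall t n, exists d, Cderiv (fun s => u s n) t d /\ Cmult Ci d = szego_nl (u t) n.

(* Hankel operator H_u h = Pi(u conj h) : (H_u h)_n = sum_m a_{n+m} conj(h_m) *)
Definition Hankel (a : seqC) (h : seqC) : seqC :=
  fun n => CSeries (fun m => Cmult (a (n + m)%nat) (Cconj (h m))).

(* K_u = H_u S : (K_u h)_n = sum_m a_{n+m+1} conj(h_m) *)
Definition Kop (a : seqC) (h : seqC) : seqC :=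
  fun n => CSeries (fun m => Cmult (a (n + m + 1)%nat) (Cconj (h m))).

Definition H2 (a : seqC) (h : seqC) : seqC := Hankel a (Hankel a h).
Definition K2 (a : seqC) (h : seqC) : seqC := Kop a (Kop a h).

Definition Sstar (h : seqC) : seqC := fun n => h (S n).

(* exponential of a bounded operator A: e^{cA} h = sum_k c^k/k! A^k h
   (norm-convergent in L^2_+; evaluated coefficientwise) *)
Definition expOp (A : seqC -> seqC) (c : C) (h : seqC) : seqC :=
  fun n => CSeries (fun k =>
    Cmult (Cdiv (Cpow c k) (RtoC (INR (Factorial.fact k)))) (Nat.iter k A h n)).

Definition uline (a : seqC) (z : C) : C := CSeries (fun k => Cmult (a k) (Cpow z k)).

(* Main.v *)
(* Write D x = x' + i T x for the covariant derivative along the flow, where T is the Toeplitz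
   operator of symbol |u|^2.  The equation gives D(H_u x) = i H_u^3 x + H_u(D x), hence D commutes
   with H_u^2 and K_u^2, and [S^*, T] = (.|1) S^* H_u^2 1 turns D x = i H_u^2 x into
   D(S^* x) = i K_u^2 S^* x.  With theta = s - t it follows that the vectors
   x_k(s) = (e^{i theta H^2} e^{-i theta K^2} S^* )^k e^{i theta H^2} u(s), with H and K taken at
   u(s), all satisfy D x = i H^2 x, and as (T x|1) = (H^2 x|1), the number (x_k(s)|1) does not
   depend on s.  At s = t it is the k-th Fourier coefficient of u(t); at s = 0 it is
   the k-th coefficient of the Neumann series in the formula.

   On H^{1/2} the operator T is unbounded, so everything is done for the truncations v = P_N u,
   which satisfy the equation up to an error F tending to 0 in l^2 locally uniformly in time.
   H_v and K_v are bounded, uniformly in N, on the spaces X and X' of weights (1+n)^{1/2} and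
   (1+n)^{-1/2} (that is, H^{1/4} and H^{-1/4}), and H_F : X -> X' has norm O(|F|), so the error
   in D x_k tends to 0 in X' and the identity survives the limit N -> oo. *)
Require Import Defs.
From Stdlib Require Import Reals Factorial Lra Lia Psatz FunctionalExtensionality.
From Coquelicot Require Import Coquelicot.
Open Scope R_scope.

(** * Finite sums *)

(** The truncation error [F] is controlled in [l^2] only, and a Hankel operator with an [l^2] symbol
    need not be bounded on [l^2]; this is the obstacle behind the two spaces. All Hankel estimates
    come from one criterion: [H_a] maps weight [p] to weight [q] if the sum of [q n / p m] over
    [n + m = P] is at most the weight [r P] of the symbol. For [p = (1+n)^{1/2}] and
    [q = (1+n)^{-1/2}] this sum is a discrete Beta integral [B(1/2,1/2)], bounded in [P], so an
    [l^2] symbol is enough. The loss from X to X' occurs once: each commutator error has a single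
    factor [H_F], what acts before it is bounded on X, what acts after it is bounded on X', and the
    final step reads coefficient 0, which is continuous on X'. The exponentials are cut at the same
    order [N] as the symbol. For fixed [N] everything is then a finite sum that can be
    differentiated term by term, at the price of one more error, the last Taylor term. Unitarity of
    the exponentials is a separate point: only because the operator in the formula is a contraction
    does its Neumann series converge in the whole disc. *)

Fixpoint rsum (f : nat -> R) (n : nat) : R :=
  match n with O => 0 | S m => rsum f m + f m end.

Fixpoint csum (f : nat -> C) (n : nat) : C :=
  match n with O => RtoC 0 | S m => Cplus (csum f m) (f m) end.

Lemma rsum_S f n : rsum f (S n) = rsum f n + f n.
Proof. easy. Qed.

Lemma csum_S f n : csum f (S n) = Cplus (csum f n) (f n).
Proof. easy. Qed.

Lemma rsum_ext f g n : (forall i, (i < n)%nat -> f i = g i) -> rsum f n = rsum g n.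
Proof.
  induction n as [|n IH]; intros H; simpl; [easy|].
  rewrite IH by (intros; apply H; lia). now rewrite H by lia.
Qed.

Lemma rsum_le f g n : (forall i, (i < n)%nat -> f i <= g i) -> rsum f n <= rsum g n.
Proof.
  induction n as [|n IH]; intros H; simpl; [lra|].
  apply Rplus_le_compat; [apply IH; intros; apply H; lia | apply H; lia].
Qed.

Lemma rsum_zero n : rsum (fun _ => 0) n = 0.
Proof. induction n; simpl; lra. Qed.

Lemma rsum_nonneg f n : (forall i, (i < n)%nat -> 0 <= f i) -> 0 <= rsum f n.
Proof. intros H. rewrite <- (rsum_zero n). now apply rsum_le. Qed.

Lemma rsum_plus f g n : rsum (fun i => f i + g i) n = rsum f n + rsum g n.
Proof. induction n; simpl; lra. Qed.

Lemma rsum_scal c f n : rsum (fun i => c * f i) n = c * rsum f n.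
Proof. induction n; simpl; lra. Qed.

Lemma rsum_mono f n m :
  (n <= m)%nat -> (forall i, 0 <= f i) -> rsum f n <= rsum f m.
Proof. intros H Hf. induction H; simpl; [lra|]. specialize (Hf m). lra. Qed.

Lemma rsum_triangle (g : nat -> nat -> R) K :
  rsum (fun P => rsum (fun n => g n (P - n)%nat) (S P)) K
  = rsum (fun n => rsum (g n) (K - n)) K.
Proof.
  induction K as [|K IH]; [easy|].
  rewrite (rsum_S (fun P => rsum _ (S P))), IH.
  transitivity (rsum (fun n => rsum (g n) (K - n) + g n (K - n)%nat) (S K)).
  - rewrite rsum_plus, !rsum_S, Nat.sub_diag. simpl. lra.
  - apply rsum_ext; intros i Hi.
    replace (S K - i)%nat with (S (K - i)) by lia. easy.
Qed.

(** The rectangle lies in the triangle [n + m < N + M], which is then summed along antidiagonals,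
    where the entries of a Hankel matrix are constant. *)
Lemma rsum_rect_le (g : nat -> nat -> R) N M :
  (forall n m, 0 <= g n m) ->
  rsum (fun n => rsum (g n) M) N
  <= rsum (fun P => rsum (fun n => g n (P - n)%nat) (S P)) (N + M).
Proof.
  intros Hg. rewrite rsum_triangle.
  apply Rle_trans with (rsum (fun n => rsum (g n) (N + M - n)) N).
  - apply rsum_le; intros i Hi. apply rsum_mono; [lia|auto].
  - apply (rsum_mono (fun n => rsum (g n) (N + M - n))); [lia|].
    intros; apply rsum_nonneg; auto.
Qed.

Lemma rsum_shift f n : rsum f (S n) = f O + rsum (fun i => f (S i)) n.
Proof. induction n; simpl in *; lra. Qed.

Lemma rsum_rev f n : rsum (fun i => f (n - i)%nat) (S n) = rsum f (S n).
Proof.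
  induction n as [|n IH]; [easy|].
  rewrite rsum_shift. replace (S n - 0)%nat with (S n) by lia.
  rewrite (rsum_ext _ (fun i => f (n - i)%nat)) by (intros; f_equal; lia).
  rewrite IH. simpl. lra.
Qed.

(** After expansion it remains to see that [2 s x y <= a y^2 + b x^2]. This is AM-GM for the two
    terms on the right, as [s^2 <= a b]; squares are compared in order to avoid roots. *)
Lemma rsum_cauchy_step s a b x y :
  s ^ 2 <= a * b -> 0 <= a -> 0 <= b ->
  (s + x * y) ^ 2 <= (a + x ^ 2) * (b + y ^ 2).
Proof.
  intros IH Ha Hb.
  assert (H : 2 * (s * (x * y)) <= a * y ^ 2 + b * x ^ 2); [|nra].
  assert (H0 : 0 <= a * y ^ 2 + b * x ^ 2) by nra.
  apply Rnot_lt_le; intro Hlt.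
  assert (s ^ 2 * (x * y) ^ 2 <= a * b * (x * y) ^ 2)
    by (apply Rmult_le_compat_r; [apply pow2_ge_0|easy]).
  assert (0 <= (a * y ^ 2 - b * x ^ 2) ^ 2) by apply pow2_ge_0.
  assert ((a * y ^ 2 + b * x ^ 2) ^ 2 < (2 * (s * (x * y))) ^ 2)
    by (simpl; rewrite !Rmult_1_r; apply Rmult_le_0_lt_compat; lra).
  nra.
Qed.

Lemma rsum_cauchy f g n :
  (rsum (fun i => f i * g i) n) ^ 2
  <= rsum (fun i => f i ^ 2) n * rsum (fun i => g i ^ 2) n.
Proof.
  induction n as [|n IH]; simpl rsum; [lra|].
  apply rsum_cauchy_step; [apply IH| |];
    apply rsum_nonneg; intros; apply pow2_ge_0.
Qed.

Lemma csum_ext f g n : (forall i, (i < n)%nat -> f i = g i) -> csum f n = csum g n.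
Proof.
  induction n as [|n IH]; intros H; simpl; [easy|].
  rewrite IH by (intros; apply H; lia). now rewrite H by lia.
Qed.

Lemma csum_zero n : csum (fun _ => RtoC 0) n = RtoC 0.
Proof. induction n; simpl; [easy|]. rewrite IHn. ring. Qed.

Lemma csum_eq0 f n : (forall i, (i < n)%nat -> f i = RtoC 0) -> csum f n = RtoC 0.
Proof. intros H. rewrite <- (csum_zero n). now apply csum_ext. Qed.

Lemma csum_plus f g n : csum (fun i => Cplus (f i) (g i)) n = Cplus (csum f n) (csum g n).
Proof. induction n; simpl; [ring|]. rewrite IHn. ring. Qed.

Lemma csum_minus f g n : csum (fun i => Cminus (f i) (g i)) n = Cminus (csum f n) (csum g n).
Proof. induction n; simpl; [ring|]. rewrite IHn. ring. Qed.

Lemma csum_scal c f n : csum (fun i => Cmult c (f i)) n = Cmult c (csum f n).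
Proof. induction n; simpl; [ring|]. rewrite IHn. ring. Qed.

Lemma csum_scal_r c f n : csum (fun i => Cmult (f i) c) n = Cmult (csum f n) c.
Proof. induction n; simpl; [ring|]. rewrite IHn. ring. Qed.

Lemma csum_switch (g : nat -> nat -> C) n m :
  csum (fun i => csum (g i) m) n = csum (fun j => csum (fun i => g i j) n) m.
Proof.
  induction n; simpl; [now rewrite csum_zero|].
  now rewrite IHn, <- csum_plus.
Qed.

Lemma csum_add f n m : csum f (n + m) = Cplus (csum f n) (csum (fun i => f (n + i)%nat) m).
Proof.
  induction m as [|m IH]; simpl.
  - rewrite Nat.add_0_r. ring.
  - rewrite Nat.add_succ_r. simpl. rewrite IH. ring.
Qed.

Lemma csum_extend f n m :
  (n <= m)%nat -> (forall i, (n <= i)%nat -> f i = RtoC 0) -> csum f m = csum f n.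
Proof.
  intros H Hf. replace m with (n + (m - n))%nat by lia.
  rewrite csum_add, (csum_eq0 (fun i => f (n + i)%nat)) by (intros; apply Hf; lia). ring.
Qed.

Lemma csum_shift f n : csum f (S n) = Cplus (f O) (csum (fun i => f (S i)) n).
Proof. change (S n) with (1 + n)%nat. rewrite csum_add. simpl. ring. Qed.

Lemma Cconj_csum f n : Cconj (csum f n) = csum (fun i => Cconj (f i)) n.
Proof.
  induction n; simpl; [apply injective_projections; simpl; ring|].
  now rewrite Cplus_conj, IHn.
Qed.

Lemma Cmod_csum f n : Cmod (csum f n) <= rsum (fun i => Cmod (f i)) n.
Proof.
  induction n; simpl; [rewrite Cmod_0; lra|].
  eapply Rle_trans; [apply Cmod_triangle|lra].
Qed.

Lemma Re_csum f n : Re (csum f n) = rsum (fun i => Re (f i)) n.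
Proof. induction n; simpl in *; [easy|]. now rewrite <- IHn. Qed.

Lemma Im_csum f n : Im (csum f n) = rsum (fun i => Im (f i)) n.
Proof. induction n; simpl in *; [easy|]. now rewrite <- IHn. Qed.

Lemma Csum_upto_csum f n : Csum_upto f n = csum f (S n).
Proof. induction n; simpl in *; [ring|]. now rewrite IHn. Qed.

Lemma sum_n_rsum f n : sum_n f n = rsum f (S n).
Proof.
  induction n; [rewrite sum_O; simpl; lra|].
  rewrite sum_Sn, IHn. reflexivity.
Qed.

(** * Limits and series of complex numbers *)

Definition Clim (g : nat -> C) (l : C) : Prop :=
  is_lim_seq (fun M => Cmod (Cminus (g M) l)) 0.

Lemma is_lim_seq_0_le (f g : nat -> R) :
  (forall n, 0 <= f n <= g n) -> is_lim_seq g 0 -> is_lim_seq f 0.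
Proof.
  intros H Hg. apply (is_lim_seq_le_le (fun _ => 0) f g); auto.
  apply is_lim_seq_const.
Qed.

Lemma is_lim_seq_0_plus (f g : nat -> R) :
  is_lim_seq f 0 -> is_lim_seq g 0 -> is_lim_seq (fun n => f n + g n) 0.
Proof.
  intros Hf Hg. replace 0 with (0 + 0) by ring. now apply is_lim_seq_plus'.
Qed.

Lemma Clim_Re_Im g l :
  is_lim_seq (fun n => Re (g n)) (Re l) -> is_lim_seq (fun n => Im (g n)) (Im l) -> Clim g l.
Proof.
  intros H1 H2. unfold Clim.
  apply is_lim_seq_0_le with
    (fun n => Rabs (Re (g n) - Re l) + Rabs (Im (g n) - Im l)).
  - intros n. split; [apply Cmod_ge_0|].
    set (d := Cminus (g n) l).
    change (Re (g n) - Re l) with (Re d). change (Im (g n) - Im l) with (Im d).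
    replace d with (Cplus (RtoC (Re d)) (Cmult Ci (RtoC (Im d))))
      at 1 by (apply injective_projections; simpl; ring).
    eapply Rle_trans; [apply Cmod_triangle|].
    rewrite Cmod_mult, !Cmod_R, Cmod_Ci. lra.
  - apply is_lim_seq_0_plus.
    + rewrite <- Rabs_R0. apply (is_lim_seq_abs _ 0).
      replace 0 with (Re l - Re l) by ring.
      apply is_lim_seq_minus'; [easy|apply is_lim_seq_const].
    + rewrite <- Rabs_R0. apply (is_lim_seq_abs _ 0).
      replace 0 with (Im l - Im l) by ring.
      apply is_lim_seq_minus'; [easy|apply is_lim_seq_const].
Qed.

Lemma Rabs_Re_le c : Rabs (Re c) <= Cmod c.
Proof. eapply Rle_trans; [|apply Rmax_Cmod]. apply Rmax_l. Qed.

Lemma Rabs_Im_le c : Rabs (Im c) <= Cmod c.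
Proof. eapply Rle_trans; [|apply Rmax_Cmod]. apply Rmax_r. Qed.

Lemma is_lim_seq_of_dist (f : nat -> R) l (g : nat -> R) :
  (forall n, Rabs (f n - l) <= g n) -> is_lim_seq g 0 -> is_lim_seq f l.
Proof.
  intros H Hg.
  apply is_lim_seq_ext with (fun n => (f n - l) + l); [intros; ring|].
  cut (is_lim_seq (fun n => f n - l + l) (0 + l)); [now rewrite Rplus_0_l|].
  apply is_lim_seq_plus'; [|apply is_lim_seq_const].
  apply is_lim_seq_abs_0.
  apply is_lim_seq_0_le with g; auto.
  intros; split; [apply Rabs_pos|auto].
Qed.

Lemma Clim_Re g l : Clim g l -> is_lim_seq (fun n => Re (g n)) (Re l).
Proof.
  intros H. apply is_lim_seq_of_dist with (2 := H).
  intros n. apply (Rabs_Re_le (Cminus (g n) l)).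
Qed.

Lemma Clim_Im g l : Clim g l -> is_lim_seq (fun n => Im (g n)) (Im l).
Proof.
  intros H. apply is_lim_seq_of_dist with (2 := H).
  intros n. apply (Rabs_Im_le (Cminus (g n) l)).
Qed.

Lemma Cmod_dist a b : Rabs (Cmod a - Cmod b) <= Cmod (Cminus a b).
Proof.
  apply Rabs_le. split.
  - assert (H := Cmod_triangle (Cminus b a) a).
    replace (Cplus (Cminus b a) a) with b in H by ring.
    replace (Cminus b a) with (Copp (Cminus a b)) in H by ring.
    rewrite Cmod_opp in H. lra.
  - assert (H := Cmod_triangle (Cminus a b) b).
    replace (Cplus (Cminus a b) b) with a in H by ring. lra.
Qed.

Lemma Clim_Cmod g l : Clim g l -> is_lim_seq (fun n => Cmod (g n)) (Cmod l).
Proof.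
  intros H. apply is_lim_seq_of_dist with (2 := H). intros n. apply Cmod_dist.
Qed.

Lemma Clim_unique g l1 l2 : Clim g l1 -> Clim g l2 -> l1 = l2.
Proof.
  intros H1 H2. apply injective_projections.
  - assert (A := is_lim_seq_unique _ _ (Clim_Re _ _ H1)).
    assert (B := is_lim_seq_unique _ _ (Clim_Re _ _ H2)).
    rewrite A in B. now injection B.
  - assert (A := is_lim_seq_unique _ _ (Clim_Im _ _ H1)).
    assert (B := is_lim_seq_unique _ _ (Clim_Im _ _ H2)).
    rewrite A in B. now injection B.
Qed.

Lemma Clim_const l : Clim (fun _ => l) l.
Proof.
  unfold Clim. apply is_lim_seq_ext with (fun _ => 0); [|apply is_lim_seq_const].
  intros. replace (Cminus l l) with (RtoC 0) by ring. now rewrite Cmod_0.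
Qed.

Lemma Clim_ext_loc g h l :
  (exists N, forall n, (N <= n)%nat -> g n = h n) -> Clim g l -> Clim h l.
Proof.
  intros [N H]. apply is_lim_seq_ext_loc. exists N. intros n Hn. now rewrite H.
Qed.

Lemma Clim_ext g h l : Clim g l -> (forall n, g n = h n) -> Clim h l.
Proof. intros Hg H. apply Clim_ext_loc with (2 := Hg). exists O. auto. Qed.

Lemma Clim_plus g h a b : Clim g a -> Clim h b -> Clim (fun n => Cplus (g n) (h n)) (Cplus a b).
Proof.
  intros Hg Hh. apply is_lim_seq_0_le with (2 := is_lim_seq_0_plus _ _ Hg Hh).
  intros n; split; [apply Cmod_ge_0|].
  replace (Cminus (Cplus (g n) (h n)) (Cplus a b))
    with (Cplus (Cminus (g n) a) (Cminus (h n) b)) by ring.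
  apply Cmod_triangle.
Qed.

Lemma Clim_scal c g a : Clim g a -> Clim (fun n => Cmult c (g n)) (Cmult c a).
Proof.
  intros Hg. unfold Clim.
  apply is_lim_seq_ext with (fun n => Cmod c * Cmod (Cminus (g n) a)).
  - intros n. rewrite <- Cmod_mult. f_equal. ring.
  - replace 0 with (Cmod c * 0) by ring.
    apply is_lim_seq_mult'; [apply is_lim_seq_const|easy].
Qed.

Lemma bounded_rsum_ex_series f B :
  (forall n, 0 <= f n) -> (forall M, rsum f M <= B) -> ex_series f.
Proof.
  intros Hf HB. destruct (ex_finite_lim_seq_incr (sum_n f) B) as [l Hl].
  - intros n. rewrite sum_Sn. change plus with Rplus. specialize (Hf (S n)). lra.
  - intros n. rewrite sum_n_rsum. auto.
  - now exists l.
Qed.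

Lemma ex_series_bounded_rsum f :
  (forall n, 0 <= f n) -> ex_series f -> forall M, rsum f M <= Series f.
Proof.
  intros Hf Hs M.
  assert (H : is_lim_seq (sum_n f) (Series f)) by apply (Series_correct _ Hs).
  assert (Hi : forall n, sum_n f n <= sum_n f (S n)).
  { intros n. rewrite sum_Sn. change plus with Rplus. specialize (Hf (S n)). lra. }
  assert (H1 := is_lim_seq_incr_compare _ _ H Hi M).
  rewrite sum_n_rsum in H1. simpl in H1. specialize (Hf M). lra.
Qed.

Lemma Clim_csum_of_parts f :
  ex_series (fun n => Re (f n)) -> ex_series (fun n => Im (f n)) ->
  Clim (csum f) (CSeries f).
Proof.
  intros H1 H2. apply Clim_Re_Im.
  - apply is_lim_seq_incr_1.
    apply is_lim_seq_ext with (sum_n (fun n => Re (f n))).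
    + intros n. now rewrite sum_n_rsum, Re_csum.
    + apply (Series_correct _ H1).
  - apply is_lim_seq_incr_1.
    apply is_lim_seq_ext with (sum_n (fun n => Im (f n))).
    + intros n. now rewrite sum_n_rsum, Im_csum.
    + apply (Series_correct _ H2).
Qed.

Lemma Clim_csum f B :
  (forall M, rsum (fun n => Cmod (f n)) M <= B) -> Clim (csum f) (CSeries f).
Proof.
  intros H.
  assert (H0 : ex_series (fun n => Cmod (f n)))
    by (apply bounded_rsum_ex_series with B; auto; intros; apply Cmod_ge_0).
  apply Clim_csum_of_parts.
  - apply (@ex_series_le R_AbsRing R_CompleteNormedModule _ (fun n => Cmod (f n)));
      [|easy]. intros n. apply Rabs_Re_le.
  - apply (@ex_series_le R_AbsRing R_CompleteNormedModule _ (fun n => Cmod (f n)));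
      [|easy]. intros n. apply Rabs_Im_le.
Qed.

(** [CSeries] is total and meaningless on divergent series, so identities between infinite sums are
    obtained by exhibiting the limit of the partial sums. *)
Lemma CSeries_unique f l : Clim (csum f) l -> CSeries f = l.
Proof.
  intros H. unfold CSeries. apply injective_projections; simpl.
  - apply is_series_unique.
    change (is_lim_seq (sum_n (fun n => Re (f n))) (Re l)).
    apply is_lim_seq_ext with (fun n => Re (csum f (S n))).
    + intros n. now rewrite sum_n_rsum, Re_csum.
    + apply -> (is_lim_seq_incr_1 (fun n => Re (csum f n))). now apply Clim_Re.
  - apply is_series_unique.
    change (is_lim_seq (sum_n (fun n => Im (f n))) (Im l)).
    apply is_lim_seq_ext with (fun n => Im (csum f (S n))).
    + intros n. now rewrite sum_n_rsum, Im_csum.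
    + apply -> (is_lim_seq_incr_1 (fun n => Im (csum f n))). now apply Clim_Im.
Qed.

Lemma CSeries_fin f L : (forall n, (L <= n)%nat -> f n = RtoC 0) -> CSeries f = csum f L.
Proof.
  intros H. apply CSeries_unique.
  apply Clim_ext_loc with (2 := Clim_const _).
  exists L. intros n Hn. symmetry. now apply csum_extend.
Qed.

Lemma CSeries_ext f g : (forall n, f n = g n) -> CSeries f = CSeries g.
Proof. intros H. now rewrite (functional_extensionality f g H). Qed.

(** * Weighted l2 norms *)

(** A norm bound stated through partial sums contains summability and needs neither the value of a
    series nor a root. The weight [q] multiplies the squared modulus, and [0 <= B] is recorded
    because [B ^ 2] forgets the sign. *)
Definition nb (q : nat -> R) (x : seqC) (B : R) : Prop :=
  0 <= B /\ forall N, rsum (fun n => q n * Cmod (x n) ^ 2) N <= B ^ 2.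

Definition one_w (n : nat) : R := 1.
Definition nb1 := nb one_w.

Definition seq_add (a b : seqC) : seqC := fun n => Cplus (a n) (b n).
Definition seq_scal (c : C) (a : seqC) : seqC := fun n => Cmult c (a n).
Definition zero_seq : seqC := fun _ => RtoC 0.

Lemma nb_mono q x B B' : nb q x B -> B <= B' -> nb q x B'.
Proof.
  intros [H0 H] HB. split; [lra|]. intros N. eapply Rle_trans; [apply H|].
  apply pow_incr; lra.
Qed.

Lemma nb_nonneg q x B : nb q x B -> 0 <= B.
Proof. now intros []. Qed.

Lemma nb_le q q' x y B :
  (forall n, q' n * Cmod (y n) ^ 2 <= q n * Cmod (x n) ^ 2) -> nb q x B -> nb q' y B.
Proof.
  intros H [H0 H1]. split; [easy|]. intros N.
  eapply Rle_trans; [|apply (H1 N)]. apply rsum_le. auto.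
Qed.

Lemma nb_weight q q' x B : (forall n, q' n <= q n) -> nb q x B -> nb q' x B.
Proof.
  intros H. apply nb_le. intros n. apply Rmult_le_compat_r; [apply pow2_ge_0|auto].
Qed.

Lemma nb_zero q B : 0 <= B -> nb q zero_seq B.
Proof.
  intros HB. split; [easy|]. intros N.
  rewrite (rsum_ext _ (fun _ => 0)), rsum_zero; [apply pow2_ge_0|].
  intros. unfold zero_seq. rewrite Cmod_0. ring.
Qed.

Lemma nb_scal q c x B : nb q x B -> nb q (seq_scal c x) (Cmod c * B).
Proof.
  intros [H0 H]. split; [apply Rmult_le_pos; [apply Cmod_ge_0|easy]|].
  intros N. rewrite (rsum_ext _ (fun n => Cmod c ^ 2 * (q n * Cmod (x n) ^ 2))).
  - rewrite rsum_scal. replace ((Cmod c * B) ^ 2) with (Cmod c ^ 2 * B ^ 2) by ring.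
    apply Rmult_le_compat_l; [apply pow2_ge_0|auto].
  - intros n _. unfold seq_scal. rewrite Cmod_mult. ring.
Qed.

(** Minkowski's inequality: [sqrt (q n)] is moved into the two factors and Cauchy-Schwarz bounds the
    cross term. *)
Lemma nb_add q x y B D :
  (forall n, 0 <= q n) -> nb q x B -> nb q y D -> nb q (seq_add x y) (B + D).
Proof.
  intros Hq [HB Hx] [HD Hy]. split; [lra|]. intros N.
  set (f n := sqrt (q n) * Cmod (x n)). set (g n := sqrt (q n) * Cmod (y n)).
  assert (Hf : rsum (fun n => f n ^ 2) N <= B ^ 2).
  { eapply Rle_trans; [|apply (Hx N)]. right. apply rsum_ext. intros n _. unfold f.
    rewrite Rpow_mult_distr, pow2_sqrt; auto. }
  assert (Hg : rsum (fun n => g n ^ 2) N <= D ^ 2).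
  { eapply Rle_trans; [|apply (Hy N)]. right. apply rsum_ext. intros n _. unfold g.
    rewrite Rpow_mult_distr, pow2_sqrt; auto. }
  assert (Hfg : rsum (fun n => f n * g n) N <= B * D).
  { assert (H := rsum_cauchy f g N).
    apply Rnot_lt_le. intros Hlt.
    assert (Hf0 : 0 <= rsum (fun n => f n ^ 2) N)
      by (apply rsum_nonneg; intros; apply pow2_ge_0).
    assert (Hg0 : 0 <= rsum (fun n => g n ^ 2) N)
      by (apply rsum_nonneg; intros; apply pow2_ge_0).
    assert (H1 : rsum (fun n => f n ^ 2) N * rsum (fun n => g n ^ 2) N <= B ^ 2 * D ^ 2)
      by (apply Rmult_le_compat; auto).
    assert (H2 : 0 <= B * D) by (apply Rmult_le_pos; auto).
    assert (H3 : (B * D) * (B * D)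
                 < rsum (fun n => f n * g n) N * rsum (fun n => f n * g n) N)
      by (apply Rmult_le_0_lt_compat; auto).
    nra. }
  apply Rle_trans with
    (rsum (fun n => f n ^ 2 + (g n ^ 2 + 2 * (f n * g n))) N).
  - apply rsum_le. intros n _. unfold seq_add.
    replace (f n ^ 2 + (g n ^ 2 + 2 * (f n * g n))) with ((f n + g n) ^ 2) by ring.
    unfold f, g. rewrite <- Rmult_plus_distr_l, Rpow_mult_distr, pow2_sqrt by auto.
    apply Rmult_le_compat_l; auto. apply pow_incr.
    split; [apply Cmod_ge_0|apply Cmod_triangle].
  - rewrite !rsum_plus, rsum_scal. nra.
Qed.

Lemma seq_sub_scal x y : seq_sub x y = seq_add x (seq_scal (RtoC (-1)) y).
Proof.
  apply functional_extensionality. intros n. unfold seq_sub, seq_add, seq_scal.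
  apply injective_projections; simpl; ring.
Qed.

Lemma nb_opp q x B : nb q x B -> nb q (seq_scal (RtoC (-1)) x) B.
Proof.
  intros H. eapply nb_mono; [apply nb_scal, H|].
  rewrite Cmod_R, Rabs_left by lra. lra.
Qed.

Lemma nb_sub q x y B D :
  (forall n, 0 <= q n) -> nb q x B -> nb q y D -> nb q (seq_sub x y) (B + D).
Proof. intros. rewrite seq_sub_scal. apply nb_add; auto. now apply nb_opp. Qed.

Lemma nb_coord q x B n : (forall n, 0 <= q n) -> nb q x B -> sqrt (q n) * Cmod (x n) <= B.
Proof.
  intros Hq [HB H]. specialize (H (S n)). rewrite rsum_S in H.
  assert (0 <= rsum (fun k => q k * Cmod (x k) ^ 2) n).
  { apply rsum_nonneg. intros. apply Rmult_le_pos; [auto|apply pow2_ge_0]. }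
  apply Rnot_lt_le. intros Hlt.
  assert (B * B < (sqrt (q n) * Cmod (x n)) * (sqrt (q n) * Cmod (x n)))
    by (apply Rmult_le_0_lt_compat; auto).
  assert (E := pow2_sqrt _ (Hq n)). nra.
Qed.

Lemma nb1_coord x B n : nb1 x B -> Cmod (x n) <= B.
Proof.
  intros H. assert (H1 := nb_coord one_w x B n ltac:(unfold one_w; intros; lra) H).
  unfold one_w in H1. rewrite sqrt_1 in H1. lra.
Qed.

Lemma is_lim_seq_rsum (f : nat -> nat -> R) (l : nat -> R) N :
  (forall n, is_lim_seq (fun M => f M n) (l n)) ->
  is_lim_seq (fun M => rsum (f M) N) (rsum l N).
Proof.
  intros H. induction N; simpl; [apply is_lim_seq_const|].
  apply is_lim_seq_plus'; [apply IHN|apply H].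
Qed.

(** A form of Fatou's lemma: a partial sum involves finitely many coefficients, so coefficientwise
    convergence suffices. Infinite sums inherit their norm bounds from finite ones in this way. *)
Lemma nb_limit q (y : nat -> seqC) x (Bn : nat -> R) (B : R) :
  (forall n, Clim (fun M => y M n) (x n)) -> (forall M, nb q (y M) (Bn M)) ->
  is_lim_seq Bn B -> nb q x B.
Proof.
  intros Hc Hy HB. split.
  - apply (is_lim_seq_le (fun _ => 0) Bn 0 B); auto.
    + intros M. apply (Hy M).
    + apply is_lim_seq_const.
  - intros N.
    apply (is_lim_seq_le (fun M => rsum (fun n => q n * Cmod (y M n) ^ 2) N)
             (fun M => Bn M ^ 2) (rsum (fun n => q n * Cmod (x n) ^ 2) N) (B ^ 2)).
    + intros M. apply (Hy M).
    + apply (is_lim_seq_rsum (fun M n => q n * Cmod (y M n) ^ 2)). intros n. simpl.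
      apply is_lim_seq_mult'; [apply is_lim_seq_const|].
      apply is_lim_seq_mult'; [now apply Clim_Cmod|].
      apply is_lim_seq_mult'; [now apply Clim_Cmod|apply is_lim_seq_const].
    + simpl. apply is_lim_seq_mult'; [easy|].
      apply is_lim_seq_mult'; [easy|apply is_lim_seq_const].
Qed.

Lemma ex_series_nb q x :
  (forall n, 0 <= q n) -> ex_series (fun n => q n * Cmod (x n) ^ 2) ->
  nb q x (sqrt (Series (fun n => q n * Cmod (x n) ^ 2))).
Proof.
  intros Hq H. assert (Hp : forall n, 0 <= q n * Cmod (x n) ^ 2)
    by (intros; apply Rmult_le_pos; [auto|apply pow2_ge_0]).
  assert (HB := ex_series_bounded_rsum _ Hp H).
  split; [apply sqrt_pos|]. intros N. rewrite pow2_sqrt; [apply HB|].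
  apply (HB O).
Qed.

Lemma nb_ex_series q x B :
  (forall n, 0 <= q n) -> nb q x B -> ex_series (fun n => q n * Cmod (x n) ^ 2).
Proof.
  intros Hq [_ H]. apply bounded_rsum_ex_series with (B ^ 2); auto.
  intros; apply Rmult_le_pos; [auto|apply pow2_ge_0].
Qed.

Lemma l2_nb1 x : l2 x <-> exists B, nb1 x B.
Proof.
  assert (E : (fun n => one_w n * Cmod (x n) ^ 2) = (fun n => Cmod (x n) ^ 2))
    by (apply functional_extensionality; intros; unfold one_w; ring).
  assert (P : forall n, 0 <= one_w n) by (intros; unfold one_w; lra).
  split.
  - intros H. eexists. apply ex_series_nb; [auto|]. now rewrite E.
  - intros [B H]. apply nb_ex_series in H; auto. now rewrite E in H.
Qed.

(** * Weighted bounds for Hankel operators *)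

(** Absolute convergence of every coefficient is all that additivity of [H_a x] in [a] and in [x]
    requires. It covers both weighted bounds and finitely supported data. *)
Definition hankel_conv (a x : seqC) : Prop :=
  forall n, exists B, forall M, rsum (fun m => Cmod (a (n + m)%nat) * Cmod (x m)) M <= B.

Lemma Hankel_Clim a x n :
  hankel_conv a x ->
  Clim (csum (fun m => Cmult (a (n + m)%nat) (Cconj (x m)))) (Hankel a x n).
Proof.
  intros H. destruct (H n) as [B HB]. apply Clim_csum with B.
  intros M. eapply Rle_trans; [|apply (HB M)]. right. apply rsum_ext.
  intros. now rewrite Cmod_mult, Cmod_conj.
Qed.

Lemma Hankel_add_r a x y :
  hankel_conv a x -> hankel_conv a y ->
  Hankel a (seq_add x y) = seq_add (Hankel a x) (Hankel a y).
Proof.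
  intros Hx Hy. apply functional_extensionality. intros n.
  apply CSeries_unique.
  eapply Clim_ext; [apply Clim_plus; [apply (Hankel_Clim a x n Hx)|apply (Hankel_Clim a y n Hy)]|].
  intros M. cbv beta. rewrite <- csum_plus. apply csum_ext. intros. unfold seq_add.
  rewrite Cplus_conj. ring.
Qed.

Lemma Hankel_add_l a b x :
  hankel_conv a x -> hankel_conv b x ->
  Hankel (seq_add a b) x = seq_add (Hankel a x) (Hankel b x).
Proof.
  intros Hx Hy. apply functional_extensionality. intros n.
  apply CSeries_unique.
  eapply Clim_ext; [apply Clim_plus; [apply (Hankel_Clim a x n Hx)|apply (Hankel_Clim b x n Hy)]|].
  intros M. cbv beta. rewrite <- csum_plus. apply csum_ext. intros. unfold seq_add. ring.
Qed.

Lemma Hankel_scal_r a c x :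
  hankel_conv a x -> Hankel a (seq_scal c x) = seq_scal (Cconj c) (Hankel a x).
Proof.
  intros Hx. apply functional_extensionality. intros n.
  apply CSeries_unique.
  eapply Clim_ext; [apply Clim_scal, (Hankel_Clim a x n Hx)|].
  intros M. cbv beta. rewrite <- csum_scal. apply csum_ext. intros. unfold seq_scal.
  rewrite Cmult_conj. ring.
Qed.

Lemma Hankel_scal_l a c x :
  hankel_conv a x -> Hankel (seq_scal c a) x = seq_scal c (Hankel a x).
Proof.
  intros Hx. apply functional_extensionality. intros n.
  apply CSeries_unique.
  eapply Clim_ext; [apply Clim_scal, (Hankel_Clim a x n Hx)|].
  intros M. cbv beta. rewrite <- csum_scal. apply csum_ext. intros. unfold seq_scal. ring.
Qed.

(* Cauchy-Schwarz in [m] with weight [p], then summation over the antidiagonals [n + m = P]. *)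
Lemma hankel_sum_bound p q r a x A X :
  (forall n, 0 < p n) -> (forall n, 0 < q n) ->
  (forall P, rsum (fun n => q n / p (P - n)%nat) (S P) <= r P) ->
  nb r a A -> nb p x X ->
  forall M, nb q (fun n => RtoC (rsum (fun m => Cmod (a (n + m)%nat) * Cmod (x m)) M)) (A * X).
Proof.
  intros Hp Hq Hr [HA Ha] [HX Hx] M. split; [now apply Rmult_le_pos|]. intros N.
  set (g n m := q n / p m * Cmod (a (n + m)%nat) ^ 2).
  assert (Hg : forall n m, 0 <= g n m).
  { intros n m. unfold g. apply Rmult_le_pos; [|apply pow2_ge_0].
    apply Rlt_le, Rdiv_lt_0_compat; auto. }
  apply Rle_trans with (rsum (fun n => X ^ 2 * rsum (g n) M) N).
  - apply rsum_le. intros n _.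
    set (s := rsum (fun m => Cmod (a (n + m)%nat) * Cmod (x m)) M).
    rewrite Cmod_R, pow2_abs.
    assert (H : s ^ 2 <= rsum (fun m => / p m * Cmod (a (n + m)%nat) ^ 2) M
                        * rsum (fun m => p m * Cmod (x m) ^ 2) M).
    { unfold s. rewrite (rsum_ext _ (fun m => (sqrt (/ p m) * Cmod (a (n + m)%nat))
                                         * (sqrt (p m) * Cmod (x m)))).
      - eapply Rle_trans; [apply rsum_cauchy|]. right. f_equal; apply rsum_ext; intros m _;
          rewrite Rpow_mult_distr, pow2_sqrt; auto.
        + apply Rlt_le, Rinv_0_lt_compat; auto.
        + apply Rlt_le; auto.
      - intros m _. transitivity (sqrt (/ p m) * sqrt (p m) * (Cmod (a (n + m)%nat) * Cmod (x m)));
          [|ring].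
        rewrite <- sqrt_mult_alt by (apply Rlt_le, Rinv_0_lt_compat; auto).
        rewrite Rinv_l, sqrt_1; [ring|]. specialize (Hp m). lra. }
    assert (H0 : 0 <= rsum (fun m => / p m * Cmod (a (n + m)%nat) ^ 2) M).
    { apply rsum_nonneg. intros. apply Rmult_le_pos; [|apply pow2_ge_0].
      apply Rlt_le, Rinv_0_lt_compat; auto. }
    replace (rsum (g n) M) with (q n * rsum (fun m => / p m * Cmod (a (n + m)%nat) ^ 2) M).
    + assert (H1 := Rmult_le_compat_l _ _ _ H0 (Hx M)). specialize (Hq n). nra.
    + rewrite <- rsum_scal. apply rsum_ext. intros. unfold g. unfold Rdiv. ring.
  - rewrite rsum_scal. replace ((A * X) ^ 2) with (X ^ 2 * A ^ 2) by ring.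
    apply Rmult_le_compat_l; [apply pow2_ge_0|].
    eapply Rle_trans; [apply (rsum_rect_le g), Hg|].
    eapply Rle_trans; [|apply (Ha (N + M)%nat)].
    apply rsum_le. intros P _.
    rewrite (rsum_ext _ (fun n => Cmod (a P) ^ 2 * (q n / p (P - n)%nat))).
    + rewrite rsum_scal, Rmult_comm. apply Rmult_le_compat_r; [apply pow2_ge_0|auto].
    + intros n Hn. unfold g. replace (n + (P - n))%nat with P by lia. ring.
Qed.

Lemma hankel_conv_of_nb p q r a x A X :
  (forall n, 0 < p n) -> (forall n, 0 < q n) ->
  (forall P, rsum (fun n => q n / p (P - n)%nat) (S P) <= r P) ->
  nb r a A -> nb p x X -> hankel_conv a x.
Proof.
  intros Hp Hq Hr Ha Hx n. exists (A * X / sqrt (q n)). intros M.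
  assert (H := hankel_sum_bound p q r a x A X Hp Hq Hr Ha Hx M).
  apply nb_coord with (n := n) in H; [|intros; apply Rlt_le; auto].
  rewrite Cmod_R in H.
  assert (Hs := sqrt_lt_R0 _ (Hq n)).
  apply Rmult_le_reg_l with (sqrt (q n)); [easy|].
  replace (sqrt (q n) * (A * X / sqrt (q n))) with (A * X) by (field; lra).
  eapply Rle_trans; [|apply H]. apply Rmult_le_compat_l; [lra|apply Rle_abs].
Qed.

Lemma nb_Hankel p q r a x A X :
  (forall n, 0 < p n) -> (forall n, 0 < q n) ->
  (forall P, rsum (fun n => q n / p (P - n)%nat) (S P) <= r P) ->
  nb r a A -> nb p x X -> nb q (Hankel a x) (A * X).
Proof.
  intros Hp Hq Hr Ha Hx.
  apply nb_limit with
    (y := fun M n => csum (fun m => Cmult (a (n + m)%nat) (Cconj (x m))) M)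
    (Bn := fun _ => A * X); [|intros M|apply is_lim_seq_const].
  - intros n. apply Hankel_Clim, (hankel_conv_of_nb p q r a x A X); auto.
  - eapply nb_le; [|apply (hankel_sum_bound p q r a x A X Hp Hq Hr Ha Hx M)].
    intros n. cbv beta. apply Rmult_le_compat_l; [apply Rlt_le; auto|].
    apply pow_incr. split; [apply Cmod_ge_0|].
    eapply Rle_trans; [apply Cmod_csum|]. rewrite Cmod_R.
    eapply Rle_trans; [|apply Rle_abs]. right. apply rsum_ext. intros.
    now rewrite Cmod_mult, Cmod_conj.
Qed.

(* The weights (of squared moduli) of [H^{1/2}], [H^{1/4}] and [H^{-1/4}]. *)
Definition hw (n : nat) : R := 1 + INR n.
Definition w (n : nat) : R := sqrt (hw n).
Definition wi (n : nat) : R := / w n.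

Lemma hw_ge1 n : 1 <= hw n.
Proof. unfold hw. assert (H := pos_INR n). lra. Qed.

Lemma w_ge1 n : 1 <= w n.
Proof. unfold w. rewrite <- sqrt_1 at 1. apply sqrt_le_1_alt, hw_ge1. Qed.

Lemma w_sq n : w n * w n = hw n.
Proof. apply sqrt_sqrt. assert (H := hw_ge1 n). lra. Qed.

Lemma wi_pos n : 0 < wi n.
Proof. apply Rinv_0_lt_compat. assert (H := w_ge1 n). lra. Qed.

Lemma wi_le1 n : wi n <= 1.
Proof. unfold wi. rewrite <- Rinv_1. apply Rinv_le_contravar; [lra|apply w_ge1]. Qed.

Lemma w_le_hw n : w n <= hw n.
Proof. rewrite <- w_sq. assert (H := w_ge1 n). nra. Qed.

Lemma w_mono n m : (n <= m)%nat -> w n <= w m.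
Proof. intros H. apply sqrt_le_1_alt. unfold hw. apply le_INR in H. lra. Qed.

Lemma hw_S n : hw (S n) = hw n + 1.
Proof. unfold hw. rewrite S_INR. ring. Qed.

(** Comparison of [h^{-1/2}] with its primitive [2 h^{1/2}]; the right side telescopes. With
    [s = sqrt (h - 1)] it amounts to [(w n - s)^2 >= 0]. *)
Lemma w_S_sub n : wi n <= 2 * (sqrt (hw n) - sqrt (hw n - 1)).
Proof.
  assert (Hw := w_ge1 n). assert (Hs := w_sq n). fold (w n). unfold wi.
  set (s := sqrt (hw n - 1)).
  assert (H0 : 0 <= s) by apply sqrt_pos.
  assert (H1 : s * s = hw n - 1) by (apply sqrt_sqrt; assert (H := hw_ge1 n); lra).
  apply Rmult_le_reg_l with (w n); [lra|]. rewrite Rinv_r by lra.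
  assert (0 <= (w n - s) ^ 2) by apply pow2_ge_0. nra.
Qed.

Lemma rsum_wi P : rsum wi (S P) <= 2 * w P.
Proof.
  induction P as [|P IH].
  - simpl. unfold wi, w, hw. simpl. rewrite Rplus_0_r, sqrt_1. lra.
  - rewrite rsum_S. assert (H := w_S_sub (S P)).
    replace (hw (S P) - 1) with (hw P) in H by (rewrite hw_S; ring).
    fold (w P) (w (S P)) in H. lra.
Qed.

Lemma rsum_wi_rev P : rsum (fun n => wi (P - n)%nat) (S P) = rsum wi (S P).
Proof. apply rsum_rev. Qed.

Lemma rsum_hw_inv P : rsum (fun n => one_w n / hw (P - n)%nat) (S P) <= 2 * w P.
Proof.
  eapply Rle_trans; [|apply rsum_wi]. rewrite <- rsum_wi_rev.
  apply rsum_le. intros n _. unfold one_w, wi. unfold Rdiv. rewrite Rmult_1_l.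
  assert (H := w_ge1 (P - n)). apply Rinv_le_contravar; [lra|apply w_le_hw].
Qed.

Lemma rsum_w_ratio P : rsum (fun n => w n / w (P - n)%nat) (S P) <= 2 * hw P.
Proof.
  apply Rle_trans with (rsum (fun n => w P * wi (P - n)%nat) (S P)).
  - apply rsum_le. intros n Hn. unfold Rdiv. apply Rmult_le_compat_r.
    + apply Rlt_le, wi_pos.
    + apply w_mono. lia.
  - rewrite rsum_scal, rsum_wi_rev. assert (H := rsum_wi P). assert (H1 := w_ge1 P).
    rewrite <- w_sq. nra.
Qed.

Lemma rsum_wi_ratio P : rsum (fun n => wi n / wi (P - n)%nat) (S P) <= 2 * hw P.
Proof.
  rewrite <- rsum_rev. eapply Rle_trans; [|apply rsum_w_ratio]. right.
  apply rsum_ext. intros n Hn. replace (P - (P - n))%nat with n by lia.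
  unfold wi, Rdiv. rewrite Rinv_inv. ring.
Qed.

(** [P + 1] entries of a Hankel matrix lie on the antidiagonal [P]: the [H^{1/2}] norm of the symbol
    is the Hilbert-Schmidt norm of the operator. *)
Lemma rsum_one_ratio P : rsum (fun n => one_w n / one_w (P - n)%nat) (S P) <= hw P.
Proof.
  unfold one_w, hw. right. transitivity (INR (S P)).
  - induction P as [|P IH]; [simpl; lra|]. rewrite rsum_S, IH, (S_INR (S P)). lra.
  - rewrite S_INR. ring.
Qed.

(** Partial fractions, [1/(ab) = (1/a + 1/b)/(a + b)], together with the subadditivity of the square
    root, [w (n + m) <= w n + w m]. *)
Lemma wi_wi_le n m : wi n * wi m <= (wi n + wi m) * wi (n + m).
Proof.
  assert (Hn := w_ge1 n). assert (Hm := w_ge1 m). assert (Hnm := w_ge1 (n + m)).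
  unfold wi.
  assert (Hk : w (n + m) <= w n + w m).
  { apply Rnot_lt_le. intros Hlt.
    assert (H : (w n + w m) * (w n + w m) < w (n + m) * w (n + m))
      by (apply Rmult_le_0_lt_compat; lra).
    assert (E1 := w_sq n). assert (E2 := w_sq m). rewrite w_sq in H.
    unfold hw in *. rewrite plus_INR in H. nra. }
  apply Rmult_le_reg_l with (w n * w m * w (n + m)).
  { repeat apply Rmult_lt_0_compat; lra. }
  field_simplify; lra.
Qed.

(** The discrete [B(1/2,1/2)]. That the bound does not grow with [P] is what lets a symbol in [l^2]
    map [H^{1/4}] to its dual. *)
Lemma rsum_wi_wi P : rsum (fun n => wi n / w (P - n)%nat) (S P) <= 4.
Proof.
  apply Rle_trans with (rsum (fun n => wi P * (wi n + wi (P - n)%nat)) (S P)).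
  - apply rsum_le. intros n Hn. change (wi n / w (P - n)%nat) with (wi n * wi (P - n)%nat).
    assert (H := wi_wi_le n (P - n)). replace (n + (P - n))%nat with P in H by lia. lra.
  - rewrite rsum_scal, rsum_plus, rsum_wi_rev.
    assert (H := rsum_wi P). assert (H1 := w_ge1 P). unfold wi at 1.
    apply Rmult_le_reg_l with (w P); [lra|]. rewrite <- Rmult_assoc, Rinv_r by lra. lra.
Qed.

Lemma pos_one n : 0 < one_w n. Proof. unfold one_w; lra. Qed.
Lemma pos_hw n : 0 < hw n. Proof. assert (H := hw_ge1 n); lra. Qed.
Lemma pos_w n : 0 < w n. Proof. assert (H := w_ge1 n); lra. Qed.
Lemma nn_one n : 0 <= one_w n. Proof. apply Rlt_le, pos_one. Qed.
Lemma nn_hw n : 0 <= hw n. Proof. apply Rlt_le, pos_hw. Qed.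
Lemma nn_w n : 0 <= w n. Proof. apply Rlt_le, pos_w. Qed.
Lemma nn_wi n : 0 <= wi n. Proof. apply Rlt_le, wi_pos. Qed.

(** The factor [sqrt 2] would do; [2] keeps the constants free of roots. *)
Lemma nb_2hw a A : nb hw a A -> nb (fun P => 2 * hw P) a (2 * A).
Proof.
  intros [H0 H]. split; [lra|]. intros N.
  rewrite (rsum_ext _ (fun n => 2 * (hw n * Cmod (a n) ^ 2))) by (intros; ring).
  rewrite rsum_scal. specialize (H N). nra.
Qed.

Lemma nb_2w a A : nb w a A -> nb (fun P => 2 * w P) a (2 * A).
Proof.
  intros [H0 H]. split; [lra|]. intros N.
  rewrite (rsum_ext _ (fun n => 2 * (w n * Cmod (a n) ^ 2))) by (intros; ring).
  rewrite rsum_scal. specialize (H N). nra.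
Qed.

Lemma nb_4 a A : nb1 a A -> nb (fun _ => 4) a (2 * A).
Proof.
  intros [H0 H]. split; [lra|]. intros N.
  rewrite (rsum_ext _ (fun n => 4 * (one_w n * Cmod (a n) ^ 2))) by (intros; unfold one_w; ring).
  rewrite rsum_scal. specialize (H N). nra.
Qed.

Lemma nb_Hankel_l2 a x A X : nb hw a A -> nb1 x X -> nb1 (Hankel a x) (A * X).
Proof. apply nb_Hankel; auto using pos_one, rsum_one_ratio. Qed.

Lemma hankel_conv_l2 a x A X : nb hw a A -> nb1 x X -> hankel_conv a x.
Proof. apply hankel_conv_of_nb with (q := one_w); auto using pos_one, rsum_one_ratio. Qed.

Lemma nb_Hankel_w a x A X : nb hw a A -> nb w x X -> nb w (Hankel a x) (2 * A * X).
Proof.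
  intros Ha Hx. apply nb_2hw in Ha. revert Ha Hx.
  apply nb_Hankel; auto using pos_w, rsum_w_ratio.
Qed.

Lemma nb_Hankel_wi a x A X : nb hw a A -> nb wi x X -> nb wi (Hankel a x) (2 * A * X).
Proof.
  intros Ha Hx. apply nb_2hw in Ha. revert Ha Hx.
  apply nb_Hankel; auto using wi_pos, rsum_wi_ratio.
Qed.

Lemma nb_Hankel_w_wi a x A X : nb1 a A -> nb w x X -> nb wi (Hankel a x) (2 * A * X).
Proof.
  intros Ha Hx. apply nb_4 in Ha. revert Ha Hx.
  apply nb_Hankel; auto using wi_pos, pos_w, rsum_wi_wi.
Qed.

(** Made for the cubic term [H_{u^2} u]: the symbol [u^2] is only controlled in [H^{1/4}], and the
    argument [u] in [H^{1/2}] makes up for it. *)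
Lemma nb_Hankel_w_hw d a D A : nb w d D -> nb hw a A -> nb1 (Hankel d a) (2 * D * A).
Proof.
  intros Hd Ha. apply nb_2w in Hd. revert Hd Ha.
  apply nb_Hankel; auto using pos_one, pos_hw, rsum_hw_inv.
Qed.

Lemma hankel_conv_w_hw d a D A : nb w d D -> nb hw a A -> hankel_conv d a.
Proof.
  intros Hd Ha. apply nb_2w in Hd. revert Hd Ha.
  apply hankel_conv_of_nb with (q := one_w); auto using pos_one, pos_hw, rsum_hw_inv.
Qed.

(** * The cubic nonlinearity *)

Definition conv (b c : seqC) : seqC :=
  fun P => csum (fun k => Cmult (b k) (c (P - k)%nat)) (S P).

(** [|u|^2 u] is [u^2] times the conjugate of [u], and [conv a a] holds the coefficients of
    [u^2]. *)
Lemma szego_nl_Hankel a : szego_nl a = Hankel (conv a a) a.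
Proof.
  apply functional_extensionality. intros n. apply CSeries_ext. intros l.
  rewrite Csum_upto_csum. unfold conv. ring.
Qed.

(** Cauchy-Schwarz on each antidiagonal with the weights [w k * w (P - k)]. As
    [(1 + k)(1 + P - k) >= 1 + P], one factor [wi k * wi (P - k)] is at most [wi P], and the sum of
    the other one is at most 4. *)
Lemma nb_conv b c B D : nb hw b B -> nb hw c D -> nb w (conv b c) (2 * B * D).
Proof.
  intros [HB Hb] [HD Hc]. split; [repeat apply Rmult_le_pos; lra|]. intros N.
  set (g k m := (hw k * Cmod (b k) ^ 2) * (hw m * Cmod (c m) ^ 2)).
  assert (Hg : forall k m, 0 <= g k m).
  { intros. unfold g. repeat apply Rmult_le_pos; auto using nn_hw, Cmod_ge_0; lra. }
  apply Rle_trans with (rsum (fun P => 4 * rsum (fun k => g k (P - k)%nat) (S P)) N).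
  - apply rsum_le. intros P _.
    set (s := rsum (fun k => Cmod (b k) * Cmod (c (P - k)%nat)) (S P)).
    assert (Hs : Cmod (conv b c P) <= s).
    { eapply Rle_trans; [apply Cmod_csum|]. right. apply rsum_ext. intros. apply Cmod_mult. }
    assert (H : s ^ 2 <= rsum (fun k => g k (P - k)%nat) (S P) * (4 * wi P)).
    { unfold s.
      rewrite (rsum_ext _ (fun k => (w k * Cmod (b k) * (w (P - k) * Cmod (c (P - k)%nat)))
                               * (wi k * wi (P - k)))).
      - eapply Rle_trans; [apply rsum_cauchy|]. apply Rmult_le_compat.
        + apply rsum_nonneg. intros; apply pow2_ge_0.
        + apply rsum_nonneg. intros; apply pow2_ge_0.
        + right. apply rsum_ext. intros k _. unfold g. rewrite <- !w_sq. ring.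
        + apply Rle_trans with (rsum (fun k => wi P * (wi k / w (P - k))) (S P)).
          * apply rsum_le. intros k Hk.
            change (wi k / w (P - k)) with (wi k * wi (P - k)).
            assert (H1 := wi_pos k). assert (H2 := wi_pos (P - k)).
            assert (H3 : wi k * wi (P - k) <= wi P).
            { unfold wi. rewrite <- Rinv_mult.
              assert (Hk1 := w_ge1 k). assert (Hk2 := w_ge1 (P - k)). assert (HP := w_ge1 P).
              apply Rinv_le_contravar; [lra|].
              unfold w. rewrite <- sqrt_mult_alt by apply nn_hw. apply sqrt_le_1_alt.
              unfold hw. rewrite minus_INR by lia.
              assert (INR k <= INR P) by (apply le_INR; lia). assert (H4 := pos_INR k). nra. }
            assert (0 < wi k * wi (P - k)) by (apply Rmult_lt_0_compat; auto). nra.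
          * rewrite rsum_scal. assert (H1 := rsum_wi_wi P). assert (H2 := wi_pos P). nra.
      - intros k _. unfold wi. assert (H1 := w_ge1 k). assert (H2 := w_ge1 (P - k)).
        field; lra. }
    assert (H1 : Cmod (conv b c P) ^ 2 <= s ^ 2)
      by (apply pow_incr; split; [apply Cmod_ge_0|easy]).
    assert (HP := w_ge1 P).
    apply Rle_trans with (w P * s ^ 2); [apply Rmult_le_compat_l; lra|].
    apply Rle_trans with (w P * (rsum (fun k => g k (P - k)%nat) (S P) * (4 * wi P)));
      [apply Rmult_le_compat_l; lra|].
    right. unfold wi. field. lra.
  - rewrite rsum_scal, rsum_triangle.
    apply Rle_trans with (4 * rsum (fun n => hw n * Cmod (b n) ^ 2 * D ^ 2) N).
    + apply Rmult_le_compat_l; [lra|]. apply rsum_le. intros n _. unfold g.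
      rewrite rsum_scal. apply Rmult_le_compat_l; [|apply Hc].
      apply Rmult_le_pos; [apply nn_hw|apply pow2_ge_0].
    + rewrite (rsum_ext _ (fun n => D ^ 2 * (hw n * Cmod (b n) ^ 2))) by (intros; ring).
      rewrite rsum_scal. specialize (Hb N). assert (0 <= D ^ 2) by apply pow2_ge_0. nra.
Qed.

Lemma conv_sub_l a b c : conv (seq_sub a b) c = seq_sub (conv a c) (conv b c).
Proof.
  apply functional_extensionality. intros n. unfold conv, seq_sub.
  rewrite <- csum_minus. apply csum_ext. intros. ring.
Qed.

Lemma conv_sub_r a b c : conv c (seq_sub a b) = seq_sub (conv c a) (conv c b).
Proof.
  apply functional_extensionality. intros n. unfold conv, seq_sub.
  rewrite <- csum_minus. apply csum_ext. intros. ring.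
Qed.

Lemma Hankel_sub_r a x y :
  hankel_conv a x -> hankel_conv a y ->
  Hankel a (seq_sub x y) = seq_sub (Hankel a x) (Hankel a y).
Proof.
  intros Hx Hy. rewrite !seq_sub_scal.
  assert (Hy' : hankel_conv a (seq_scal (RtoC (-1)) y)).
  { intros n. destruct (Hy n) as [B HB]. exists B. intros M.
    eapply Rle_trans; [|apply (HB M)]. right. apply rsum_ext. intros. unfold seq_scal.
    rewrite Cmod_mult, Cmod_R, Rabs_left by lra. ring. }
  rewrite Hankel_add_r, Hankel_scal_r by auto. f_equal. f_equal.
  apply injective_projections; simpl; ring.
Qed.

Lemma Hankel_sub_l a b x :
  hankel_conv a x -> hankel_conv b x ->
  Hankel (seq_sub a b) x = seq_sub (Hankel a x) (Hankel b x).
Proof.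
  intros Hx Hy. rewrite !seq_sub_scal.
  assert (Hy' : hankel_conv (seq_scal (RtoC (-1)) b) x).
  { intros n. destruct (Hy n) as [B HB]. exists B. intros M.
    eapply Rle_trans; [|apply (HB M)]. right. apply rsum_ext. intros. unfold seq_scal.
    rewrite Cmod_mult, Cmod_R, Rabs_left by lra. ring. }
  now rewrite Hankel_add_l, Hankel_scal_l by auto.
Qed.

Lemma nb_szego_nl a A : nb hw a A -> nb1 (szego_nl a) (4 * A ^ 3).
Proof.
  intros Ha. rewrite szego_nl_Hankel.
  replace (4 * A ^ 3) with (2 * (2 * A * A) * A) by ring.
  apply nb_Hankel_w_hw; auto using nb_conv.
Qed.

(** The cubic term is trilinear: the difference splits into three terms with one factor [a - b]
    each, and each of them is at most [4 A^2 d]. *)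
Lemma nb_szego_nl_sub a b A d :
  nb hw a A -> nb hw b A -> nb hw (seq_sub a b) d ->
  nb1 (seq_sub (szego_nl a) (szego_nl b)) (12 * A ^ 2 * d).
Proof.
  intros Ha Hb Hd. rewrite !szego_nl_Hankel.
  assert (Haa := nb_conv a a A A Ha Ha). assert (Hbb := nb_conv b b A A Hb Hb).
  assert (H1 := nb_conv a _ A d Ha Hd). assert (H2 := nb_conv _ b d A Hd Hb).
  assert (E : seq_sub (Hankel (conv a a) a) (Hankel (conv b b) b)
    = seq_add (Hankel (conv a a) (seq_sub a b))
        (seq_add (Hankel (conv a (seq_sub a b)) b) (Hankel (conv (seq_sub a b) b) b))).
  { rewrite conv_sub_l, conv_sub_r.
    assert (Hab := nb_conv a b A A Ha Hb).
    rewrite Hankel_sub_r, !Hankel_sub_l by eauto using hankel_conv_w_hw.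
    apply functional_extensionality. intros n. unfold seq_sub, seq_add. ring. }
  rewrite E.
  replace (12 * A ^ 2 * d) with
    (2 * (2 * A * A) * d + (2 * (2 * A * d) * A + 2 * (2 * d * A) * A)) by ring.
  apply nb_add; [apply nn_one| |apply nb_add; [apply nn_one| |]]; apply nb_Hankel_w_hw; auto.
Qed.

(** * Operators with finitely supported symbols *)

Definition fs (L : nat) (x : seqC) : Prop := forall n, (L <= n)%nat -> x n = RtoC 0.

Lemma hankel_conv_eventually0 a x :
  (forall n, exists L, forall m, (L <= m)%nat -> Cmult (a (n + m)%nat) (x m) = RtoC 0) -> hankel_conv a x.
Proof.
  intros H n. destruct (H n) as [L HL].
  exists (rsum (fun m => Cmod (a (n + m)%nat) * Cmod (x m)) L). intros M.
  destruct (Nat.le_gt_cases M L) as [HM|HM].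
  - apply rsum_mono; auto. intros. apply Rmult_le_pos; apply Cmod_ge_0.
  - right. induction HM as [|M HM IH]; rewrite rsum_S.
    + rewrite <- Cmod_mult, HL, Cmod_0 by lia. ring.
    + rewrite IH, <- Cmod_mult, HL, Cmod_0 by lia. ring.
Qed.

Lemma hankel_conv_fs L a x : fs L a -> hankel_conv a x.
Proof.
  intros H. apply hankel_conv_eventually0. intros n. exists L. intros m Hm.
  rewrite H by lia. ring.
Qed.

Lemma hankel_conv_fs_r L a x : fs L x -> hankel_conv a x.
Proof.
  intros H. apply hankel_conv_eventually0. intros n. exists L. intros m Hm.
  rewrite H by lia. ring.
Qed.

Lemma Hankel_fs_r L a x n :
  fs L x -> Hankel a x n = csum (fun m => Cmult (a (n + m)%nat) (Cconj (x m))) L.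
Proof.
  intros H. apply CSeries_fin. intros m Hm. rewrite H by lia.
  apply injective_projections; simpl; ring.
Qed.

Lemma Hankel_fs_l L a x n :
  fs L a -> Hankel a x n = csum (fun m => Cmult (a (n + m)%nat) (Cconj (x m))) L.
Proof.
  intros H. apply CSeries_fin. intros m Hm. rewrite H by lia. ring.
Qed.

Lemma fs_Hankel L a x : fs L a -> fs L (Hankel a x).
Proof.
  intros H n Hn. rewrite (Hankel_fs_l L) by easy. apply csum_eq0.
  intros m _. rewrite H by lia. ring.
Qed.

Lemma fs_Sstar L x : fs L x -> fs L (Sstar x).
Proof. intros H n Hn. apply H. lia. Qed.

Lemma fs_mono L L' x : (L <= L')%nat -> fs L x -> fs L' x.
Proof. intros H Hx n Hn. apply Hx. lia. Qed.

Lemma fs_one L : (1 <= L)%nat -> fs L one_fn.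
Proof. intros H [|n] Hn; [lia|easy]. Qed.

Lemma Kop_Hankel a : Kop a = Hankel (Sstar a).
Proof.
  apply functional_extensionality. intros x. apply functional_extensionality. intros n.
  apply CSeries_ext. intros m. unfold Sstar. do 2 f_equal. lia.
Qed.

(** [K_a] is the Hankel operator of symbol [S^* a]. Every bound and limit proved for [H2] therefore
    serves for [K2] as well. *)
Lemma K2_H2 a : K2 a = H2 (Sstar a).
Proof.
  apply functional_extensionality. intros x. unfold K2, H2. now rewrite Kop_Hankel.
Qed.

Lemma Hankel_Sstar a x : Hankel (Sstar a) x = Sstar (Hankel a x).
Proof. reflexivity. Qed.

Lemma Hankel_one a : Hankel a one_fn = a.
Proof.
  apply functional_extensionality. intros n.
  rewrite (Hankel_fs_r 1) by now apply fs_one.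
  simpl. rewrite Nat.add_0_r. apply injective_projections; simpl; ring.
Qed.

(* [S S^* = I - (.|1)1], with [H_u S = S^* H_u]. *)
Lemma K2_Sstar L v g : fs L v ->
  K2 v (Sstar g)
  = seq_sub (Sstar (H2 v g)) (seq_scal (g O) (Sstar (H2 v one_fn))).
Proof.
  intros Hv. rewrite K2_H2. unfold H2.
  assert (E : Hankel (Sstar v) (Sstar g)
    = seq_sub (Hankel v g) (seq_scal (Cconj (g O)) (Hankel v one_fn))).
  { apply functional_extensionality. intros n. rewrite Hankel_one.
    unfold seq_sub, seq_scal.
    rewrite (Hankel_fs_l (S L)), (Hankel_fs_l (S L) v)
      by (try apply fs_Sstar; apply fs_mono with L; auto).
    rewrite (csum_shift (fun m => Cmult (v (n + m)%nat) _)), Nat.add_0_r, csum_S.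
    rewrite (csum_ext (fun m => Cmult (Sstar v (n + m)%nat) (Cconj (Sstar g m)))
       (fun i => Cmult (v (n + S i)%nat) (Cconj (g (S i))))).
    - unfold Sstar at 1. rewrite (Hv (S (n + L))) by lia. ring.
    - intros i _. unfold Sstar. do 2 f_equal. lia. }
  rewrite E. rewrite Hankel_Sstar.
  rewrite !Hankel_sub_r, Hankel_scal_r, Cconj_conj by eauto using hankel_conv_fs.
  reflexivity.
Qed.

(** The Fourier coefficient of [|v|^2] at [p - m], which may be negative. The test discards the [l]
    with [p + l < m], where truncated subtraction would produce [v 0] instead of zero. *)
Definition toep_entry (L : nat) (v : seqC) (p m : nat) : C :=
  csum (fun l => if Nat.leb m (p + l)
                 then Cmult (Cconj (v l)) (v (p + l - m)%nat) else RtoC 0) L.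

(* The Toeplitz operator [T_{|v|^2}], acting on sequences supported in [0, L). *)
Definition toep (L : nat) (v x : seqC) : seqC :=
  fun p => csum (fun m => Cmult (x m) (toep_entry L v p m)) L.

Lemma toep_entry_shift L v p m k :
  toep_entry L v (p + k)%nat (m + k)%nat = toep_entry L v p m.
Proof.
  apply csum_ext. intros l _.
  replace (Nat.leb (m + k) (p + k + l)) with (Nat.leb m (p + l)).
  - replace (p + k + l - (m + k))%nat with (p + l - m)%nat by lia. easy.
  - destruct (Nat.leb_spec m (p + l)); destruct (Nat.leb_spec (m + k) (p + k + l)); lia || easy.
Qed.

Lemma toep_entry_0 L v p :
  toep_entry L v p 0 = csum (fun l => Cmult (v (p + l)%nat) (Cconj (v l))) L.
Proof.
  apply csum_ext. intros l _. simpl. rewrite Nat.sub_0_r. ring.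
Qed.

(** Since [H_v 1 = v], the left side is [H_v v], the projection of [|v|^2], which is also the first
    column of the Toeplitz matrix. *)
Lemma H2_one_fs L v n : fs L v -> H2 v one_fn n = toep_entry L v n 0.
Proof.
  intros Hv. unfold H2. rewrite Hankel_one, (Hankel_fs_l L) by easy.
  now rewrite toep_entry_0.
Qed.

(** A Toeplitz matrix is invariant under a shift of both indices. Only column 0 has no predecessor,
    and it contributes the rank one term. *)
Lemma Sstar_toep L v x : fs L v -> fs L x ->
  Sstar (toep L v x)
  = seq_add (toep L v (Sstar x)) (seq_scal (x O) (Sstar (H2 v one_fn))).
Proof.
  intros Hv Hx. apply functional_extensionality. intros n.
  unfold seq_add, seq_scal. unfold Sstar at 1 3.
  rewrite (H2_one_fs L) by easy. unfold toep.
  destruct L as [|L].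
  - simpl. unfold toep_entry. simpl. ring.
  - rewrite csum_shift, csum_S. unfold Sstar at 2. rewrite (Hx (S L)) by lia.
    rewrite (csum_ext (fun i => Cmult (x (S i)) (toep_entry (S L) v (S n) (S i)))
      (fun i => Cmult (Sstar x i) (toep_entry (S L) v n i))).
    + ring.
    + reflexivity.
Qed.

(** The terms of [(T_{|v|^2} v)_{n+m}] in which the factor [v j] has [j < m]. Here [n + m + l - j]
    is a true difference, so the test of [toep_entry] is absent. *)
Definition hankel_defect (L : nat) (v : seqC) (n m : nat) : C :=
  csum (fun j => Cmult (v j)
    (csum (fun l => Cmult (Cconj (v l)) (v (n + m + l - j)%nat)) L)) m.

Definition toep_defect (v : seqC) (p m : nat) : C :=
  csum (fun l => if Nat.leb m (p + l)
                 then Cmult (Cconj (v l)) (v (p + l - m)%nat) else RtoC 0) m.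

Lemma toep_self_split L v n m : fs L v -> (m <= L)%nat ->
  toep L v v (n + m)%nat
  = Cplus (hankel_defect L v n m)
      (csum (fun j => Cmult (v (j + m)%nat) (toep_entry L v n j)) L).
Proof.
  intros Hv Hm. unfold toep.
  replace L with (m + (L - m))%nat at 1 by lia. rewrite csum_add. f_equal.
  - apply csum_ext. intros j Hj. f_equal. apply csum_ext. intros l _.
    destruct (Nat.leb_spec j (n + m + l)); [easy|lia].
  - rewrite (csum_extend _ (L - m) L).
    + apply csum_ext. intros j _. rewrite (Nat.add_comm m j). f_equal.
      apply toep_entry_shift.
    + lia.
    + intros j Hj. rewrite Hv by lia. ring.
Qed.

Lemma H2_fs L v x p : fs L v -> fs L x ->
  H2 v x p = csum (fun m => Cmult (x m)
     (csum (fun q => Cmult (v (p + q)%nat) (Cconj (v (q + m)%nat))) L)) L.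
Proof.
  intros Hv Hx. unfold H2. rewrite (Hankel_fs_l L) by easy.
  rewrite (csum_ext _ (fun q => csum (fun m =>
     Cmult (x m) (Cmult (v (p + q)%nat) (Cconj (v (q + m)%nat)))) L)).
  - rewrite csum_switch. apply csum_ext. intros m _. now rewrite csum_scal.
  - intros q _. rewrite (Hankel_fs_l L) by easy. rewrite Cconj_csum, <- csum_scal.
    apply csum_ext. intros m _. rewrite Cmult_conj, Cconj_conj. ring.
Qed.

(** With [l = m + q], the terms [l >= m] of the Toeplitz entry are the products
    [v_{p+q} conj(v_{q+m})] that make up the entry of [H_v^2]. *)
Lemma toep_split L v x p : fs L v -> fs L x ->
  toep L v x p
  = Cplus (H2 v x p) (csum (fun m => Cmult (x m) (toep_defect v p m)) L).
Proof.
  intros Hv Hx. rewrite (H2_fs L) by easy. rewrite <- csum_plus.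
  apply csum_ext. intros m Hm. rewrite <- Cmult_plus_distr_l. f_equal.
  unfold toep_entry, toep_defect.
  replace L with (m + (L - m))%nat at 1 by lia. rewrite csum_add, Cplus_comm. f_equal.
  rewrite (csum_extend _ (L - m) L).
  - apply csum_ext. intros q _. destruct (Nat.leb_spec m (p + (m + q))); [|lia].
    replace (p + (m + q) - m)%nat with (p + q)%nat by lia.
    rewrite (Nat.add_comm m q). ring.
  - lia.
  - intros q Hq. rewrite (Hv (q + m)%nat) by lia.
    apply injective_projections; simpl; ring.
Qed.

(** In row [p = 0] the test [m <= l] excludes every term [l < m] of the defect. *)
Lemma toep_at_0 L v x : fs L v -> fs L x -> toep L v x O = H2 v x O.
Proof.
  intros Hv Hx. rewrite toep_split by easy.
  rewrite (csum_eq0 (fun m => Cmult (x m) _)); [ring|]. intros m _.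
  unfold toep_defect. rewrite csum_eq0; [ring|]. intros l Hl.
  destruct (Nat.leb_spec m (0 + l)); [lia|easy].
Qed.

Lemma Hankel_toep_defect L v n m : fs L v ->
  csum (fun p => Cmult (v (n + p)%nat) (Cconj (toep_defect v p m))) L
  = hankel_defect L v n m.
Proof.
  intros Hv. unfold toep_defect, hankel_defect.
  rewrite (csum_ext _ (fun p => csum (fun l => if Nat.leb m (p + l)
     then Cmult (v (n + p)%nat) (Cmult (v l) (Cconj (v (p + l - m)%nat))) else RtoC 0) m)).
  - rewrite csum_switch. apply csum_ext. intros l Hl.
    rewrite <- csum_scal.
    (* Substitution [p = (m - l) + r]. The longer range lets [r] run over all of [[0, L)]: the added
       terms vanish because of the support of [v], and those with [p < m - l] by the test. *)
    rewrite <- (csum_extend _ L ((m - l) + L)); [|lia|].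
    + rewrite csum_add, csum_eq0.
      * rewrite Cplus_0_l. apply csum_ext. intros r _.
        destruct (Nat.leb_spec m (m - l + r + l)); [|lia].
        replace (m - l + r + l - m)%nat with r by lia.
        replace (n + m + r - l)%nat with (n + (m - l + r))%nat by lia. ring.
      * intros p Hp. destruct (Nat.leb_spec m (p + l)); [lia|easy].
    + intros p Hp. destruct (Nat.leb m (p + l)); [|easy]. rewrite Hv by lia. ring.
  - intros p _. rewrite Cconj_csum, <- csum_scal. apply csum_ext. intros l _.
    destruct (Nat.leb m (p + l)).
    + now rewrite Cmult_conj, Cconj_conj.
    + apply injective_projections; simpl; ring.
Qed.

(* The entry (n, m) of the left side sums [v_k conj(v_l) v_j] over [k - l + j = n + m]; the three
   operators on the right restrict this sum to [k >= m], to [j >= n], and to both, and the terms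
   with [k < m] and [j < n] are absent since they would have [l < 0]. *)
Lemma Hankel_toep L v x : fs L v -> fs L x ->
  Hankel (toep L v v) x
  = seq_sub (seq_add (toep L v (Hankel v x)) (Hankel v (toep L v x)))
      (Hankel v (Hankel v (Hankel v x))).
Proof.
  intros Hv Hx. apply functional_extensionality. intros n.
  unfold seq_sub, seq_add.
  rewrite (Hankel_fs_r L) by easy.
  rewrite (csum_ext _ (fun m => Cplus (Cmult (Cconj (x m)) (hankel_defect L v n m))
     (csum (fun j => Cmult (Cmult (v (j + m)%nat) (Cconj (x m))) (toep_entry L v n j)) L))).
  2:{ intros m Hm. rewrite toep_self_split by (easy || lia).
      rewrite Cmult_plus_distr_r. f_equal; [ring|].
      rewrite <- csum_scal_r. apply csum_ext. intros. ring. }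
  rewrite csum_plus, csum_switch.
  assert (E1 : toep L v (Hankel v x) n =
     csum (fun j => csum (fun m => Cmult (Cmult (v (j + m)%nat) (Cconj (x m))) (toep_entry L v n j)) L) L).
  { apply csum_ext. intros j _. rewrite (Hankel_fs_l L) by easy. now rewrite csum_scal_r. }
  assert (E2 : Hankel v (toep L v x) n
     = Cplus (Hankel v (H2 v x) n) (csum (fun m => Cmult (Cconj (x m)) (hankel_defect L v n m)) L)).
  { rewrite !(Hankel_fs_l L) by easy.
    rewrite (csum_ext (fun m => Cmult (Cconj (x m)) _) (fun m => csum (fun p =>
       Cmult (Cconj (x m)) (Cmult (v (n + p)%nat) (Cconj (toep_defect v p m)))) L)).
    2:{ intros m _. rewrite csum_scal. now rewrite Hankel_toep_defect. }
    rewrite csum_switch, <- csum_plus. apply csum_ext. intros p _.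
    rewrite toep_split by easy. rewrite Cplus_conj, Cmult_plus_distr_l. f_equal.
    rewrite Cconj_csum, <- csum_scal. apply csum_ext. intros m _. rewrite Cmult_conj. ring. }
  rewrite E1, E2. unfold H2. ring.
Qed.

Lemma csum_leb f L P : (forall m, (L <= m)%nat -> f m = RtoC 0) ->
  csum (fun m => if Nat.leb m P then f m else RtoC 0) L = csum f (S P).
Proof.
  intros Hf.
  rewrite <- (csum_extend (fun m => if Nat.leb m P then f m else RtoC 0) L (L + S P)).
  - rewrite (csum_extend _ (S P) (L + S P)); [|lia|].
    + apply csum_ext. intros i Hi. destruct (Nat.leb_spec i P); [easy|lia].
    + intros i Hi. destruct (Nat.leb_spec i P); [lia|easy].
  - lia.
  - intros i Hi. rewrite Hf by easy. now destruct (Nat.leb i P).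
Qed.

(** The cubic term is the Toeplitz operator applied to [v] itself, so that the equation becomes
    homogeneous for the derivative [v' + i T v]. *)
Lemma szego_nl_toep L v : fs L v -> szego_nl v = toep L v v.
Proof.
  intros Hv. apply functional_extensionality. intros n.
  rewrite szego_nl_Hankel, (Hankel_fs_r L) by easy. unfold toep, toep_entry.
  rewrite (csum_ext (fun m => Cmult (v m) _) (fun m => csum (fun l =>
     Cmult (if Nat.leb m (n + l) then Cmult (v m) (v (n + l - m)%nat) else RtoC 0) (Cconj (v l))) L)).
  - rewrite csum_switch. apply csum_ext. intros l _. rewrite csum_scal_r. f_equal.
    symmetry. apply (csum_leb (fun m => Cmult (v m) (v (n + l - m)%nat))).
    intros m Hm. rewrite Hv by lia. ring.
  - intros m _. rewrite <- csum_scal. apply csum_ext. intros l _.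
    destruct (Nat.leb m (n + l)); ring.
Qed.

Lemma Hankel_sym L v x y : fs L x -> fs L y ->
  csum (fun n => Cmult (Hankel v x n) (Cconj (y n))) L
  = csum (fun n => Cmult (Hankel v y n) (Cconj (x n))) L.
Proof.
  intros Hx Hy.
  rewrite (csum_ext _ (fun n => csum (fun m =>
     Cmult (Cmult (v (n + m)%nat) (Cconj (x m))) (Cconj (y n))) L)).
  - rewrite csum_switch. apply csum_ext. intros m _.
    rewrite (Hankel_fs_r L) by easy. rewrite <- csum_scal_r. apply csum_ext. intros n _.
    rewrite (Nat.add_comm n m). ring.
  - intros n _. rewrite (Hankel_fs_r L) by easy. now rewrite <- csum_scal_r.
Qed.

(** * Exponentials *)

Definition ecoef (c : C) (k : nat) : C := Cdiv (Cpow c k) (RtoC (INR (Factorial.fact k))).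

Definition eP (A : seqC -> seqC) (c : C) (M : nat) (x : seqC) : seqC :=
  fun n => csum (fun k => Cmult (ecoef c k) (Nat.iter k A x n)) M.

Lemma Cmod_ecoef c k : Cmod (ecoef c k) = Cmod c ^ k / INR (fact k).
Proof.
  unfold ecoef. assert (H := INR_fact_neq_0 k).
  rewrite Cmod_div, Cmod_R by (intro E; apply H; now injection E).
  rewrite Rabs_pos_eq by apply pos_INR. f_equal.
  induction k as [|k IH]; simpl; [apply Cmod_1|].
  rewrite Cmod_mult. rewrite IH by apply INR_fact_neq_0. easy.
Qed.

Definition eterm (y : R) (k : nat) : R := y ^ k / INR (fact k).

Lemma eterm_nonneg y k : 0 <= y -> 0 <= eterm y k.
Proof.
  intros Hy. apply Rmult_le_pos; [now apply pow_le|].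
  apply Rlt_le, Rinv_0_lt_compat, INR_fact_lt_0.
Qed.

Lemma is_lim_rsum_eterm y : is_lim_seq (rsum (eterm y)) (exp y).
Proof.
  apply is_lim_seq_incr_1.
  apply is_lim_seq_ext with (sum_n (fun k => scal (pow_n y k) (/ INR (fact k)))).
  - intros n. rewrite sum_n_rsum. apply rsum_ext. intros i _. unfold eterm, Rdiv.
    now rewrite pow_n_pow.
  - apply (is_exp_Reals y).
Qed.

Lemma rsum_eterm_le y M : 0 <= y -> rsum (eterm y) M <= exp y.
Proof.
  intros Hy. apply (is_lim_seq_incr_compare _ _ (is_lim_rsum_eterm y)).
  intros n. rewrite rsum_S. assert (H := eterm_nonneg y n Hy). lra.
Qed.

Lemma is_lim_eterm y : is_lim_seq (eterm y) 0.
Proof.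
  apply is_lim_seq_ext with (fun n => rsum (eterm y) (S n) - rsum (eterm y) n).
  - intros n. rewrite rsum_S. ring.
  - replace 0 with (exp y - exp y) by ring. apply is_lim_seq_minus'.
    + apply (is_lim_seq_incr_1 (rsum (eterm y))), is_lim_rsum_eterm.
    + apply is_lim_rsum_eterm.
Qed.

Definition etail (y : R) (K : nat) : R := exp y - rsum (eterm y) K.

Lemma is_lim_etail y : is_lim_seq (etail y) 0.
Proof.
  replace 0 with (exp y - exp y) by ring. apply is_lim_seq_minus'.
  - apply is_lim_seq_const.
  - apply is_lim_rsum_eterm.
Qed.

Lemma etail_nonneg y K : 0 <= y -> 0 <= etail y K.
Proof. intros H. assert (H1 := rsum_eterm_le y K H). unfold etail. lra. Qed.

Definition nbop (q : nat -> R) (A : seqC -> seqC) (a : R) : Prop :=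
  forall x B, nb q x B -> nb q (A x) (a * B).

Lemma nb_iter q A a x B k : nbop q A a -> nb q x B -> nb q (Nat.iter k A x) (a ^ k * B).
Proof.
  intros HA Hx. induction k as [|k IH]; simpl.
  - now rewrite Rmult_1_l.
  - rewrite Rmult_assoc. now apply HA.
Qed.

Lemma nb_csum q (y : nat -> seqC) (B : nat -> R) M :
  (forall n, 0 <= q n) -> (forall k, (k < M)%nat -> nb q (y k) (B k)) ->
  nb q (fun n => csum (fun k => y k n) M) (rsum B M).
Proof.
  intros Hq. induction M as [|M IH]; intros H; simpl.
  - apply nb_zero. lra.
  - apply (nb_add q (fun n => csum (fun k => y k n) M) (y M)); auto.
Qed.

Lemma nb_eterms q A a c x B k M :
  (forall n, 0 <= q n) -> 0 <= a -> nbop q A a -> nb q x B ->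
  nb q (fun n => csum (fun j => Cmult (ecoef c (k + j)%nat) (Nat.iter (k + j) A x n)) M)
     ((rsum (eterm (Cmod c * a)) (k + M) - rsum (eterm (Cmod c * a)) k) * B).
Proof.
  intros Hq Ha HA Hx. eapply nb_mono.
  - apply (nb_csum q (fun j => seq_scal (ecoef c (k + j)%nat) (Nat.iter (k + j) A x))
      (fun j => Cmod (ecoef c (k + j)%nat) * (a ^ (k + j) * B))); auto.
    intros j _. apply nb_scal. now apply nb_iter.
  - right. induction M as [|M IH].
    + rewrite Nat.add_0_r. simpl. ring.
    + rewrite Nat.add_succ_r, !rsum_S, IH, Cmod_ecoef. unfold eterm.
      rewrite Rpow_mult_distr. unfold Rdiv. ring.
Qed.

Lemma nb_eP q A a c x B M :
  (forall n, 0 <= q n) -> 0 <= a -> nbop q A a -> nb q x B ->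
  nb q (eP A c M x) (exp (Cmod c * a) * B).
Proof.
  intros Hq Ha HA Hx. eapply nb_mono.
  - apply (nb_eterms q A a c x B 0 M); auto.
  - simpl. assert (H := rsum_eterm_le (Cmod c * a) M).
    assert (H0 : 0 <= Cmod c * a) by (apply Rmult_le_pos; [apply Cmod_ge_0|easy]).
    specialize (H H0). apply nb_nonneg in Hx. nra.
Qed.

Lemma eP_add A c K M x n :
  eP A c (K + M) x n
  = Cplus (eP A c K x n)
      (csum (fun j => Cmult (ecoef c (K + j)%nat) (Nat.iter (K + j) A x n)) M).
Proof. apply csum_add. Qed.

Lemma nb_eP_tail A a c x B K N :
  0 <= a -> nbop one_w A a -> nb1 x B -> (K <= N)%nat ->
  nb1 (seq_sub (eP A c N x) (eP A c K x)) (etail (Cmod c * a) K * B).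
Proof.
  intros Ha HA Hx HK.
  assert (H := nb_eterms one_w A a c x B K (N - K) nn_one Ha HA Hx).
  replace (K + (N - K))%nat with N in H by lia.
  assert (E : seq_sub (eP A c N x) (eP A c K x) = fun n =>
    csum (fun j => Cmult (ecoef c (K + j)%nat) (Nat.iter (K + j) A x n)) (N - K)).
  { apply functional_extensionality. intros n. unfold seq_sub.
    replace N with (K + (N - K))%nat at 1 by lia. rewrite eP_add. ring. }
  rewrite E. eapply nb_mono; [exact H|].
  assert (H0 : 0 <= Cmod c * a) by (apply Rmult_le_pos; [apply Cmod_ge_0|easy]).
  assert (H1 := rsum_eterm_le (Cmod c * a) N H0).
  apply nb_nonneg in Hx. unfold etail. nra.
Qed.

Lemma expOp_Clim A a c x B n :
  0 <= a -> nbop one_w A a -> nb1 x B -> Clim (fun M => eP A c M x n) (expOp A c x n).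
Proof.
  intros Ha HA Hx. apply (Clim_csum _ (exp (Cmod c * a) * B)). intros M.
  apply Rle_trans with (rsum (fun k => B * eterm (Cmod c * a) k) M).
  - apply rsum_le. intros k _. rewrite Cmod_mult.
    change (Cdiv (Cpow c k) (RtoC (INR (fact k)))) with (ecoef c k).
    rewrite Cmod_ecoef. unfold eterm. rewrite Rpow_mult_distr.
    assert (H := nb1_coord _ _ n (nb_iter one_w A a x B k HA Hx)).
    apply Rle_trans with (Cmod c ^ k / INR (fact k) * (a ^ k * B)); [|right; unfold Rdiv; ring].
    apply Rmult_le_compat_l; [|easy].
    apply (eterm_nonneg (Cmod c)), Cmod_ge_0.
  - rewrite rsum_scal, Rmult_comm.
    apply Rmult_le_compat_r; [now apply nb_nonneg in Hx|].
    apply rsum_eterm_le. apply Rmult_le_pos; [apply Cmod_ge_0|easy].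
Qed.

Lemma nb_expOp A a c x B :
  0 <= a -> nbop one_w A a -> nb1 x B -> nb1 (expOp A c x) (exp (Cmod c * a) * B).
Proof.
  intros Ha HA Hx.
  apply nb_limit with (fun M => eP A c M x) (fun _ => exp (Cmod c * a) * B).
  - intros n. eapply expOp_Clim; eauto.
  - intros M. apply nb_eP; auto using nn_one.
  - apply is_lim_seq_const.
Qed.

Lemma Clim_sub_const g l c : Clim g l -> Clim (fun n => Cminus (g n) c) (Cminus l c).
Proof.
  intros H. apply (Clim_plus g (fun _ => Copp c)); [easy|apply Clim_const].
Qed.

Lemma nb_expOp_tail A a c x B K :
  0 <= a -> nbop one_w A a -> nb1 x B ->
  nb1 (seq_sub (expOp A c x) (eP A c K x)) (etail (Cmod c * a) K * B).
Proof.
  intros Ha HA Hx.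
  apply nb_limit with (fun M => seq_sub (eP A c (K + M) x) (eP A c K x))
    (fun _ => etail (Cmod c * a) K * B).
  - intros n. unfold seq_sub. apply (Clim_sub_const (fun M => eP A c (K + M) x n)).
    assert (H := expOp_Clim A a c x B n Ha HA Hx).
    unfold Clim in *. apply (is_lim_seq_incr_n _ K) in H.
    eapply is_lim_seq_ext; [|exact H]. intros m. simpl. now rewrite (Nat.add_comm m K).
  - intros M. apply nb_eP_tail; auto. lia.
  - apply is_lim_seq_const.
Qed.

(** * Bounded linear operators on l2 *)

(** Linearity is demanded on [l2] only: elsewhere the series that define the operators may
    diverge. *)
Record l2op (A : seqC -> seqC) (a : R) : Prop := {
  l2op_nonneg : 0 <= a;
  l2op_bound : nbop one_w A a;
  l2op_add : forall x y, l2 x -> l2 y -> A (seq_add x y) = seq_add (A x) (A y);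
  l2op_scal : forall c x, l2 x -> A (seq_scal c x) = seq_scal c (A x) }.

Lemma l2op_l2 A a x : l2op A a -> l2 x -> l2 (A x).
Proof.
  intros HA Hx. apply l2_nb1 in Hx as [B HB]. apply l2_nb1. eexists.
  apply (l2op_bound _ _ HA), HB.
Qed.

Lemma l2op_iter_l2 A a k x : l2op A a -> l2 x -> l2 (Nat.iter k A x).
Proof. intros HA Hx. induction k; simpl; [easy|]. eapply l2op_l2; eauto. Qed.

Lemma l2op_comp A a B b : l2op A a -> l2op B b -> l2op (fun x => A (B x)) (a * b).
Proof.
  intros HA HB. split.
  - apply Rmult_le_pos; eapply l2op_nonneg; eauto.
  - intros x D Hx. rewrite Rmult_assoc. apply (l2op_bound _ _ HA), (l2op_bound _ _ HB), Hx.
  - intros x y Hx Hy. rewrite (l2op_add _ _ HB), (l2op_add _ _ HA); eauto using l2op_l2.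
  - intros c x Hx. rewrite (l2op_scal _ _ HB), (l2op_scal _ _ HA); eauto using l2op_l2.
Qed.

Lemma nb1_Sstar x B : nb1 x B -> nb1 (Sstar x) B.
Proof.
  intros [H0 H]. split; [easy|]. intros N. specialize (H (S N)).
  rewrite rsum_shift in H. assert (H1 := Cmod_ge_0 (x O)). unfold Sstar, one_w in *. nra.
Qed.

Lemma l2op_Sstar : l2op Sstar 1.
Proof.
  split; try easy; [lra|]. intros x B Hx. rewrite Rmult_1_l. now apply nb1_Sstar.
Qed.

Lemma nbop_H2 v R0 : nb hw v R0 -> nbop one_w (H2 v) (R0 * R0).
Proof.
  intros Hv x B Hx. rewrite Rmult_assoc. apply nb_Hankel_l2; [easy|]. now apply nb_Hankel_l2.
Qed.

Lemma l2op_H2 v R0 : nb hw v R0 -> l2op (H2 v) (R0 * R0).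
Proof.
  intros Hv. split.
  - apply nb_nonneg in Hv. nra.
  - now apply nbop_H2.
  - intros x y Hx Hy. apply l2_nb1 in Hx as [B HB]. apply l2_nb1 in Hy as [D HD].
    unfold H2. rewrite !Hankel_add_r; eauto using hankel_conv_l2, nb_Hankel_l2.
  - intros c x Hx. apply l2_nb1 in Hx as [B HB]. unfold H2.
    rewrite !Hankel_scal_r, Cconj_conj; eauto using hankel_conv_l2, nb_Hankel_l2.
Qed.

Lemma nb_hw_Sstar v R0 : nb hw v R0 -> nb hw (Sstar v) R0.
Proof.
  intros [H0 H]. split; [easy|]. intros N. eapply Rle_trans; [|apply (H (S N))].
  rewrite rsum_shift.
  apply Rle_trans with (0 + rsum (fun i => hw (S i) * Cmod (v (S i)) ^ 2) N).
  - rewrite Rplus_0_l. apply rsum_le. intros n _. apply Rmult_le_compat_r; [apply pow2_ge_0|].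
    rewrite hw_S. lra.
  - apply Rplus_le_compat_r. apply Rmult_le_pos; [apply nn_hw|apply pow2_ge_0].
Qed.

Lemma iter_add A a k x y : l2op A a -> l2 x -> l2 y ->
  Nat.iter k A (seq_add x y) = seq_add (Nat.iter k A x) (Nat.iter k A y).
Proof.
  intros HA Hx Hy. induction k; simpl; [easy|]. rewrite IHk.
  apply (l2op_add _ _ HA); eapply l2op_iter_l2; eauto.
Qed.

Lemma iter_scal A a k c x : l2op A a -> l2 x ->
  Nat.iter k A (seq_scal c x) = seq_scal c (Nat.iter k A x).
Proof.
  intros HA Hx. induction k; simpl; [easy|]. rewrite IHk.
  apply (l2op_scal _ _ HA); eapply l2op_iter_l2; eauto.
Qed.

Lemma l2op_expOp A a c : l2op A a -> l2op (expOp A c) (exp (Cmod c * a)).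
Proof.
  intros HA. assert (Ha := l2op_nonneg _ _ HA). assert (Hb := l2op_bound _ _ HA). split.
  - apply Rlt_le, exp_pos.
  - intros x B. now apply nb_expOp.
  - intros x y Hx Hy. assert (Hx' := Hx). assert (Hy' := Hy).
    apply l2_nb1 in Hx as [B HB]. apply l2_nb1 in Hy as [D HD].
    apply functional_extensionality. intros n. apply CSeries_unique.
    eapply Clim_ext; [apply Clim_plus; [apply (expOp_Clim A a c x B n)|apply (expOp_Clim A a c y D n)]|]; auto.
    intros M. cbv beta. unfold eP. rewrite <- csum_plus. apply csum_ext. intros k _.
    rewrite (iter_add A a) by auto. unfold seq_add, ecoef. ring.
  - intros d x Hx. assert (Hx' := Hx). apply l2_nb1 in Hx as [B HB].
    apply functional_extensionality. intros n. apply CSeries_unique.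
    eapply Clim_ext; [apply Clim_scal, (expOp_Clim A a c x B n)|]; auto.
    intros M. cbv beta. unfold eP. rewrite <- csum_scal. apply csum_ext. intros k _.
    rewrite (iter_scal A a) by auto. unfold seq_scal, ecoef. ring.
Qed.

(** * Norm limits *)

Definition limq (q : nat -> R) (y : nat -> seqC) (x : seqC) : Prop :=
  forall eps, 0 < eps -> exists N0, forall N, (N0 <= N)%nat -> nb q (seq_sub (y N) x) eps.

Lemma limq_Clim y x n : limq one_w y x -> Clim (fun N => y N n) (x n).
Proof.
  intros H. apply is_lim_seq_spec. intros eps.
  destruct (H (eps / 2)) as [N0 HN]; [assert (Hp := cond_pos eps); lra|].
  exists N0. intros N HN'. specialize (HN N HN').
  apply nb1_coord with (n := n) in HN. unfold seq_sub in HN.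
  rewrite Rminus_0_r, Rabs_pos_eq by apply Cmod_ge_0. assert (Hp := cond_pos eps). lra.
Qed.

Lemma limq_const q x : limq q (fun _ => x) x.
Proof.
  intros eps He. exists O. intros N _.
  replace (seq_sub x x) with zero_seq; [apply nb_zero; lra|].
  apply functional_extensionality. intros n. unfold zero_seq, seq_sub. ring.
Qed.

Lemma limq_plus q y z a b : (forall n, 0 <= q n) ->
  limq q y a -> limq q z b -> limq q (fun N => seq_add (y N) (z N)) (seq_add a b).
Proof.
  intros Hq Hy Hz eps He.
  destruct (Hy (eps / 2)) as [N1 H1]; [lra|]. destruct (Hz (eps / 2)) as [N2 H2]; [lra|].
  exists (Nat.max N1 N2). intros N HN.
  replace (seq_sub (seq_add (y N) (z N)) (seq_add a b))
    with (seq_add (seq_sub (y N) a) (seq_sub (z N) b)).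
  - replace eps with (eps / 2 + eps / 2) by lra.
    apply nb_add; auto; [apply H1|apply H2]; lia.
  - apply functional_extensionality. intros n. unfold seq_add, seq_sub. ring.
Qed.

Lemma limq_scal q c y a :
  limq q y a -> limq q (fun N => seq_scal c (y N)) (seq_scal c a).
Proof.
  intros Hy eps He. assert (Hc := Cmod_ge_0 c).
  destruct (Hy (eps / (Cmod c + 1))) as [N1 H1]; [apply Rdiv_lt_0_compat; lra|].
  exists N1. intros N HN.
  replace (seq_sub (seq_scal c (y N)) (seq_scal c a))
    with (seq_scal c (seq_sub (y N) a)).
  - eapply nb_mono; [apply nb_scal, H1, HN|].
    apply Rmult_le_reg_r with (Cmod c + 1); [lra|].
    replace (Cmod c * (eps / (Cmod c + 1)) * (Cmod c + 1)) with (Cmod c * eps) by (field; lra).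
    nra.
  - apply functional_extensionality. intros n. unfold seq_scal, seq_sub. ring.
Qed.

Definition trunc (N : nat) (x : seqC) : seqC :=
  fun n => if Nat.ltb n N then x n else RtoC 0.

Lemma fs_trunc N x : fs N (trunc N x).
Proof. intros n Hn. unfold trunc. destruct (Nat.ltb_spec n N); [lia|easy]. Qed.

Lemma nb_trunc q N x B : (forall n, 0 <= q n) -> nb q x B -> nb q (trunc N x) B.
Proof.
  intros Hq. apply nb_le. intros n. unfold trunc. destruct (Nat.ltb n N); [lra|].
  rewrite Cmod_0. assert (H := pow2_ge_0 (Cmod (x n))). specialize (Hq n). nra.
Qed.

Lemma limq_trunc q x B : (forall n, 0 <= q n) -> nb q x B -> limq q (fun N => trunc N x) x.
Proof.
  intros Hq Hx eps He.
  set (f n := q n * Cmod (x n) ^ 2).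
  assert (Hf : forall n, 0 <= f n) by (intros; apply Rmult_le_pos; [auto|apply pow2_ge_0]).
  assert (Hs : ex_series f) by (eapply nb_ex_series; eauto).
  assert (Hl : is_lim_seq (rsum f) (Series f)).
  { apply is_lim_seq_incr_1. apply is_lim_seq_ext with (sum_n f).
    - intros n. apply sum_n_rsum.
    - apply (Series_correct _ Hs). }
  apply is_lim_seq_spec in Hl.
  assert (He2 : 0 < eps ^ 2) by (apply pow_lt; lra).
  destruct (Hl (mkposreal _ He2)) as [N0 H0]. exists N0. intros N HN.
  split; [lra|]. intros M.
  assert (HN0 := H0 N HN). simpl in HN0. apply Rabs_def2 in HN0 as [_ HN0].
  assert (HS := ex_series_bounded_rsum f Hf Hs (N + M)).
  set (g n := q n * Cmod (seq_sub (trunc N x) x n) ^ 2).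
  assert (Hg0 : forall n, (n < N)%nat -> g n = 0).
  { intros n Hn. unfold g, seq_sub, trunc. destruct (Nat.ltb_spec n N); [|lia].
    replace (Cminus (x n) (x n)) with (RtoC 0) by ring. rewrite Cmod_0. ring. }
  assert (Hg1 : forall n, (N <= n)%nat -> g n = f n).
  { intros n Hn. unfold g, f, seq_sub, trunc. destruct (Nat.ltb_spec n N); [lia|].
    replace (Cminus (RtoC 0) (x n)) with (Copp (x n)) by ring. now rewrite Cmod_opp. }
  assert (HT : forall K, rsum f N + rsum g (N + K) = rsum f (N + K)).
  { induction K as [|K IHK].
    - rewrite Nat.add_0_r, (rsum_ext g (fun _ => 0)), rsum_zero; [ring|auto].
    - rewrite Nat.add_succ_r, !rsum_S, <- IHK, Hg1 by lia. ring. }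
  assert (HM : rsum g M <= rsum g (N + M)).
  { apply rsum_mono; [lia|]. intros n.
    destruct (Nat.lt_ge_cases n N); [rewrite Hg0 by easy; lra|rewrite Hg1 by easy; auto]. }
  specialize (HT M).
  simpl in HN0, He2 |- *. lra.
Qed.

Lemma limq_bounded q y x B : (forall n, 0 <= q n) -> limq q y x -> nb q x B ->
  exists N0, forall N, (N0 <= N)%nat -> nb q (y N) (B + 1).
Proof.
  intros Hq Hy Hx. destruct (Hy 1) as [N0 H0]; [lra|]. exists N0. intros N HN.
  replace (y N) with (seq_add x (seq_sub (y N) x)).
  - apply nb_add; auto.
  - apply functional_extensionality. intros n. unfold seq_add, seq_sub. ring.
Qed.

(** The difference is [H_{a_N} (x_N - x) + H_{a_N - a} x]: the first term uses the uniform bound on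
    the symbols, the second their convergence in [H^{1/2}]. *)
Lemma limq_Hankel a A (aN : nat -> seqC) x B (xN : nat -> seqC) :
  nb hw a A -> (forall N, nb hw (aN N) A) -> limq hw aN a ->
  nb1 x B -> (forall N, l2 (xN N)) -> limq one_w xN x ->
  limq one_w (fun N => Hankel (aN N) (xN N)) (Hankel a x).
Proof.
  intros Ha HaN Hlim Hx HxN Hxlim eps He.
  assert (HA := nb_nonneg _ _ _ Ha). assert (HB := nb_nonneg _ _ _ Hx).
  destruct (Hxlim (eps / 2 / (A + 1))) as [N1 H1]; [repeat apply Rdiv_lt_0_compat; lra|].
  destruct (Hlim (eps / 2 / (B + 1))) as [N2 H2]; [repeat apply Rdiv_lt_0_compat; lra|].
  exists (Nat.max N1 N2). intros N HN.
  specialize (H1 N ltac:(lia)). specialize (H2 N ltac:(lia)).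
  destruct (proj1 (l2_nb1 _) (HxN N)) as [D HD].
  replace (seq_sub (Hankel (aN N) (xN N)) (Hankel a x))
    with (seq_add (Hankel (aN N) (seq_sub (xN N) x)) (Hankel (seq_sub (aN N) a) x)).
  - eapply nb_mono.
    + apply nb_add; [apply nn_one| |].
      * apply nb_Hankel_l2; [apply HaN|apply H1].
      * apply nb_Hankel_l2; [apply H2|apply Hx].
    + assert (E1 : A * (eps / 2 / (A + 1)) <= eps / 2).
      { apply Rmult_le_reg_r with (A + 1); [lra|].
        replace (A * (eps / 2 / (A + 1)) * (A + 1)) with (A * (eps / 2)) by (field; lra). nra. }
      assert (E2 : eps / 2 / (B + 1) * B <= eps / 2).
      { apply Rmult_le_reg_r with (B + 1); [lra|].
        replace (eps / 2 / (B + 1) * B * (B + 1)) with (B * (eps / 2)) by (field; lra). nra. }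
      lra.
  - rewrite Hankel_sub_r, Hankel_sub_l; eauto using hankel_conv_l2.
    apply functional_extensionality. intros n. unfold seq_add, seq_sub. ring.
Qed.

(** Operator, vector and order of the Taylor polynomial vary together. The common bound [a] makes
    all tails beyond some [K] small at once; with [K] fixed, finitely many powers remain and each
    one converges. *)
Lemma limq_eP (AN : nat -> seqC -> seqC) A a c x (xN : nat -> seqC) :
  0 <= a -> (forall N, nbop one_w (AN N) a) -> nbop one_w A a ->
  (forall y (yN : nat -> seqC), l2 y -> (forall N, l2 (yN N)) -> limq one_w yN y ->
     limq one_w (fun N => AN N (yN N)) (A y)) ->
  l2 x -> (forall N, l2 (xN N)) -> limq one_w xN x ->
  limq one_w (fun N => eP (AN N) c N (xN N)) (expOp A c x).
Proof.
  intros Ha HAN HA Hlim Hx HxN Hxlim eps He.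
  apply l2_nb1 in Hx as [B HB]. assert (HB0 := nb_nonneg _ _ _ HB).
  assert (Hit : forall k, limq one_w (fun N => Nat.iter k (AN N) (xN N)) (Nat.iter k A x)).
  { induction k as [|k IH]; simpl; [easy|]. apply Hlim; auto.
    - apply l2_nb1. eexists. apply nb_iter; eauto.
    - intros N. destruct (proj1 (l2_nb1 _) (HxN N)) as [D HD].
      apply l2_nb1. eexists. apply nb_iter; eauto. }
  assert (HK : forall K, limq one_w (fun N => eP (AN N) c K (xN N)) (eP A c K x)).
  { induction K as [|K IH]; [apply (limq_const one_w zero_seq)|].
    apply (limq_plus one_w (fun N => eP (AN N) c K (xN N))
       (fun N => seq_scal (ecoef c K) (Nat.iter K (AN N) (xN N)))
       (eP A c K x) (seq_scal (ecoef c K) (Nat.iter K A x))); auto using nn_one.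
    apply limq_scal, Hit. }
  set (y := Cmod c * a).
  assert (Hy : 0 <= y) by (apply Rmult_le_pos; [apply Cmod_ge_0|easy]).
  assert (Ht := is_lim_etail y). apply is_lim_seq_spec in Ht.
  assert (He3 : 0 < eps / 3 / (B + 1)) by (repeat apply Rdiv_lt_0_compat; lra).
  destruct (Ht (mkposreal _ He3)) as [K HtK]. specialize (HtK K (Nat.le_refl K)).
  simpl in HtK. rewrite Rminus_0_r, Rabs_pos_eq in HtK by now apply etail_nonneg.
  destruct (HK K (eps / 3)) as [N1 H1]; [lra|].
  destruct (limq_bounded _ _ _ _ nn_one Hxlim HB) as [N2 HN2].
  exists (Nat.max K (Nat.max N1 N2)). intros N HN.
  specialize (H1 N ltac:(lia)). specialize (HN2 N ltac:(lia)).
  assert (T1 := nb_eP_tail (AN N) a c (xN N) (B + 1) K N Ha (HAN N) HN2 ltac:(lia)).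
  assert (T2 := nb_expOp_tail A a c x B K Ha HA HB). fold y in T1, T2.
  replace (seq_sub (eP (AN N) c N (xN N)) (expOp A c x))
    with (seq_sub (seq_add (seq_sub (eP (AN N) c N (xN N)) (eP (AN N) c K (xN N)))
                (seq_sub (eP (AN N) c K (xN N)) (eP A c K x)))
             (seq_sub (expOp A c x) (eP A c K x))).
  - eapply nb_mono; [apply nb_sub; [apply nn_one|apply nb_add; [apply nn_one|exact T1|exact H1]|exact T2]|].
    assert (E : etail y K * (B + 1) <= eps / 3).
    { apply Rle_trans with (eps / 3 / (B + 1) * (B + 1)).
      - apply Rmult_le_compat_r; lra.
      - right. field. lra. }
    assert (E0 := etail_nonneg y K Hy). nra.
  - apply functional_extensionality. intros n. unfold seq_add, seq_sub. ring.
Qed.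

Lemma limq_H2 a A (aN : nat -> seqC) :
  nb hw a A -> (forall N, nb hw (aN N) A) -> limq hw aN a ->
  forall y (yN : nat -> seqC), l2 y -> (forall N, l2 (yN N)) -> limq one_w yN y ->
     limq one_w (fun N => H2 (aN N) (yN N)) (H2 a y).
Proof.
  intros Ha HaN Hlim y yN Hy HyN Hylim.
  destruct (proj1 (l2_nb1 _) Hy) as [B HB].
  apply limq_Hankel with A (A * B); auto.
  - now apply nb_Hankel_l2.
  - intros N. destruct (proj1 (l2_nb1 _) (HyN N)) as [D HD].
    apply l2_nb1. eexists. apply nb_Hankel_l2; eauto.
  - now apply limq_Hankel with A B.
Qed.

Lemma limq_Sstar_hw aN a : limq hw aN a -> limq hw (fun N => Sstar (aN N)) (Sstar a).
Proof.
  intros H eps He. destruct (H eps He) as [N0 H0]. exists N0. intros N HN.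
  apply (nb_hw_Sstar (seq_sub (aN N) a)). auto.
Qed.

Lemma limq_Sstar aN a : limq one_w aN a -> limq one_w (fun N => Sstar (aN N)) (Sstar a).
Proof.
  intros H eps He. destruct (H eps He) as [N0 H0]. exists N0. intros N HN.
  apply (nb1_Sstar (seq_sub (aN N) a)), H0, HN.
Qed.

(** * Covariant derivatives *)

Lemma Cderiv_ext f g t d : (forall s, f s = g s) -> Cderiv f t d -> Cderiv g t d.
Proof.
  intros H [H1 H2]. split; eapply is_derive_ext; try eassumption; intros; cbv beta; now rewrite H.
Qed.

Lemma Cderiv_eq f t d d' : Cderiv f t d -> d = d' -> Cderiv f t d'.
Proof. now intros H <-. Qed.

Lemma Cderiv_const c t : Cderiv (fun _ => c) t (RtoC 0).
Proof. split; apply (is_derive_const (V := R_NormedModule)). Qed.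

Lemma Cderiv_plus f g t a b :
  Cderiv f t a -> Cderiv g t b -> Cderiv (fun s => Cplus (f s) (g s)) t (Cplus a b).
Proof.
  intros [F1 F2] [G1 G2]. split.
  - apply (is_derive_plus (fun s => Re (f s)) (fun s => Re (g s))); easy.
  - apply (is_derive_plus (fun s => Im (f s)) (fun s => Im (g s))); easy.
Qed.

Lemma Cderiv_mult f g t a b :
  Cderiv f t a -> Cderiv g t b ->
  Cderiv (fun s => Cmult (f s) (g s)) t (Cplus (Cmult a (g t)) (Cmult (f t) b)).
Proof.
  intros [F1 F2] [G1 G2].
  assert (M : forall (p q : R -> R) (p' q' : R), is_derive p t p' -> is_derive q t q' ->
    is_derive (fun s => p s * q s) t (p' * q t + p t * q')).
  { intros p q p' q' Hp Hq. apply (is_derive_mult p q t p' q' Hp Hq).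
    intros; apply Rmult_comm. }
  split.
  - eapply (is_derive_ext (fun s => Re (f s) * Re (g s) - Im (f s) * Im (g s)));
      [reflexivity|].
    replace (Re (Cplus (Cmult a (g t)) (Cmult (f t) b))) with
      ((Re a * Re (g t) + Re (f t) * Re b) - (Im a * Im (g t) + Im (f t) * Im b))
      by (simpl; unfold Re, Im; ring).
    apply (is_derive_minus (fun s => Re (f s) * Re (g s)) (fun s => Im (f s) * Im (g s)));
      apply M; easy.
  - eapply (is_derive_ext (fun s => Re (f s) * Im (g s) + Im (f s) * Re (g s)));
      [reflexivity|].
    replace (Im (Cplus (Cmult a (g t)) (Cmult (f t) b))) with
      ((Re a * Im (g t) + Re (f t) * Im b) + (Im a * Re (g t) + Im (f t) * Re b))
      by (simpl; unfold Re, Im; ring).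
    apply (is_derive_plus (fun s => Re (f s) * Im (g s)) (fun s => Im (f s) * Re (g s)));
      apply M; easy.
Qed.

Lemma Cderiv_conj f t a : Cderiv f t a -> Cderiv (fun s => Cconj (f s)) t (Cconj a).
Proof.
  intros [F1 F2]. split; [easy|].
  apply (is_derive_opp (fun s => Im (f s))). easy.
Qed.

Lemma Cderiv_scal c f t a : Cderiv f t a -> Cderiv (fun s => Cmult c (f s)) t (Cmult c a).
Proof.
  intros H. eapply Cderiv_eq; [apply Cderiv_mult; [apply Cderiv_const|exact H]|].
  cbv beta. ring.
Qed.

Lemma Cderiv_csum (f : R -> nat -> C) (a : nat -> C) t M :
  (forall k, (k < M)%nat -> Cderiv (fun s => f s k) t (a k)) ->
  Cderiv (fun s => csum (f s) M) t (csum a M).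
Proof.
  induction M as [|M IH]; intros H.
  - apply (Cderiv_const (RtoC 0)).
  - apply (Cderiv_plus (fun s => csum (f s) M) (fun s => f s M));
      [apply IH; intros; apply H; lia|apply H; lia].
Qed.

(* [g] is the covariant derivative [x' + i T_{|v|^2} x] of [x]. *)
Definition dc (L : nat) (v x g : R -> seqC) : Prop :=
  (forall s, fs L (v s)) /\ (forall s, fs L (x s)) /\
  forall s n, Cderiv (fun r => x r n) s
                (Cminus (g s n) (Cmult Ci (toep L (v s) (x s) n))).

Lemma dc_eq L v x g g' : dc L v x g -> (forall s, g s = g' s) -> dc L v x g'.
Proof. intros [H1 [H2 H3]] H. split; [easy|]. split; [easy|]. intros. rewrite <- H. apply H3. Qed.

Lemma toep_add L v x y : toep L v (seq_add x y) = seq_add (toep L v x) (toep L v y).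
Proof.
  apply functional_extensionality. intros n. unfold toep, seq_add.
  rewrite <- csum_plus. apply csum_ext. intros. ring.
Qed.

Lemma toep_scal L v c x : toep L v (seq_scal c x) = seq_scal c (toep L v x).
Proof.
  apply functional_extensionality. intros n. unfold toep, seq_scal.
  rewrite <- csum_scal. apply csum_ext. intros. ring.
Qed.

Lemma fs_add L x y : fs L x -> fs L y -> fs L (seq_add x y).
Proof. intros Hx Hy n Hn. unfold seq_add. rewrite Hx, Hy by easy. ring. Qed.

Lemma fs_scal L c x : fs L x -> fs L (seq_scal c x).
Proof. intros Hx n Hn. unfold seq_scal. rewrite Hx by easy. ring. Qed.

Lemma dc_add L v x y g h : dc L v x g -> dc L v y h ->
  dc L v (fun s => seq_add (x s) (y s)) (fun s => seq_add (g s) (h s)).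
Proof.
  intros [V [X G]] [_ [Y H]]. split; [easy|]. split; [auto using fs_add|]. intros s n.
  apply (Cderiv_eq _ _ (Cplus (Cminus (g s n) (Cmult Ci (toep L (v s) (x s) n)))
     (Cminus (h s n) (Cmult Ci (toep L (v s) (y s) n))))).
  - apply (Cderiv_plus (fun r => x r n) (fun r => y r n)); [apply G|apply H].
  - rewrite toep_add. unfold seq_add. ring.
Qed.

Lemma dc_zero L v : (forall s, fs L (v s)) -> dc L v (fun _ => zero_seq) (fun _ => zero_seq).
Proof.
  intros V. split; [easy|]. split; [easy|]. intros s n.
  apply (Cderiv_eq _ _ (RtoC 0)); [apply Cderiv_const|].
  unfold toep, zero_seq. rewrite csum_eq0; [ring|]. intros. ring.
Qed.

Lemma dc_scal L v x g (phi phi' : R -> C) :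
  (forall s, Cderiv phi s (phi' s)) -> dc L v x g ->
  dc L v (fun s => seq_scal (phi s) (x s))
         (fun s => seq_add (seq_scal (phi' s) (x s)) (seq_scal (phi s) (g s))).
Proof.
  intros P [V [X G]]. split; [easy|]. split; [auto using fs_scal|]. intros s n.
  eapply Cderiv_eq; [apply Cderiv_mult; [apply P|apply G]|].
  cbv beta. rewrite toep_scal. unfold seq_add, seq_scal. ring.
Qed.

Lemma dc_Sstar L v x g : dc L v x g ->
  dc L v (fun s => Sstar (x s))
    (fun s => seq_sub (Sstar (g s))
       (seq_scal (Cmult Ci (x s O)) (Sstar (H2 (v s) one_fn)))).
Proof.
  intros [V [X G]]. split; [easy|]. split; [auto using fs_Sstar|]. intros s n.
  eapply Cderiv_eq; [apply (G s (S n))|].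
  assert (E := f_equal (fun f => f n) (Sstar_toep L (v s) (x s) (V s) (X s))).
  unfold Sstar at 1 in E. cbv beta in E. rewrite E.
  unfold seq_sub, seq_add, seq_scal, Sstar. ring.
Qed.

(* Used with [V = v] for [H_v] and with [V = S^* v] for [K_v]; the term [H_F x] is the error due
   to the truncation. *)
Definition lax (L : nat) (v V F : R -> seqC) : Prop :=
  (forall s, fs L (V s)) /\
  forall x g, dc L v x g ->
    dc L v (fun s => Hankel (V s) (x s))
      (fun s => seq_add (seq_scal Ci (H2 (V s) (Hankel (V s) (x s))))
                  (seq_add (Hankel (V s) (g s)) (Hankel (F s) (x s)))).

(** Product rule with [v' = F - i T v] and [x' = g - i T x]. Antilinearity turns the last term into
    [+ i H_v T x], and [Hankel_toep] rewrites [- i H_{Tv} x + i H_v T x] as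
    [i H_v^3 x - i T H_v x]. *)
Lemma lax_H L v F : dc L v v F -> lax L v v F.
Proof.
  intros [V [_ DV]]. split; [easy|]. intros x g [_ [X G]].
  split; [easy|]. split; [intros; now apply fs_Hankel|]. intros s n.
  apply (Cderiv_ext (fun r => csum (fun m => Cmult (v r (n + m)%nat) (Cconj (x r m))) L)).
  { intros r. now rewrite (Hankel_fs_l L). }
  eapply Cderiv_eq; [apply Cderiv_csum; intros m _; apply Cderiv_mult; [apply DV|apply Cderiv_conj, G]|].
  cbv beta.
  rewrite (csum_ext _ (fun m => Cplus
     (Cmult (seq_add (F s) (seq_scal (Copp Ci) (toep L (v s) (v s))) (n + m)%nat) (Cconj (x s m)))
     (Cmult (v s (n + m)%nat) (Cconj (seq_add (g s) (seq_scal (Copp Ci) (toep L (v s) (x s))) m))))).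
  2:{ intros m _. unfold seq_add, seq_scal. f_equal; [ring|]. do 2 f_equal. ring. }
  rewrite csum_plus, <- Hankel_fs_r, <- Hankel_fs_l by auto.
  rewrite Hankel_add_l, Hankel_add_r, Hankel_scal_l, Hankel_scal_r
    by eauto using hankel_conv_fs, hankel_conv_fs_r.
  rewrite (Hankel_toep L) by auto.
  replace (Cconj (Copp Ci)) with Ci by (apply injective_projections; simpl; ring).
  unfold seq_add, seq_sub, seq_scal, H2. ring.
Qed.

Lemma H2_add L v x y : fs L v -> H2 v (seq_add x y) = seq_add (H2 v x) (H2 v y).
Proof.
  intros Hv. unfold H2. now rewrite !Hankel_add_r by eauto using hankel_conv_fs.
Qed.

Lemma H2_scal L v c x : fs L v -> H2 v (seq_scal c x) = seq_scal c (H2 v x).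
Proof.
  intros Hv. unfold H2.
  now rewrite !Hankel_scal_r, Cconj_conj by eauto using hankel_conv_fs.
Qed.

(** Apply [S^*] to the identity for [H_v]: the rank one term left by commuting [S^*] with [T] is the
    difference between [S^* H_v^2] and [K_v^2 S^*]. *)
Lemma lax_K L v F : dc L v v F -> lax L v (fun s => Sstar (v s)) (fun s => Sstar (F s)).
Proof.
  intros HF. destruct (lax_H L v F HF) as [V HL]. split; [auto using fs_Sstar|].
  intros x g Hx. assert (HD := dc_Sstar _ _ _ _ (HL x g Hx)).
  apply dc_eq with (1 := HD). intros s.
  rewrite !Hankel_Sstar. rewrite <- K2_H2, (K2_Sstar L) by auto.
  apply functional_extensionality. intros n.
  unfold seq_sub, seq_add, seq_scal, Sstar. ring.
Qed.

Lemma H2_fs_l L v x : fs L v -> fs L (H2 v x).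
Proof. intros. now apply fs_Hankel. Qed.

Definition lax_err (V F : seqC) (x : seqC) : seqC :=
  seq_add (Hankel V (Hankel F x)) (Hankel F (Hankel V x)).

(** The outer operator produces [i H^4 x], while antilinearity gives [H (i H^3 x) = - i H^4 x].
    These cancel and only the terms containing [F] remain. *)
Lemma dc_H2 L v V F x g : lax L v V F -> dc L v x g ->
  dc L v (fun s => H2 (V s) (x s))
    (fun s => seq_add (H2 (V s) (g s)) (lax_err (V s) (F s) (x s))).
Proof.
  intros [HV HL] Hx. eapply dc_eq; [apply HL, HL, Hx|]. intros s. cbv beta.
  rewrite !Hankel_add_r, Hankel_scal_r by eauto using hankel_conv_fs.
  replace (Cconj Ci) with (Copp Ci) by (apply injective_projections; simpl; ring).
  apply functional_extensionality. intros n.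
  unfold lax_err, seq_add, seq_scal, H2. ring.
Qed.

(** Leibniz rule: the sum over [j < k] of [H_V^{2(k-1-j)}] applied to the commutator error at
    [H_V^{2j} x]. *)
Fixpoint iter_err (V F x : seqC) (k : nat) : seqC :=
  match k with
  | O => zero_seq
  | S j => seq_add (H2 V (iter_err V F x j)) (lax_err V F (Nat.iter j (H2 V) x))
  end.

Lemma dc_iter L v V F x g k : lax L v V F -> dc L v x g ->
  dc L v (fun s => Nat.iter k (H2 (V s)) (x s))
    (fun s => seq_add (Nat.iter k (H2 (V s)) (g s)) (iter_err (V s) (F s) (x s) k)).
Proof.
  intros HL Hx. induction k as [|k IH]; simpl.
  - apply dc_eq with (1 := Hx). intros s. apply functional_extensionality. intros n.
    unfold seq_add, zero_seq. ring.
  - eapply dc_eq; [apply (dc_H2 _ _ _ _ _ _ HL IH)|]. intros s. cbv beta.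
    rewrite (H2_add L) by apply HL.
    apply functional_extensionality. intros n. unfold seq_add. ring.
Qed.

Lemma RtoC_neq_0 x : x <> 0 -> RtoC x <> RtoC 0.
Proof. intros H E. apply H. now injection E. Qed.

Lemma ecoef_S c k : ecoef c (S k) = Cdiv (Cmult c (ecoef c k)) (RtoC (INR (S k))).
Proof.
  unfold ecoef. rewrite fact_simpl, mult_INR, RtoC_mult. simpl Cpow.
  assert (H1 : RtoC (INR (S k)) <> RtoC 0)
    by (apply RtoC_neq_0, not_0_INR; lia).
  assert (H2 : RtoC (INR (fact k)) <> RtoC 0)
    by (apply RtoC_neq_0, INR_fact_neq_0).
  field. auto.
Qed.

Lemma ecoef_0 c : ecoef c 0 = RtoC 1.
Proof. unfold ecoef. simpl. field. Qed.

(** The derivative of [c^k / k!] in [c], with the value 0 at [k = 0]. *)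
Definition ecoef_pred (c : C) (k : nat) : C :=
  match k with O => RtoC 0 | S j => ecoef c j end.

Lemma ecoef_pred_S c k : Cmult (RtoC (INR k)) (ecoef c k) = Cmult c (ecoef_pred c k).
Proof.
  destruct k as [|k]; simpl ecoef_pred; [simpl; ring|].
  rewrite ecoef_S.
  assert (H1 : RtoC (INR (S k)) <> RtoC 0)
    by (apply RtoC_neq_0, not_0_INR; lia).
  field. auto.
Qed.

Lemma Cderiv_ecoef (c : R -> C) t d k :
  Cderiv c t d -> Cderiv (fun s => ecoef (c s) k) t (Cmult d (ecoef_pred (c t) k)).
Proof.
  intros Hc. induction k as [|k IH].
  - apply (Cderiv_ext (fun _ => RtoC 1)); [intros; now rewrite ecoef_0|].
    apply (Cderiv_eq _ _ (RtoC 0)); [apply Cderiv_const|simpl; ring].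
  - assert (H1 : RtoC (INR (S k)) <> RtoC 0)
      by (apply RtoC_neq_0, not_0_INR; lia).
    apply (Cderiv_ext (fun s => Cmult (Cinv (RtoC (INR (S k)))) (Cmult (c s) (ecoef (c s) k)))).
    { intros s. rewrite ecoef_S. field. auto. }
    eapply Cderiv_eq; [apply Cderiv_scal, Cderiv_mult; [exact Hc|exact IH]|].
    simpl ecoef_pred.
    replace (Cmult (c t) (Cmult d (ecoef_pred (c t) k)))
      with (Cmult d (Cmult (RtoC (INR k)) (ecoef (c t) k)))
      by (rewrite ecoef_pred_S; ring).
    replace (RtoC (INR k)) with (Cminus (RtoC (INR (S k))) (RtoC 1)).
    + field. auto.
    + rewrite S_INR, RtoC_plus. ring.
Qed.

Lemma H2_csum L v (f : nat -> seqC) M : fs L v ->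
  H2 v (fun n => csum (fun k => f k n) M) = fun n => csum (fun k => H2 v (f k) n) M.
Proof.
  intros Hv. induction M as [|M IH].
  - apply functional_extensionality. intros n. simpl.
    change (fun _ : nat => RtoC 0) with zero_seq.
    replace zero_seq with (seq_scal (RtoC 0) zero_seq).
    + rewrite (H2_scal L) by easy. unfold seq_scal. ring.
    + apply functional_extensionality. intros m. unfold seq_scal, zero_seq. ring.
  - change (H2 v (seq_add (fun n => csum (fun k => f k n) M) (f M))
      = fun n => csum (fun k => H2 v (f k) n) (S M)).
    rewrite (H2_add L), IH by easy. reflexivity.
Qed.

Lemma H2_eP L v c M x : fs L v -> H2 v (eP (H2 v) c M x) = eP (H2 v) c M (H2 v x).
Proof.
  intros Hv. unfold eP.
  rewrite (H2_csum L v (fun k => seq_scal (ecoef c k) (Nat.iter k (H2 v) x))) by easy.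
  apply functional_extensionality. intros n. apply csum_ext. intros k _.
  rewrite (H2_scal L) by easy. unfold seq_scal. now rewrite <- Nat.iter_swap.
Qed.

Lemma iter_H2_add L v k x y : fs L v ->
  Nat.iter k (H2 v) (seq_add x y) = seq_add (Nat.iter k (H2 v) x) (Nat.iter k (H2 v) y).
Proof. intros Hv. induction k; simpl; [easy|]. now rewrite IHk, (H2_add L). Qed.

Lemma iter_H2_scal L v k c x : fs L v ->
  Nat.iter k (H2 v) (seq_scal c x) = seq_scal c (Nat.iter k (H2 v) x).
Proof. intros Hv. induction k; simpl; [easy|]. now rewrite IHk, (H2_scal L). Qed.

Lemma eP_add_r L v c M x y : fs L v ->
  eP (H2 v) c M (seq_add x y) = seq_add (eP (H2 v) c M x) (eP (H2 v) c M y).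
Proof.
  intros Hv. apply functional_extensionality. intros n. unfold eP. unfold seq_add at 2.
  rewrite <- csum_plus. apply csum_ext. intros k _.
  rewrite (iter_H2_add L) by easy. unfold seq_add. ring.
Qed.

Lemma eP_scal_r L v c M d x : fs L v ->
  eP (H2 v) c M (seq_scal d x) = seq_scal d (eP (H2 v) c M x).
Proof.
  intros Hv. apply functional_extensionality. intros n. unfold eP. unfold seq_scal at 2.
  rewrite <- csum_scal. apply csum_ext. intros k _.
  rewrite (iter_H2_scal L) by easy. unfold seq_scal. ring.
Qed.

(** Two sources of error: the commutators with the powers of [H_V^2], and the top term.
    Differentiating a Taylor polynomial lowers its degree, so [d H_V^2] times the polynomial
    contains one term of degree [M] in [H_V^2] too many, which is subtracted here. *)
Definition exp_err (V F : seqC) (c d : C) (M : nat) (x : seqC) : seqC :=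
  seq_add (fun n => csum (fun k => Cmult (ecoef c k) (iter_err V F x k n)) M)
    (seq_scal (Copp (Cmult d (ecoef_pred c M))) (Nat.iter M (H2 V) x)).

Lemma dc_eP L v V F x g (c : R -> C) d M :
  lax L v V F -> dc L v x g -> (forall s, Cderiv c s d) ->
  dc L v (fun s => eP (H2 (V s)) (c s) M (x s))
    (fun s => seq_add (seq_scal d (H2 (V s) (eP (H2 (V s)) (c s) M (x s))))
       (seq_add (eP (H2 (V s)) (c s) M (g s))
          (exp_err (V s) (F s) (c s) d M (x s)))).
Proof.
  intros HL Hx Hc. assert (HV := proj1 HL).
  induction M as [|M IH].
  - apply dc_eq with (1 := dc_zero L v (proj1 Hx)). intros s.
    rewrite (H2_eP L) by auto. apply functional_extensionality. intros n.
    unfold exp_err, seq_add, seq_scal, eP, zero_seq. simpl. ring.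
  - assert (HT := dc_scal L v _ _ (fun s => ecoef (c s) M) _
      (fun s => Cderiv_ecoef c s d M (Hc s)) (dc_iter L v V F x g M HL Hx)).
    assert (H := dc_add _ _ _ _ _ _ IH HT).
    apply dc_eq with (1 := H). intros s. cbv beta.
    rewrite !(H2_eP L) by auto. apply functional_extensionality. intros n.
    unfold exp_err, seq_add, seq_scal, eP. rewrite !csum_S.
    rewrite (Nat.iter_swap M (seqC) (H2 (V s)) (x s)).
    simpl ecoef_pred. change (Nat.iter (S M) (H2 (V s)) (x s)) with
      (H2 (V s) (Nat.iter M (H2 (V s)) (x s))). ring.
Qed.

(** * Approximate solutions *)

(** The order [N] and the time [s] are taken jointly: [N] large and [s] close to [t0]. This encodes
    local uniformity in time. *)
Definition near (t0 : R) (P : nat -> R -> Prop) : Prop :=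
  filter_prod eventually (locally t0) (fun p => P (fst p) (snd p)).

Lemma near_imp t0 P Q : (forall N s, P N s -> Q N s) -> near t0 P -> near t0 Q.
Proof. intros H. unfold near. apply filter_imp. intros [N s]. apply H. Qed.

Lemma near_and t0 P Q : near t0 P -> near t0 Q -> near t0 (fun N s => P N s /\ Q N s).
Proof. intros HP HQ. unfold near in *. now apply (filter_and (F := filter_prod eventually (locally t0))). Qed.

Lemma near_intro t0 (P : nat -> R -> Prop) N0 delta :
  0 < delta -> (forall N s, (N0 <= N)%nat -> Rabs (s - t0) < delta -> P N s) -> near t0 P.
Proof.
  intros Hd H.
  apply (Filter_prod _ _ _ (fun N => (N0 <= N)%nat) (fun s => Rabs (s - t0) < delta)).
  - exists N0. auto.
  - exists (mkposreal _ Hd). intros s Hs. exact Hs.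
  - intros N s. simpl. auto.
Qed.

Lemma near_elim t0 (P : nat -> R -> Prop) :
  near t0 P -> exists N0 delta, 0 < delta /\
    forall N s, (N0 <= N)%nat -> Rabs (s - t0) < delta -> P N s.
Proof.
  intros [Q1 Q2 [N0 H1] [d H2] H]. exists N0, (pos d). split; [apply cond_pos|].
  intros N s HN Hs. apply H; [now apply H1|]. apply H2. exact Hs.
Qed.

Definition small (t0 : R) (q : nat -> R) (r : nat -> R -> seqC) : Prop :=
  forall eta, 0 < eta -> near t0 (fun N s => nb q (r N s) eta).

Lemma nbop_H2_w V R0 : nb hw V R0 -> nbop w (H2 V) (4 * R0 ^ 2).
Proof.
  intros HV x B Hx. replace (4 * R0 ^ 2 * B) with (2 * R0 * (2 * R0 * B)) by ring.
  apply nb_Hankel_w; [easy|]. now apply nb_Hankel_w.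
Qed.

Lemma nbop_H2_wi V R0 : nb hw V R0 -> nbop wi (H2 V) (4 * R0 ^ 2).
Proof.
  intros HV x B Hx. replace (4 * R0 ^ 2 * B) with (2 * R0 * (2 * R0 * B)) by ring.
  apply nb_Hankel_wi; [easy|]. now apply nb_Hankel_wi.
Qed.

Lemma nb_lax_err V F x R0 eta X :
  nb hw V R0 -> nb1 F eta -> nb w x X -> nb wi (lax_err V F x) (8 * R0 * eta * X).
Proof.
  intros HV HF Hx.
  replace (8 * R0 * eta * X) with (2 * R0 * (2 * eta * X) + 2 * eta * (2 * R0 * X)) by ring.
  apply nb_add; [apply nn_wi| |].
  - apply nb_Hankel_wi; [easy|]. now apply nb_Hankel_w_wi.
  - apply nb_Hankel_w_wi; [easy|]. now apply nb_Hankel_w.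
Qed.

Lemma nb_iter_err V F x R0 eta X k :
  nb hw V R0 -> nb1 F eta -> nb w x X ->
  nb wi (iter_err V F x k) ((2 * (4 * R0 ^ 2 + 1)) ^ k * (8 * R0 * eta * X)).
Proof.
  (* One step of the recursion multiplies by [4 R0^2] and adds at most [(4 R0^2)^k] times the basic
     error, so any base not below [4 R0^2 + 1] absorbs it. *)
  intros HV HF Hx. set (b := 2 * (4 * R0 ^ 2 + 1)).
  assert (HR := nb_nonneg _ _ _ HV). assert (He := nb_nonneg _ _ _ HF).
  assert (HX := nb_nonneg _ _ _ Hx).
  assert (Hrho : 0 <= 8 * R0 * eta * X) by (repeat apply Rmult_le_pos; lra).
  assert (Hb : 4 * R0 ^ 2 <= b) by (unfold b; assert (H := pow2_ge_0 R0); lra).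
  assert (H4 : 0 <= 4 * R0 ^ 2) by (assert (H := pow2_ge_0 R0); lra).
  induction k as [|k IH]; simpl iter_err.
  - apply nb_zero. simpl. lra.
  - eapply nb_mono.
    + apply nb_add; [apply nn_wi|apply (nbop_H2_wi V R0 HV _ _ IH)|].
      apply nb_lax_err; [exact HV|exact HF|apply (nb_iter w _ _ _ _ k (nbop_H2_w V R0 HV) Hx)].
    + assert (E : (4 * R0 ^ 2) ^ k <= b ^ k) by (apply pow_incr; lra).
      replace (8 * R0 * eta * ((4 * R0 ^ 2) ^ k * X))
        with ((4 * R0 ^ 2) ^ k * (8 * R0 * eta * X)) by ring.
      assert (E2 : (4 * R0 ^ 2) ^ k * (8 * R0 * eta * X) <= b ^ k * (8 * R0 * eta * X))
        by (apply Rmult_le_compat_r; auto).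
      assert (E3 : 0 <= b ^ k * (8 * R0 * eta * X))
        by (apply Rmult_le_pos; [apply pow_le; lra|easy]).
      set (z := b ^ k * (8 * R0 * eta * X)) in *.
      replace (b ^ S k * (8 * R0 * eta * X)) with (b * z) by (unfold z; simpl; ring).
      apply Rle_trans with (4 * R0 ^ 2 * z + z); [lra|].
      assert (E4 := Rmult_le_pos _ _ H4 E3). unfold b. lra.
Qed.

Lemma w_wi_le n : wi n <= w n.
Proof. assert (H1 := wi_le1 n). assert (H2 := w_ge1 n). lra. Qed.

Lemma eterm_mono y y' k : 0 <= y <= y' -> eterm y k <= eterm y' k.
Proof.
  intros H. apply Rmult_le_compat_r; [apply Rlt_le, Rinv_0_lt_compat, INR_fact_lt_0|].
  now apply pow_incr.
Qed.

Lemma exp_le_compat x y : x <= y -> exp x <= exp y.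
Proof.
  intros [H|H]; [apply Rlt_le, exp_increasing, H|rewrite H; lra].
Qed.

(** The iterated errors grow geometrically in [k] and the factorials turn this into an exponential.
    The top Taylor term is even bounded in X, and the bound is weakened to X'. *)
Lemma nb_exp_err V F c d M x R0 eta X Th :
  nb hw V R0 -> nb1 F eta -> nb w x X -> Cmod c <= Th ->
  nb wi (exp_err V F c d (S M) x)
    (exp (Th * (2 * (4 * R0 ^ 2 + 1))) * (8 * R0 * X) * eta
     + Cmod d * (4 * R0 ^ 2) * X * eterm (Th * (4 * R0 ^ 2)) M).
Proof.
  intros HV HF Hx Hc.
  assert (HR := nb_nonneg _ _ _ HV). assert (He := nb_nonneg _ _ _ HF).
  assert (HX := nb_nonneg _ _ _ Hx). assert (Hc0 := Cmod_ge_0 c).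
  assert (H4 : 0 <= 4 * R0 ^ 2) by (assert (H := pow2_ge_0 R0); lra).
  apply nb_add; [apply nn_wi| |].
  - set (b := 2 * (4 * R0 ^ 2 + 1)). assert (Hb : 0 <= b) by (unfold b; lra).
    set (rho := 8 * R0 * eta * X).
    assert (Hrho : 0 <= rho) by (unfold rho; repeat apply Rmult_le_pos; lra).
    eapply nb_mono.
    + apply (nb_csum wi (fun k => seq_scal (ecoef c k) (iter_err V F x k))
        (fun k => Cmod (ecoef c k) * (b ^ k * rho)) (S M)); [apply nn_wi|].
      intros k _. apply nb_scal. now apply nb_iter_err.
    + apply Rle_trans with (rsum (fun k => rho * eterm (Th * b) k) (S M)).
      * apply rsum_le. intros k _. rewrite Cmod_ecoef.
        apply Rle_trans with (rho * eterm (Cmod c * b) k).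
        -- right. unfold eterm. rewrite Rpow_mult_distr. unfold Rdiv. ring.
        -- apply Rmult_le_compat_l; [easy|]. apply eterm_mono. split; [nra|].
           apply Rmult_le_compat_r; lra.
      * rewrite rsum_scal.
        assert (H := rsum_eterm_le (Th * b) (S M) ltac:(nra)).
        replace (exp (Th * b) * (8 * R0 * X) * eta) with (rho * exp (Th * b))
          by (unfold rho; ring).
        now apply Rmult_le_compat_l.
  - apply nb_weight with w; [apply w_wi_le|].
    eapply nb_mono.
    + apply nb_scal, (nb_iter w _ _ _ _ (S M) (nbop_H2_w V R0 HV) Hx).
    + rewrite Cmod_opp, Cmod_mult. change (ecoef_pred c (S M)) with (ecoef c M).
      rewrite Cmod_ecoef.
      apply Rle_trans with
        (Cmod d * (4 * R0 ^ 2) * X * eterm (Cmod c * (4 * R0 ^ 2)) M).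
      * right. unfold eterm. rewrite (Rpow_mult_distr (Cmod c)), <- (tech_pow_Rmult (4 * R0 ^ 2) M).
        generalize ((4 * R0 ^ 2) ^ M). intros. unfold Rdiv. ring.
      * apply Rmult_le_compat_l.
        -- repeat apply Rmult_le_pos; auto using Cmod_ge_0; lra.
        -- apply eterm_mono. split; [nra|]. apply Rmult_le_compat_r; lra.
Qed.

Lemma exists_small_factor C0 eta : 0 <= C0 -> 0 < eta -> exists e, 0 < e /\ C0 * e <= eta.
Proof.
  intros HC He. exists (eta / (C0 + 1)). split; [apply Rdiv_lt_0_compat; lra|].
  apply Rmult_le_reg_r with (C0 + 1); [lra|].
  replace (C0 * (eta / (C0 + 1)) * (C0 + 1)) with (C0 * eta) by (field; lra). nra.
Qed.

(** Satisfied both by the symbol of [H] and by that of [K], so that the two exponentials are treated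
    by a single lemma. *)
Record approx_lax (t0 : R) (v V F : nat -> R -> seqC) (R0 : R) : Prop := {
  al_lax : forall N, (1 <= N)%nat -> lax N (v N) (V N) (F N);
  al_bound : near t0 (fun N s => nb hw (V N s) R0);
  al_small : small t0 one_w F }.

(* Approximate solutions of [D x = tau H_V^2 x]: the remainder only tends to [0] in the dual of
   the space in which [x] is bounded. *)
Definition asol (t0 : R) (v V : nat -> R -> seqC) (tau : C) (x : nat -> R -> seqC) : Prop :=
  exists r,
    (forall N, (1 <= N)%nat -> dc N (v N) (x N)
        (fun s => seq_add (seq_scal tau (H2 (V N s) (x N s))) (r N s))) /\
    small t0 wi r /\ exists X, near t0 (fun N s => nb w (x N s) X).

Lemma near_ge1 t0 : near t0 (fun N _ => (1 <= N)%nat).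
Proof. apply near_intro with 1%nat 1; [lra|auto]. Qed.

(** The predecessor appears because the polynomial with [N] terms ends at degree [N - 1], and the
    top term in [exp_err] carries that coefficient. *)
Lemma near_eterm t0 y C0 eta : 0 <= C0 -> 0 <= y -> 0 < eta ->
  near t0 (fun N _ => C0 * eterm y (Nat.pred N) <= eta).
Proof.
  intros HC Hy He. destruct (exists_small_factor C0 eta HC He) as [e [He0 He1]].
  assert (H := is_lim_eterm y). apply is_lim_seq_spec in H.
  destruct (H (mkposreal e He0)) as [N0 HN0].
  apply near_intro with (S N0) 1; [lra|]. intros N s HN _.
  specialize (HN0 (Nat.pred N) ltac:(lia)). simpl in HN0.
  rewrite Rminus_0_r, Rabs_pos_eq in HN0 by now apply eterm_nonneg.
  eapply Rle_trans; [|exact He1]. apply Rmult_le_compat_l; lra.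
Qed.

(** As [D] commutes with [H_V^2] up to errors, the exponential adds its own rate [d] to [tau]. The
    old remainder is only small in X', whence the need for [H_V^2] to be bounded there too. *)
Lemma asol_exp t0 v V F R0 tau x (c : R -> C) d Th :
  approx_lax t0 v V F R0 -> asol t0 v V tau x ->
  (forall s, Cderiv c s d) -> 0 <= Th -> near t0 (fun _ s => Cmod (c s) <= Th) ->
  asol t0 v V (Cplus d tau) (fun N s => eP (H2 (V N s)) (c s) N (x N s)).
Proof.
  intros HV [r [Hdc [Hr [X HX]]]] Hc HTh Hcb.
  exists (fun N s => seq_add (eP (H2 (V N s)) (c s) N (r N s))
      (exp_err (V N s) (F N s) (c s) d N (x N s))).
  assert (H4 : 0 <= 4 * R0 ^ 2) by (assert (H := pow2_ge_0 R0); lra).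
  split; [|split].
  - intros N HN. assert (HL := al_lax _ _ _ _ _ HV N HN).
    assert (Hfs := proj1 HL).
    eapply dc_eq; [apply (dc_eP N (v N) (V N) (F N) (x N) _ c d N HL (Hdc N HN) Hc)|].
    intros s. cbv beta. rewrite (eP_add_r N), (eP_scal_r N), (H2_eP N) by auto.
    apply functional_extensionality. intros n. unfold seq_add, seq_scal. ring.
  - intros eta He.
    destruct (near_elim _ _ (near_and _ _ _ HX (al_bound _ _ _ _ _ HV)))
      as [N1 [d1 [Hd1 HR]]].
    assert (HX0 : 0 <= X /\ 0 <= R0).
    { destruct (HR N1 t0) as [H1 H2]; [lia|rewrite Rminus_diag, Rabs_R0; lra|].
      split; eapply nb_nonneg; eauto. }
    destruct HX0 as [HX0 HR0].
    (* A third of [eta] for each of the errors coming from the old remainder, from [F] and from the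
       top Taylor term. *)
    destruct (exists_small_factor (exp (Th * (4 * R0 ^ 2))) (eta / 3))
      as [e1 [He1 HE1]]; [apply Rlt_le, exp_pos|lra|].
    destruct (exists_small_factor (exp (Th * (2 * (4 * R0 ^ 2 + 1))) * (8 * R0 * X)) (eta / 3))
      as [e2 [He2 HE2]];
      [apply Rmult_le_pos; [apply Rlt_le, exp_pos|repeat apply Rmult_le_pos; lra]|lra|].
    assert (N3 := near_eterm t0 (Th * (4 * R0 ^ 2)) (Cmod d * (4 * R0 ^ 2) * X) (eta / 3)).
    apply near_imp with (2 := near_and _ _ _ (near_and _ _ _ (Hr e1 He1) (al_small _ _ _ _ _ HV e2 He2))
       (near_and _ _ _ (near_and _ _ _ HX (al_bound _ _ _ _ _ HV))
         (near_and _ _ _ (near_and _ _ _ Hcb (near_ge1 t0))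
         (N3 ltac:(repeat apply Rmult_le_pos; auto using Cmod_ge_0; lra) ltac:(nra) ltac:(lra))))).
    intros N s [[Hrs HFs] [[Hxs HVs] [[Hcs HN] Hes]]].
    destruct N as [|M]; [lia|]. simpl Nat.pred in Hes.
    eapply nb_mono.
    + apply nb_add; [apply nn_wi| |].
      * apply nb_eP; [apply nn_wi|exact H4|apply nbop_H2_wi, HVs|exact Hrs].
      * apply (nb_exp_err _ _ _ _ _ _ R0 e2 X Th); auto.
    + assert (E : exp (Cmod (c s) * (4 * R0 ^ 2)) * e1 <= exp (Th * (4 * R0 ^ 2)) * e1).
      { apply Rmult_le_compat_r; [lra|]. apply exp_le_compat, Rmult_le_compat_r; lra. }
      lra.
  - exists (exp (Th * (4 * R0 ^ 2)) * X).
    apply near_imp with (2 := near_and _ _ _ (near_and _ _ _ HX (al_bound _ _ _ _ _ HV)) Hcb).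
    intros N s [[Hxs HVs] Hcs]. eapply nb_mono.
    + apply nb_eP; [apply nn_w|exact H4|apply nbop_H2_w, HVs|exact Hxs].
    + assert (HX0 := nb_nonneg _ _ _ Hxs). apply Rmult_le_compat_r; [easy|].
      apply exp_le_compat, Rmult_le_compat_r; lra.
Qed.

(** For [tau = 0] the equation no longer mentions the operator; this is the passage from [K] back to
    [H]. *)
Lemma asol_0_change t0 v V V' x :
  asol t0 v V (RtoC 0) x -> asol t0 v V' (RtoC 0) x.
Proof.
  intros [r [Hdc Hr]]. exists r. split; [|easy]. intros N HN.
  eapply dc_eq; [apply (Hdc N HN)|]. intros s.
  apply functional_extensionality. intros n. unfold seq_add, seq_scal. ring.
Qed.

(** The weight [wi] decreases, so [S^*] is not a contraction for it; the 4 is the square of the norm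
    bound 2 in [nb_wi_Sstar]. *)
Lemma wi_le_4wi_S n : wi n <= 4 * wi (S n).
Proof.
  assert (H1 := w_ge1 n). assert (H2 := w_ge1 (S n)). unfold wi.
  assert (H : w (S n) <= 2 * w n).
  { apply Rnot_lt_le. intros Hlt.
    assert (H : (2 * w n) * (2 * w n) < w (S n) * w (S n)) by (apply Rmult_le_0_lt_compat; lra).
    rewrite w_sq, hw_S in H. assert (E := w_sq n). assert (E1 := hw_ge1 n). nra. }
  apply Rmult_le_reg_l with (w n * w (S n)); [apply Rmult_lt_0_compat; lra|].
  replace (w n * w (S n) * / w n) with (w (S n)) by (field; lra).
  replace (w n * w (S n) * (4 * / w (S n))) with (4 * w n) by (field; lra). lra.
Qed.

Lemma nb_wi_Sstar x B : nb wi x B -> nb wi (Sstar x) (2 * B).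
Proof.
  intros [H0 H]. split; [lra|]. intros N.
  apply Rle_trans with (4 * rsum (fun n => wi n * Cmod (x n) ^ 2) (S N)).
  - rewrite rsum_shift, Rmult_plus_distr_l, <- rsum_scal.
    assert (E : 0 <= 4 * (wi 0 * Cmod (x O) ^ 2)).
    { assert (H1 := wi_pos 0). assert (H2 := pow2_ge_0 (Cmod (x O))). nra. }
    assert (E2 : rsum (fun n => wi n * Cmod (Sstar x n) ^ 2) N
       <= rsum (fun i => 4 * (wi (S i) * Cmod (x (S i)) ^ 2)) N).
    { apply rsum_le. intros n _. unfold Sstar. rewrite <- Rmult_assoc.
      apply Rmult_le_compat_r; [apply pow2_ge_0|apply wi_le_4wi_S]. }
    lra.
  - specialize (H (S N)). nra.
Qed.

Lemma nb_w_Sstar x B : nb w x B -> nb w (Sstar x) B.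
Proof.
  intros [H0 H]. split; [lra|]. intros N.
  apply Rle_trans with (rsum (fun n => w n * Cmod (x n) ^ 2) (S N)); [|apply H].
  rewrite rsum_shift.
  assert (E : 0 <= w 0 * Cmod (x O) ^ 2).
  { assert (H1 := pos_w 0). assert (H2 := pow2_ge_0 (Cmod (x O))). nra. }
  assert (E2 : rsum (fun n => w n * Cmod (Sstar x n) ^ 2) N
     <= rsum (fun i => w (S i) * Cmod (x (S i)) ^ 2) N).
  { apply rsum_le. intros n _. unfold Sstar.
    apply Rmult_le_compat_r; [apply pow2_ge_0|apply w_mono; lia]. }
  lra.
Qed.

(** The rate has to be exactly [i]: the term [- i x_0 S^* H^2 1] left by the commutator with [T] is
    then what converts [i S^* H^2 x] into [i K^2 S^* x]. *)
Lemma asol_Sstar t0 v x :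
  asol t0 v v Ci x ->
  asol t0 v (fun N s => Sstar (v N s)) Ci (fun N s => Sstar (x N s)).
Proof.
  intros [r [Hdc [Hr [X HX]]]]. exists (fun N s => Sstar (r N s)). split; [|split].
  - intros N HN. eapply dc_eq; [apply dc_Sstar, (Hdc N HN)|].
    intros s. cbv beta. rewrite <- K2_H2, (K2_Sstar N) by apply (Hdc N HN).
    apply functional_extensionality. intros n.
    unfold seq_add, seq_sub, seq_scal, Sstar. ring.
  - intros eta He. apply near_imp with (2 := Hr (eta / 2) ltac:(lra)).
    intros N s H. replace eta with (2 * (eta / 2)) by field. now apply nb_wi_Sstar.
  - exists X. apply near_imp with (2 := HX). intros N s. apply nb_w_Sstar.
Qed.

Record approx_flow (t0 : R) (v F : nat -> R -> seqC) (R0 : R) : Prop := {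
  af_dc : forall N, (1 <= N)%nat -> dc N (v N) (v N) (F N);
  af_bound : near t0 (fun N s => nb hw (v N s) R0);
  af_small : small t0 one_w F }.

Lemma approx_flow_H t0 v F R0 : approx_flow t0 v F R0 -> approx_lax t0 v v F R0.
Proof.
  intros [H1 H2 H3]. split; auto. intros N HN. now apply lax_H, H1.
Qed.

Lemma approx_flow_K t0 v F R0 : approx_flow t0 v F R0 ->
  approx_lax t0 v (fun N s => Sstar (v N s)) (fun N s => Sstar (F N s)) R0.
Proof.
  intros [H1 H2 H3]. split.
  - intros N HN. now apply lax_K, H1.
  - apply near_imp with (2 := H2). intros N s. apply nb_hw_Sstar.
  - intros eta He. apply near_imp with (2 := H3 eta He). intros N s. apply nb1_Sstar.
Qed.

Lemma asol_symbol t0 v F R0 : approx_flow t0 v F R0 -> asol t0 v v (RtoC 0) v.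
Proof.
  intros [H1 H2 H3]. exists F. split; [|split].
  - intros N HN. eapply dc_eq; [apply (H1 N HN)|]. intros s.
    apply functional_extensionality. intros n. unfold seq_add, seq_scal. ring.
  - intros eta He. apply near_imp with (2 := H3 eta He). intros N s.
    apply nb_weight. intros n. apply wi_le1.
  - exists R0. apply near_imp with (2 := H2). intros N s. apply nb_weight, w_le_hw.
Qed.

Definition phase (a b : R) : C := Cmult (RtoC (a - b)) Ci.

(** The vectors [x_k] for the truncated symbol, with exponentials cut at the same order [N]; the
    time [t1] at which the phases vanish is a parameter. *)
Fixpoint xseq (t1 : R) (v : nat -> R -> seqC) (k : nat) : nat -> R -> seqC :=
  match k with
  | O => fun N s => eP (H2 (v N s)) (phase s t1) N (v N s)
  | S j => fun N s => eP (H2 (v N s)) (phase s t1) N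
      (eP (H2 (Sstar (v N s))) (phase t1 s) N (Sstar (xseq t1 v j N s)))
  end.

Lemma Cderiv_phase_l t1 s : Cderiv (fun s => phase s t1) s Ci.
Proof.
  unfold phase. split; simpl.
  - auto_derive; [easy|ring].
  - auto_derive; [easy|ring].
Qed.

Lemma Cderiv_phase_r t1 s : Cderiv (fun s => phase t1 s) s (Copp Ci).
Proof.
  unfold phase. split; simpl.
  - auto_derive; [easy|ring].
  - auto_derive; [easy|ring].
Qed.

Lemma Cmod_phase a b : Cmod (phase a b) = Rabs (a - b).
Proof. unfold phase. rewrite Cmod_mult, Cmod_R, Cmod_Ci. ring. Qed.

Lemma near_phase_l t0 t1 : near t0 (fun _ s => Cmod (phase s t1) <= Rabs (t0 - t1) + 1).
Proof.
  apply near_intro with O 1; [lra|]. intros N s _ Hs. rewrite Cmod_phase.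
  replace (s - t1) with ((t0 - t1) + (s - t0)) by ring.
  eapply Rle_trans; [apply Rabs_triang|lra].
Qed.

Lemma near_phase_r t0 t1 : near t0 (fun _ s => Cmod (phase t1 s) <= Rabs (t0 - t1) + 1).
Proof.
  apply near_imp with (2 := near_phase_l t0 t1). intros _ s.
  now rewrite !Cmod_phase, (Rabs_minus_sym t1 s).
Qed.

(** In each step the rate starts at [i]; [S^*] keeps it and replaces [H] by [K], the exponential of
    [K] lowers it to 0, the operator is changed back to [H], and the exponential of [H] restores
    [i]. *)
Lemma asol_xseq t0 t1 v F R0 k : approx_flow t0 v F R0 -> asol t0 v v Ci (xseq t1 v k).
Proof.
  intros Hf. assert (Th0 : 0 <= Rabs (t0 - t1) + 1)
    by (assert (H := Rabs_pos (t0 - t1)); lra).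
  assert (HF : forall x, asol t0 v v (RtoC 0) x ->
     asol t0 v v Ci (fun N s => eP (H2 (v N s)) (phase s t1) N (x N s))).
  { intros x Hx. replace Ci with (Cplus Ci (RtoC 0)) by ring.
    apply (asol_exp t0 v v F R0 (RtoC 0) x (fun s => phase s t1) Ci (Rabs (t0 - t1) + 1));
      auto using approx_flow_H, Cderiv_phase_l, near_phase_l. }
  induction k as [|k IH]; simpl xseq; apply HF.
  - eapply asol_symbol, Hf.
  - apply asol_0_change with (fun N s => Sstar (v N s)).
    replace (RtoC 0) with (Cplus (Copp Ci) Ci) by ring.
    apply (asol_exp t0 v (fun N s => Sstar (v N s)) (fun N s => Sstar (F N s)) R0 Ci
      (fun N s => Sstar (xseq t1 v k N s)) (fun s => phase t1 s) (Copp Ci) (Rabs (t0 - t1) + 1));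
      auto using approx_flow_K, Cderiv_phase_r, near_phase_r, asol_Sstar.
Qed.

(** * Quantities that become constant in the limit *)

Definition slow (t0 : R) (f : nat -> R -> C) : Prop :=
  forall eta, 0 < eta -> near t0 (fun N s => exists d, Cmod d <= eta /\ Cderiv (f N) s d).

(* [(T_{|v|^2} x | 1) = (H_v^2 x | 1)], so that only the remainder survives. *)
Lemma asol_slow t0 v x : asol t0 v v Ci x -> slow t0 (fun N s => x N s O).
Proof.
  intros [r [Hdc [Hr _]]] eta He.
  apply near_imp with (2 := near_and _ _ _ (near_ge1 t0) (Hr eta He)).
  intros N s [HN Hs]. exists (r N s O). split.
  - apply nb_coord with (n := O) in Hs; [|apply nn_wi].
    unfold wi, w, hw in Hs. simpl in Hs. rewrite Rplus_0_r, sqrt_1, Rinv_1, sqrt_1 in Hs. lra.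
  - destruct (Hdc N HN) as [V [X D]].
    eapply Cderiv_eq; [apply D|]. cbv beta. rewrite toep_at_0 by auto.
    unfold seq_add, seq_scal. ring.
Qed.

(** No derivative of [J] is presupposed. The mean value inequality for [f N] near [t0] has a
    constant independent of [N] and passes to the limit; hence the difference quotients of [J] tend
    to 0 everywhere. *)
Lemma real_const_of_slow (f : nat -> R -> R) (J : R -> R) :
  (forall t0 eta, 0 < eta ->
     near t0 (fun N s => exists d, Rabs d <= eta /\ is_derive (f N) s d)) ->
  (forall s, is_lim_seq (fun N => f N s) (J s)) -> forall a b, J a = J b.
Proof.
  intros Hs HJ.
  assert (HD : forall t, is_derive J t zero).
  { intros t0. apply is_derive_Reals. intros eps Heps.
    destruct (near_elim _ _ (Hs t0 (eps / 2) ltac:(lra))) as [N0 [d [Hd H]]].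
    exists (mkposreal d Hd). intros h Hh Hhd. simpl in Hhd.
    assert (HB : Rabs (J (t0 + h) - J t0) <= eps / 2 * Rabs h).
    { apply (is_lim_seq_le_loc (fun N => Rabs (f N (t0 + h) - f N t0)) (fun _ => eps / 2 * Rabs h)
        (Rabs (J (t0 + h) - J t0)) (eps / 2 * Rabs h)).
      - exists N0. intros N HN.
        replace (Rabs h) with (Rabs (t0 + h - t0)) by (f_equal; ring).
        apply (bounded_variation (f N) (Derive (f N))). intros s Hsr.
        replace (t0 + h - t0) with h in Hsr by ring.
        destruct (H N s HN ltac:(lra)) as [dd [Hdd Hder]].
        rewrite (is_derive_unique _ _ _ Hder). auto.
      - apply (is_lim_seq_abs _ (J (t0 + h) - J t0)), is_lim_seq_minus'; auto.
      - apply is_lim_seq_const. }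
    change (@zero R_AbelianMonoid) with 0.
    rewrite Rminus_0_r. unfold Rdiv. rewrite Rabs_mult, Rabs_inv.
    assert (Hp := Rabs_pos_lt h Hh).
    apply Rmult_lt_reg_r with (Rabs h); [easy|].
    rewrite Rmult_assoc, Rinv_l, Rmult_1_r by lra. nra. }
  assert (HE : forall a b, a < b -> J a = J b)
    by (intros a b Hab; apply (eq_is_derive J a b); auto).
  intros a b. destruct (Rtotal_order a b) as [H|[H|H]]; [auto|now f_equal|symmetry; auto].
Qed.

Lemma const_of_slow (f : nat -> R -> C) (J : R -> C) :
  (forall t0, slow t0 f) -> (forall s, Clim (fun N => f N s) (J s)) -> forall a b, J a = J b.
Proof.
  intros Hs HJ a b. apply injective_projections.
  - apply (real_const_of_slow (fun N s => Re (f N s)) (fun s => Re (J s))).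
    + intros t0 eta He. apply near_imp with (2 := Hs t0 eta He).
      intros N s [d [Hd [D _]]]. exists (Re d). split; [|easy].
      eapply Rle_trans; [apply Rabs_Re_le|easy].
    + intros s. apply Clim_Re, HJ.
  - apply (real_const_of_slow (fun N s => Im (f N s)) (fun s => Im (J s))).
    + intros t0 eta He. apply near_imp with (2 := Hs t0 eta He).
      intros N s [d [Hd [_ D]]]. exists (Im d). split; [|easy].
      eapply Rle_trans; [apply Rabs_Im_le|easy].
    + intros s. apply Clim_Im, HJ.
Qed.

(** * Unitarity of the exponentials *)

Lemma rsum_Cmod_mul_le x y A B N :
  nb1 x A -> nb1 y B -> rsum (fun n => Cmod (x n) * Cmod (y n)) N <= A * B.
Proof.
  intros [HA Hx] [HB Hy].
  assert (E : forall z, rsum (fun n => Cmod (z n) ^ 2) N = rsum (fun n => one_w n * Cmod (z n) ^ 2) N)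
    by (intros z; apply rsum_ext; intros; unfold one_w; ring).
  assert (H := rsum_cauchy (fun n => Cmod (x n)) (fun n => Cmod (y n)) N).
  cbv beta in H. rewrite !E in H. specialize (Hx N). specialize (Hy N).
  apply Rnot_lt_le. intros Hlt.
  assert (H0 : 0 <= A * B) by now apply Rmult_le_pos.
  assert (H1 : (A * B) * (A * B)
     < rsum (fun n => Cmod (x n) * Cmod (y n)) N * rsum (fun n => Cmod (x n) * Cmod (y n)) N)
    by (apply Rmult_le_0_lt_compat; auto).
  assert (H2 : rsum (fun n => one_w n * Cmod (x n) ^ 2) N * rsum (fun n => one_w n * Cmod (y n) ^ 2) N
     <= A ^ 2 * B ^ 2).
  { apply Rmult_le_compat; auto; apply rsum_nonneg; intros;
      apply Rmult_le_pos; auto using nn_one; apply pow2_ge_0. }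
  nra.
Qed.

Lemma Cmod_sq c : Cmod c ^ 2 = Re (Cmult c (Cconj c)).
Proof.
  unfold Cmod. rewrite pow2_sqrt by (assert (H1 := pow2_ge_0 (fst c)); assert (H2 := pow2_ge_0 (snd c)); lra).
  simpl. ring.
Qed.

(** By the symmetry of the Hankel matrix the form equals the squared norm of [H_v y]. *)
Lemma H2_form_real L v y : fs L v -> fs L y ->
  Im (csum (fun n => Cmult (H2 v y n) (Cconj (y n))) L) = 0.
Proof.
  intros Hv Hy. unfold H2. rewrite Hankel_sym by auto using fs_Hankel.
  rewrite Im_csum, (rsum_ext _ (fun _ => 0)), rsum_zero; [easy|].
  intros n _. simpl. ring.
Qed.

Lemma fs_eP L v c M x : fs L v -> fs L x -> fs L (eP (H2 v) c M x).
Proof.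
  intros Hv Hx n Hn. apply csum_eq0. intros k _.
  replace (Nat.iter k (H2 v) x n) with (RtoC 0); [ring|].
  destruct k as [|k]; symmetry; simpl; [now apply Hx|]. now apply (H2_fs_l L).
Qed.

Lemma rsum_fs_le (f : nat -> R) L K :
  (forall n, 0 <= f n) -> (forall n, (L <= n)%nat -> f n = 0) -> rsum f K <= rsum f L.
Proof.
  intros Hf H0. destruct (Nat.le_gt_cases K L) as [H|H]; [now apply rsum_mono|].
  right. induction H as [|K H IH]; rewrite rsum_S, H0 by lia; [ring|]. rewrite IH. ring.
Qed.

Lemma eP_0 A M x : eP A (RtoC 0) (S M) x = x.
Proof.
  apply functional_extensionality. intros n. unfold eP. rewrite csum_shift, ecoef_0.
  rewrite csum_eq0; [simpl; ring|]. intros k _. rewrite ecoef_S.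
  unfold Cdiv. ring.
Qed.

(** Bound for the growth of the squared norm over a time [T] when the exponential stops at degree
    [M]: the length [T] times the largest contribution of the missing term. *)
Definition eP_defect (a B T : R) (M : nat) : R :=
  2 * (a * B ^ 2 * exp (T * a)) * T * eterm (T * a) M.

Lemma nb_eP_isometry L v x R0 B tau M :
  fs L v -> fs L x -> nb hw v R0 -> nb1 x B ->
  nb1 (eP (H2 v) (phase tau 0) (S M) x) (sqrt (B ^ 2 + eP_defect (R0 * R0) B (Rabs tau) M)).
Proof.
  intros Hv Hx HR HB. set (a := R0 * R0).
  assert (Ha : 0 <= a) by (apply nb_nonneg in HR; unfold a; nra).
  assert (HA : nbop one_w (H2 v) a) by now apply nbop_H2.
  assert (HB0 := nb_nonneg _ _ _ HB).
  set (y s := eP (H2 v) (phase s 0) (S M) x).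
  assert (Hy : forall s, fs L (y s)) by (intros; now apply fs_eP).
  set (dy s := seq_scal Ci (seq_add (H2 v (y s))
     (seq_scal (Copp (ecoef (phase s 0) M)) (Nat.iter (S M) (H2 v) x)))).
  assert (Dy : forall s n, Cderiv (fun r => y r n) s (dy s n)).
  { intros s n. unfold y, eP. eapply Cderiv_eq.
    - apply Cderiv_csum. intros k _. apply Cderiv_mult;
        [apply (Cderiv_ecoef (fun s => phase s 0)), Cderiv_phase_l|apply Cderiv_const].
    - cbv beta. unfold dy, y. rewrite (H2_eP L) by easy. unfold seq_scal, seq_add, eP.
      rewrite (csum_shift (fun k => Cplus _ _)), csum_S. cbn [ecoef_pred].
      rewrite (csum_ext (fun k => Cplus _ _) (fun k => Cmult Ci (Cmult (ecoef (phase s 0) k)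
         (Nat.iter k (H2 v) (H2 v x) n)))).
      + rewrite csum_scal, (Nat.iter_swap M).
        change (Nat.iter (S M) (H2 v) x) with (H2 v (Nat.iter M (H2 v) x)).
        ring.
      + intros k _. rewrite Nat.iter_swap.
        change (Nat.iter (S k) (H2 v) x) with (H2 v (Nat.iter k (H2 v) x)). ring. }
  set (p s := rsum (fun n => Cmod (y s n) ^ 2) L).
  set (dp s := Re (csum (fun n => Cplus (Cmult (dy s n) (Cconj (y s n)))
                       (Cmult (y s n) (Cconj (dy s n)))) L)).
  assert (Dp : forall s, is_derive p s (dp s)).
  { intros s.
    assert (D : Cderiv (fun r => csum (fun n => Cmult (y r n) (Cconj (y r n))) L) s
       (csum (fun n => Cplus (Cmult (dy s n) (Cconj (y s n)))
                       (Cmult (y s n) (Cconj (dy s n)))) L)).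
    { apply Cderiv_csum. intros n _. apply Cderiv_mult; [apply Dy|apply Cderiv_conj, Dy]. }
    destruct D as [D _].
    eapply is_derive_ext; [|exact D]. intros r. cbv beta. unfold p. rewrite Re_csum.
    apply rsum_ext. intros n _. now rewrite Cmod_sq. }
  assert (Bdp : forall s, Rabs s <= Rabs tau ->
     Rabs (dp s) <= 2 * (a * B ^ 2 * exp (Rabs tau * a)) * eterm (Rabs tau * a) M).
  { intros s Hs.
    set (z := csum (fun n => Cmult (Nat.iter (S M) (H2 v) x n) (Cconj (y s n))) L).
    set (q := csum (fun n => Cmult (H2 v (y s) n) (Cconj (y s n))) L).
    assert (Hq : Im q = 0) by now apply H2_form_real.
    assert (Edp : dp s = 2 * Re (Copp (Cmult Ci (Cmult (ecoef (phase s 0) M) z)))).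
    { unfold dp. rewrite csum_plus.
      replace (csum (fun n => Cmult (y s n) (Cconj (dy s n))) L)
        with (Cconj (csum (fun n => Cmult (dy s n) (Cconj (y s n))) L)).
      2:{ rewrite Cconj_csum. apply csum_ext. intros. rewrite Cmult_conj, Cconj_conj. ring. }
      replace (csum (fun n => Cmult (dy s n) (Cconj (y s n))) L)
        with (Cmult Ci (Cminus q (Cmult (ecoef (phase s 0) M) z))).
      2:{ unfold q, z. rewrite <- csum_scal, <- csum_minus, <- csum_scal.
          apply csum_ext. intros. unfold dy, seq_scal, seq_add. ring. }
      set (ez := Cmult (ecoef (phase s 0) M) z).
      simpl. unfold Re, Im in *. rewrite Hq. ring. }
    rewrite Edp, Rabs_mult, (Rabs_pos_eq 2) by lra. rewrite Rmult_assoc.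
    apply Rmult_le_compat_l; [lra|].
    eapply Rle_trans; [apply Rabs_Re_le|].
    rewrite Cmod_opp, !Cmod_mult, Cmod_Ci, Rmult_1_l, Cmod_ecoef, Cmod_phase, Rminus_0_r.
    assert (Hz : Cmod z <= a ^ S M * B * (exp (Rabs tau * a) * B)).
    { eapply Rle_trans; [apply Cmod_csum|].
      rewrite (rsum_ext _ (fun n => Cmod (Nat.iter (S M) (H2 v) x n) * Cmod (y s n)))
        by (intros; now rewrite Cmod_mult, Cmod_conj).
      apply rsum_Cmod_mul_le; [now apply (nb_iter one_w)|].
      eapply nb_mono; [apply (nb_eP one_w _ a _ _ B); auto using nn_one|].
      apply Rmult_le_compat_r; [easy|]. apply exp_le_compat, Rmult_le_compat_r; [easy|].
      now rewrite Cmod_phase, Rminus_0_r. }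
    apply Rle_trans with (Rabs tau ^ M / INR (fact M) * (a ^ S M * B * (exp (Rabs tau * a) * B))).
    - apply Rmult_le_compat; [apply eterm_nonneg, Rabs_pos|apply Cmod_ge_0| |exact Hz].
      apply eterm_mono. split; [apply Rabs_pos|easy].
    - right. unfold eterm. rewrite Rpow_mult_distr, <- (tech_pow_Rmult a M). unfold Rdiv. ring. }
  assert (Hp : p tau <= B ^ 2 + eP_defect a B (Rabs tau) M).
  { assert (H := bounded_variation p dp
       (2 * (a * B ^ 2 * exp (Rabs tau * a)) * eterm (Rabs tau * a) M) 0 tau).
    rewrite Rminus_0_r in H.
    assert (H1 : Rabs (p tau - p 0)
       <= 2 * (a * B ^ 2 * exp (Rabs tau * a)) * eterm (Rabs tau * a) M * Rabs tau).
    { apply H. intros s Hs. rewrite Rminus_0_r in Hs. auto. }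
    apply Rabs_le_between in H1.
    assert (H0 : p 0 <= B ^ 2).
    { unfold p, y. replace (phase 0 0) with (RtoC 0).
      - rewrite eP_0. eapply Rle_trans; [|apply (proj2 HB L)]. right.
        apply rsum_ext. intros. unfold one_w. ring.
      - unfold phase. rewrite Rminus_0_r. ring. }
    unfold eP_defect. lra. }
  split; [apply sqrt_pos|]. intros K.
  assert (Hp0 : 0 <= p tau) by (apply rsum_nonneg; intros; apply pow2_ge_0).
  rewrite pow2_sqrt by lra. eapply Rle_trans; [|exact Hp].
  eapply Rle_trans; [apply (rsum_fs_le _ L)|].
  - intros n. apply Rmult_le_pos; [apply nn_one|apply pow2_ge_0].
  - intros n Hn. fold (y tau). rewrite Hy by easy. rewrite Cmod_0. ring.
  - right. apply rsum_ext. intros. unfold one_w. fold (y tau). ring.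
Qed.

Lemma Clim_incr_1 g l : Clim g l -> Clim (fun n => g (S n)) l.
Proof. intros H. apply (is_lim_seq_incr_1 (fun n => Cmod (Cminus (g n) l))), H. Qed.

Lemma l2_of_nb x B : nb1 x B -> l2 x.
Proof. intros H. apply l2_nb1. eauto. Qed.

(** The bound of [nb_expOp] would give the Neumann series in a smaller disc only. Here the defect
    disappears in the limit and the constant 1 is exact. *)
Lemma nb_expOp_isometry u R0 tau x B :
  nb hw u R0 -> nb1 x B -> nb1 (expOp (H2 u) (phase tau 0) x) B.
Proof.
  intros HR HB.
  assert (HRN : forall N, nb hw (trunc N u) R0) by (intros; apply nb_trunc; auto using nn_hw).
  assert (HBN : forall N, nb1 (trunc N x) B) by (intros; apply nb_trunc; auto using nn_one).
  assert (Ha : 0 <= R0 * R0) by (apply nb_nonneg in HR; nra).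
  assert (HL : limq one_w (fun N => eP (H2 (trunc N u)) (phase tau 0) N (trunc N x))
                 (expOp (H2 u) (phase tau 0) x)).
  { apply (limq_eP (fun N => H2 (trunc N u)) (H2 u) (R0 * R0)); auto using nbop_H2.
    - apply limq_H2 with R0; auto. eapply limq_trunc; eauto using nn_hw.
    - eapply l2_of_nb; eauto.
    - intros N. eapply l2_of_nb; eauto.
    - eapply limq_trunc; eauto using nn_one. }
  apply nb_limit with
    (fun M => eP (H2 (trunc (S M) u)) (phase tau 0) (S M) (trunc (S M) x))
    (fun M => sqrt (B ^ 2 + eP_defect (R0 * R0) B (Rabs tau) M)).
  - intros n. apply (Clim_incr_1 (fun N => eP (H2 (trunc N u)) (phase tau 0) N (trunc N x) n)).
    exact (limq_Clim _ _ n HL).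
  - intros M. apply nb_eP_isometry with (S M); auto using fs_trunc.
  - assert (HB0 := nb_nonneg _ _ _ HB).
    replace (Finite B) with (Finite (sqrt (B ^ 2))) by (f_equal; now apply sqrt_pow2).
    apply (is_lim_seq_continuous sqrt).
    + apply continuity_pt_sqrt, pow2_ge_0.
    + set (C0 := 2 * (R0 * R0 * B ^ 2 * exp (Rabs tau * (R0 * R0))) * Rabs tau).
      assert (H : is_lim_seq (fun M => B ^ 2 + C0 * eterm (Rabs tau * (R0 * R0)) M) (B ^ 2 + C0 * 0)).
      { apply is_lim_seq_plus'; [apply is_lim_seq_const|].
        apply is_lim_seq_mult'; [apply is_lim_seq_const|apply is_lim_eterm]. }
      rewrite Rmult_0_r, Rplus_0_r in H. exact H.
Qed.

Lemma l2op_expOp_phase u R0 c : nb hw u R0 -> l2op (expOp (H2 u) (Cmult (RtoC c) Ci)) 1.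
Proof.
  intros HR. assert (H := l2op_expOp _ _ (Cmult (RtoC c) Ci) (l2op_H2 u R0 HR)).
  split; [lra| |apply H|apply H].
  intros x B HB. rewrite Rmult_1_l.
  replace (Cmult (RtoC c) Ci) with (phase c 0) by (unfold phase; now rewrite Rminus_0_r).
  now apply nb_expOp_isometry with R0.
Qed.

(** * Neumann series *)

Lemma rsum_geom r M : 0 <= r < 1 -> rsum (fun k => r ^ k) M <= / (1 - r).
Proof.
  intros Hr. assert (E : rsum (fun k => r ^ k) M = (1 - r ^ M) / (1 - r)).
  { induction M as [|M IH]; [simpl; field; lra|]. rewrite rsum_S, IH. simpl. field. lra. }
  rewrite E. unfold Rdiv. assert (0 <= r ^ M) by (apply pow_le; lra).
  assert (0 < / (1 - r)) by (apply Rinv_0_lt_compat; lra). nra.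
Qed.

Definition neumann (T : seqC -> seqC) (z : C) (y : seqC) (K : nat) : seqC :=
  fun n => csum (fun k => Cmult (Cpow z k) (Nat.iter k T y n)) K.

Lemma Cmod_Cpow z k : Cmod (Cpow z k) = Cmod z ^ k.
Proof. induction k; simpl; [apply Cmod_1|]. now rewrite Cmod_mult, IHk. Qed.

Lemma nbop_1_iter T k x B : l2op T 1 -> nb1 x B -> nb1 (Nat.iter k T x) B.
Proof.
  intros HT Hx. assert (H := nb_iter one_w T 1 x B k (l2op_bound _ _ HT) Hx).
  now rewrite pow1, Rmult_1_l in H.
Qed.

Lemma nb_neumann_tail T z y B K M : l2op T 1 -> Cmod z < 1 -> nb1 y B ->
  nb1 (seq_sub (neumann T z y (K + M)) (neumann T z y K)) (Cmod z ^ K * (B / (1 - Cmod z))).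
Proof.
  intros HT Hz Hy. assert (Hz0 := Cmod_ge_0 z). assert (HB := nb_nonneg _ _ _ Hy).
  replace (seq_sub (neumann T z y (K + M)) (neumann T z y K))
    with (fun n => csum (fun j => seq_scal (Cpow z (K + j)) (Nat.iter (K + j) T y) n) M).
  - eapply nb_mono.
    + apply (nb_csum one_w (fun j => seq_scal (Cpow z (K + j)) (Nat.iter (K + j) T y))
        (fun j => Cmod (Cpow z (K + j)) * B)); [apply nn_one|].
      intros j _. apply nb_scal. now apply nbop_1_iter.
    + rewrite (rsum_ext _ (fun j => Cmod z ^ K * B * Cmod z ^ j))
        by (intros; rewrite Cmod_Cpow, pow_add; ring).
      rewrite rsum_scal. unfold Rdiv. rewrite <- Rmult_assoc.
      apply Rmult_le_compat_l; [apply Rmult_le_pos; [now apply pow_le|easy]|].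
      now apply rsum_geom.
  - apply functional_extensionality. intros n. unfold seq_sub, neumann. rewrite csum_add.
    unfold seq_scal. ring.
Qed.

Lemma neumann_S T z y K : l2op T 1 -> l2 y ->
  neumann T z y (S K) = seq_add y (seq_scal z (T (neumann T z y K))).
Proof.
  intros HT Hy.
  (* Membership in [l2] goes through the induction together with the identity, since [T] is linear
     on [l2] only. *)
  assert (E : T (neumann T z y K) =
    (fun n => csum (fun k => Cmult (Cpow z k) (Nat.iter (S k) T y n)) K)
    /\ l2 (neumann T z y K)).
  { induction K as [|K [IH IHl]].
    - assert (Hz : neumann T z y 0 = seq_scal (RtoC 0) y)
        by (apply functional_extensionality; intros n; unfold neumann, seq_scal; simpl; ring).
      rewrite Hz. split.
      + rewrite (l2op_scal _ _ HT) by easy. apply functional_extensionality. intros n.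
        unfold seq_scal. simpl. ring.
      + apply l2_nb1 in Hy as [B HB]. eapply l2_of_nb, nb_scal, HB.
    - assert (Hz : neumann T z y (S K)
        = seq_add (neumann T z y K) (seq_scal (Cpow z K) (Nat.iter K T y))) by reflexivity.
      assert (Hk := l2op_iter_l2 T 1 K y HT Hy).
      assert (Hs : l2 (seq_scal (Cpow z K) (Nat.iter K T y))).
      { apply l2_nb1 in Hk as [D HD]. eapply l2_of_nb, nb_scal, HD. }
      rewrite Hz. split.
      + rewrite (l2op_add _ _ HT), (l2op_scal _ _ HT), IH by easy. reflexivity.
      + apply l2_nb1 in Hs as [D HD]. apply l2_nb1 in IHl as [D' HD'].
        eapply l2_of_nb, nb_add; eauto using nn_one. }
  rewrite (proj1 E). apply functional_extensionality. intros n.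
  unfold neumann, seq_add, seq_scal. rewrite csum_shift. f_equal; [simpl; ring|].
  rewrite <- csum_scal. apply csum_ext. intros. simpl Cpow. ring.
Qed.

Lemma is_lim_geom_mul r D : 0 <= r < 1 -> is_lim_seq (fun K => r ^ K * D) 0.
Proof.
  intros Hr. replace 0 with (0 * D) by ring.
  apply is_lim_seq_mult'; [|apply is_lim_seq_const].
  apply is_lim_seq_geom. rewrite Rabs_pos_eq; lra.
Qed.

Lemma Clim_neumann T z y B n : l2op T 1 -> Cmod z < 1 -> nb1 y B ->
  Clim (fun K => neumann T z y K n) (CSeries (fun k => Cmult (Cpow z k) (Nat.iter k T y n))).
Proof.
  intros HT Hz Hy. assert (Hz0 := Cmod_ge_0 z). assert (HB := nb_nonneg _ _ _ Hy).
  apply (Clim_csum _ (B * / (1 - Cmod z))). intros M.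
  apply Rle_trans with (rsum (fun k => B * Cmod z ^ k) M).
  - apply rsum_le. intros k _. rewrite Cmod_mult, Cmod_Cpow, Rmult_comm.
    apply Rmult_le_compat_r; [now apply pow_le|].
    apply nb1_coord. now apply nbop_1_iter.
  - rewrite rsum_scal. apply Rmult_le_compat_l; [easy|]. now apply rsum_geom.
Qed.

(** The tail bound makes the coefficientwise sum [x] a limit in norm of the partial sums [s_K].
    Since [s_{K+1} = y + z T s_K], the residual of [x] is [(x - s_{K+1}) - z T (x - s_K)], which
    tends to 0. *)
Lemma neumann_surjective T z y : l2op T 1 -> Cmod z < 1 -> l2 y ->
  exists x, l2 x /\ (fun n => Cminus (x n) (Cmult z (T x n))) = y.
Proof.
  intros HT Hz Hy. assert (Hz0 := Cmod_ge_0 z). assert (Hy' := Hy).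
  apply l2_nb1 in Hy as [B HB].
  set (x n := CSeries (fun k => Cmult (Cpow z k) (Nat.iter k T y n))).
  assert (Htail : forall K, nb1 (seq_sub x (neumann T z y K)) (Cmod z ^ K * (B / (1 - Cmod z)))).
  { intros K. apply nb_limit with
      (fun M => seq_sub (neumann T z y (K + M)) (neumann T z y K))
      (fun _ => Cmod z ^ K * (B / (1 - Cmod z))).
    - intros n. apply (Clim_sub_const (fun M => neumann T z y (K + M) n)).
      assert (H := Clim_neumann T z y B n HT Hz HB).
      unfold Clim in *. apply (is_lim_seq_incr_n _ K) in H.
      eapply is_lim_seq_ext; [|exact H]. intros m. simpl. now rewrite (Nat.add_comm m K).
    - intros M. now apply nb_neumann_tail.
    - apply is_lim_seq_const. }
  assert (Hx : l2 x).
  { specialize (Htail O). apply l2_of_nb in Htail.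
    replace (seq_sub x (neumann T z y 0)) with x in Htail; [easy|].
    apply functional_extensionality. intros n. unfold seq_sub, neumann. simpl. ring. }
  exists x. split; [easy|].
  apply functional_extensionality. intros n.
  assert (HK : forall K, l2 (neumann T z y K)).
  { intros K. assert (H0 := Htail K). apply l2_nb1 in Hx as [D HD].
    assert (H1 := nb_sub _ _ _ _ _ nn_one HD H0). apply l2_of_nb in H1.
    replace (seq_sub x (seq_sub x (neumann T z y K))) with (neumann T z y K) in H1; [easy|].
    apply functional_extensionality. intros m. unfold seq_sub. ring. }
  apply (Clim_unique (fun _ => Cminus (x n) (Cmult z (T x n)))); [apply Clim_const|].
  unfold Clim. apply is_lim_seq_0_le with
    (fun K => Cmod z ^ K * (2 * (B / (1 - Cmod z)))); [|now apply is_lim_geom_mul].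
  intros K. split; [apply Cmod_ge_0|].
  assert (ET : T x n = Cplus (T (seq_sub x (neumann T z y K)) n) (T (neumann T z y K) n)).
  { change (T x n = seq_add (T (seq_sub x (neumann T z y K))) (T (neumann T z y K)) n).
    rewrite <- (l2op_add _ _ HT); eauto using l2_of_nb.
    f_equal. f_equal. apply functional_extensionality. intros m. unfold seq_add, seq_sub. ring. }
  replace (Cminus (Cminus (x n) (Cmult z (T x n))) (y n)) with
    (Cminus (seq_sub x (neumann T z y (S K)) n) (Cmult z (T (seq_sub x (neumann T z y K)) n))).
  2:{ rewrite ET, neumann_S by easy. unfold seq_sub at 1. unfold seq_add, seq_scal. ring. }
  assert (E1 := nb1_coord _ _ n (Htail (S K))).
  assert (E2 := nb1_coord _ _ n (l2op_bound _ _ HT _ _ (Htail K))).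
  assert (E3 : Cmod (Cminus (seq_sub x (neumann T z y (S K)) n) (Cmult z (T (seq_sub x (neumann T z y K)) n)))
     <= Cmod (seq_sub x (neumann T z y (S K)) n) + Cmod z * Cmod (T (seq_sub x (neumann T z y K)) n)).
  { unfold Cminus. eapply Rle_trans; [apply Cmod_triangle|]. rewrite Cmod_opp, Cmod_mult. lra. }
  set (D := B / (1 - Cmod z)) in *.
  assert (HD : 0 <= D).
  { unfold D. apply Rmult_le_pos; [eapply nb_nonneg; eauto|]. apply Rlt_le, Rinv_0_lt_compat. lra. }
  assert (HP : 0 <= Cmod z ^ K * D) by (apply Rmult_le_pos; [now apply pow_le|easy]).
  assert (HC := Cmod_ge_0 (T (seq_sub x (neumann T z y K)) n)).
  simpl pow in E1. nra.
Qed.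

(** Iteration of [x = f + z T x]. It holds for any solution in [l2], so uniqueness and the formula
    follow from the same expansion. *)
Lemma neumann_expand T z f x K : l2op T 1 -> l2 x -> l2 f ->
  (fun n => Cminus (x n) (Cmult z (T x n))) = f ->
  x = seq_add (neumann T z f K) (seq_scal (Cpow z K) (Nat.iter K T x)).
Proof.
  intros HT Hx Hf E. induction K as [|K IH].
  - apply functional_extensionality. intros n. unfold seq_add, seq_scal, neumann. simpl. ring.
  - rewrite IH at 1.
    assert (Ex : x = seq_add f (seq_scal z (T x))).
    { rewrite <- E. apply functional_extensionality. intros n. unfold seq_add, seq_scal. ring. }
    assert (HTx : l2 (T x)) by (eapply l2op_l2; eauto).
    assert (HzTx : l2 (seq_scal z (T x))).
    { apply l2_nb1 in HTx as [D HD]. eapply l2_of_nb, nb_scal, HD. }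
    rewrite Ex at 1. rewrite (iter_add T 1), (iter_scal T 1) by easy.
    apply functional_extensionality. intros n. unfold seq_add, seq_scal, neumann.
    rewrite csum_S, Nat.iter_swap. simpl. ring.
Qed.

(** The remainder [z^K T^K x] has norm at most [|z|^K] times that of [x], because [T] is a
    contraction. *)
Lemma neumann_coord T z f x n : l2op T 1 -> Cmod z < 1 -> l2 x -> l2 f ->
  (fun n => Cminus (x n) (Cmult z (T x n))) = f ->
  Clim (fun K => neumann T z f K n) (x n).
Proof.
  intros HT Hz Hx Hf E. assert (Hx' := Hx). apply l2_nb1 in Hx as [B HB].
  apply is_lim_seq_0_le with (fun K => Cmod z ^ K * B);
    [|apply is_lim_geom_mul; split; [apply Cmod_ge_0|easy]].
  intros K. split; [apply Cmod_ge_0|].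
  assert (Ex := f_equal (fun g => g n) (neumann_expand T z f x K HT Hx' Hf E)).
  unfold seq_add, seq_scal in Ex. cbv beta in Ex.
  replace (Cminus (neumann T z f K n) (x n)) with (Copp (Cmult (Cpow z K) (Nat.iter K T x n)))
    by (rewrite Ex; ring).
  rewrite Cmod_opp, Cmod_mult, Cmod_Cpow.
  apply Rmult_le_compat_l; [apply pow_le, Cmod_ge_0|].
  apply nb1_coord. now apply nbop_1_iter.
Qed.

(** * Truncation of the flow *)

Lemma h12_nb a : h12 a -> nb hw a (h12norm a).
Proof. intros H. apply (ex_series_nb hw a nn_hw H). Qed.

Lemma nb_h12 a B : nb hw a B -> h12 a.
Proof. intros H. apply (nb_ex_series hw a B nn_hw H). Qed.

(** For [v = P_N u] the projected equation gives [v' = - i P_N Pi(|u|^2 u)], and the covariant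
    derivative adds [i T v = i Pi(|v|^2 v)]. *)
Definition trunc_err (u : R -> seqC) (N : nat) (s : R) : seqC :=
  seq_scal Ci (seq_sub (szego_nl (trunc N (u s))) (trunc N (szego_nl (u s)))).

Lemma dc_trunc u0 u N : szego_solution u0 u ->
  dc N (fun s => trunc N (u s)) (fun s => trunc N (u s)) (trunc_err u N).
Proof.
  intros [_ [_ Hu]]. split; [auto using fs_trunc|]. split; [auto using fs_trunc|].
  intros s n. unfold trunc_err, seq_scal, seq_sub.
  rewrite (szego_nl_toep N (trunc N (u s))) by apply fs_trunc.
  unfold trunc at 1 4. destruct (Nat.ltb n N).
  - destruct (Hu s n) as [d [Hd E]]. eapply Cderiv_eq; [exact Hd|].
    rewrite <- E. apply injective_projections; simpl; ring.
  - apply (Cderiv_eq _ _ (RtoC 0)); [apply Cderiv_const|ring].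
Qed.

(** Near [t0] and for large [N], both [u s] and its truncation are close to [u t0] in [H^{1/2}]. The
    cubic term is Lipschitz from bounded sets of [H^{1/2}] to [l^2], so both parts of [F] are
    compared with [y0], the cubic term at [t0], and its truncation. *)
Lemma approx_flow_trunc u0 u t0 : szego_solution u0 u ->
  exists R0, approx_flow t0 (fun N s => trunc N (u s)) (trunc_err u) R0.
Proof.
  intros Hs. assert (Hs' := Hs). destruct Hs' as [[Hh Hc] _].
  set (B := h12norm (u t0)). assert (HB : nb hw (u t0) B) by now apply h12_nb.
  assert (Hu : forall eta, 0 < eta -> near t0 (fun _ s => nb hw (seq_sub (u s) (u t0)) eta)).
  { intros eta He. destruct (Hc t0 eta He) as [d [Hd H]].
    apply near_intro with O d; [easy|]. intros _ s _ Hsd.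
    apply nb_mono with (h12norm (seq_sub (u s) (u t0))); [|apply Rlt_le, H, Hsd].
    apply h12_nb. apply (nb_h12 _ (h12norm (u s) + B)).
    apply nb_sub; [apply nn_hw|now apply h12_nb|easy]. }
  assert (Hv : forall eta, 0 < eta ->
     near t0 (fun N s => nb hw (seq_sub (trunc N (u s)) (u t0)) eta)).
  { intros eta He. destruct (limq_trunc hw (u t0) B nn_hw HB (eta / 2)) as [N0 HN0]; [lra|].
    assert (H1 : near t0 (fun N _ => (N0 <= N)%nat)) by (apply near_intro with N0 1; auto; lra).
    apply near_imp with (2 := near_and _ _ _ H1 (Hu (eta / 2) ltac:(lra))).
    intros N s [HN H].
    replace (seq_sub (trunc N (u s)) (u t0)) with
      (seq_add (trunc N (seq_sub (u s) (u t0))) (seq_sub (trunc N (u t0)) (u t0))).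
    - replace eta with (eta / 2 + eta / 2) by field.
      apply nb_add; [apply nn_hw|now apply nb_trunc; [apply nn_hw|]|auto].
    - apply functional_extensionality. intros n. unfold seq_add, seq_sub, trunc.
      destruct (Nat.ltb n N); ring. }
  assert (Hbd : forall a, nb hw (seq_sub a (u t0)) 1 -> nb hw a (B + 1)).
  { intros a Ha. replace a with (seq_add (u t0) (seq_sub a (u t0))).
    - apply nb_add; auto using nn_hw.
    - apply functional_extensionality. intros n. unfold seq_add, seq_sub. ring. }
  assert (HB0 := nb_nonneg _ _ _ HB).
  exists (B + 1). split.
  - intros N _. eapply dc_trunc, Hs.
  - apply near_imp with (2 := Hv 1 Rlt_0_1). intros N s. apply Hbd.
  - intros eta He. set (y0 := szego_nl (u t0)).
    assert (Hy0 : nb1 y0 (4 * B ^ 3)) by now apply nb_szego_nl.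
    destruct (limq_trunc one_w y0 _ nn_one Hy0 (eta / 3)) as [N0 HN0]; [lra|].
    destruct (exists_small_factor (12 * (B + 1) ^ 2) (eta / 3)) as [e0 [He0 He1]];
      [assert (H := pow2_ge_0 (B + 1)); lra|lra|].
    (* The cap 1 keeps [u s] and its truncations in the ball of radius [B + 1], for which the
       Lipschitz constant [12 (B + 1)^2] was computed. *)
    set (e := Rmin e0 1).
    assert (Hep : 0 < e) by (apply Rmin_pos; lra).
    assert (He2 : 12 * (B + 1) ^ 2 * e <= eta / 3).
    { eapply Rle_trans; [|exact He1]. apply Rmult_le_compat_l; [|apply Rmin_l].
      assert (H := pow2_ge_0 (B + 1)). lra. }
    assert (H1 : near t0 (fun N _ => (N0 <= N)%nat)) by (apply near_intro with N0 1; auto; lra).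
    apply near_imp with (2 := near_and _ _ _ H1 (near_and _ _ _ (Hu e Hep) (Hv e Hep))).
    intros N s [HN [Hus Hvs]].
    assert (HD : forall a, nb hw (seq_sub a (u t0)) e -> nb1 (seq_sub (szego_nl a) y0) (eta / 3)).
    { intros a Ha. eapply nb_mono; [|exact He2]. apply nb_szego_nl_sub; [| |easy].
      - apply Hbd. apply nb_mono with (1 := Ha). apply Rmin_r.
      - apply nb_mono with (1 := HB). lra. }
    unfold trunc_err.
    replace eta with (Cmod Ci * ((eta / 3 + eta / 3) + eta / 3)) by (rewrite Cmod_Ci; field).
    apply nb_scal.
    replace (seq_sub (szego_nl (trunc N (u s))) (trunc N (szego_nl (u s)))) with
      (seq_sub (seq_sub (seq_sub (szego_nl (trunc N (u s))) y0)
                        (trunc N (seq_sub (szego_nl (u s)) y0)))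
               (seq_sub (trunc N y0) y0)).
    + apply nb_sub; [apply nn_one|apply nb_sub; [apply nn_one| |]|auto].
      * now apply HD.
      * apply nb_trunc; [apply nn_one|]. now apply HD.
    + apply functional_extensionality. intros n. unfold seq_sub.
      set (a := szego_nl (trunc N (u s)) n). unfold trunc.
      destruct (Nat.ltb n N); ring.
Qed.

(** * Convergence of the truncated vectors *)

Definition szego_step (a : seqC) (c1 c2 : C) (h : seqC) : seqC :=
  expOp (H2 a) c1 (expOp (K2 a) c2 (Sstar h)).

Lemma limq_expOp_trunc a B c (x : seqC) (xN : nat -> seqC) :
  nb hw a B -> l2 x -> (forall N, l2 (xN N)) -> limq one_w xN x ->
  limq one_w (fun N => eP (H2 (trunc N a)) c N (xN N)) (expOp (H2 a) c x).
Proof.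
  intros Ha. assert (HaN : forall N, nb hw (trunc N a) B)
    by (intros; apply nb_trunc; auto using nn_hw).
  apply limq_eP with (B * B).
  - apply nb_nonneg in Ha. nra.
  - intros N. now apply nbop_H2.
  - now apply nbop_H2.
  - apply limq_H2 with B; auto. eapply limq_trunc; eauto using nn_hw.
Qed.

Lemma limq_expOp_Sstar_trunc a B c (x : seqC) (xN : nat -> seqC) :
  nb hw a B -> l2 x -> (forall N, l2 (xN N)) -> limq one_w xN x ->
  limq one_w (fun N => eP (H2 (Sstar (trunc N a))) c N (xN N)) (expOp (K2 a) c x).
Proof.
  intros Ha. rewrite K2_H2.
  assert (HaN : forall N, nb hw (Sstar (trunc N a)) B)
    by (intros; apply nb_hw_Sstar, nb_trunc; auto using nn_hw).
  assert (Ha' := nb_hw_Sstar _ _ Ha).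
  apply limq_eP with (B * B).
  - apply nb_nonneg in Ha. nra.
  - intros N. now apply nbop_H2.
  - now apply nbop_H2.
  - apply limq_H2 with B; auto.
    apply (limq_Sstar_hw (fun N => trunc N a)). eapply limq_trunc; eauto using nn_hw.
Qed.

Lemma l2_eP a B c M x : nb hw a B -> l2 x -> l2 (eP (H2 a) c M x).
Proof.
  intros Ha Hx. apply l2_nb1 in Hx as [D HD]. eapply l2_of_nb.
  apply (nb_eP one_w (H2 a) (B * B) c x D M); auto using nn_one, nbop_H2.
  apply nb_nonneg in Ha. nra.
Qed.

Lemma l2_Sstar x : l2 x -> l2 (Sstar x).
Proof. exact (l2op_l2 _ _ x l2op_Sstar). Qed.

Lemma nb_hw_l2 a B : nb hw a B -> l2 a.
Proof.
  intros H. apply (l2_of_nb _ B). apply nb_weight with (2 := H). exact hw_ge1.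
Qed.

Lemma l2op_szego_step a B t1 t2 : nb hw a B ->
  l2op (szego_step a (Cmult (RtoC t1) Ci) (Cmult (RtoC t2) Ci)) 1.
Proof.
  intros Ha. unfold szego_step. rewrite K2_H2. replace 1 with (1 * (1 * 1)) by ring.
  apply (l2op_comp (expOp (H2 a) (Cmult (RtoC t1) Ci)) 1
     (fun h => expOp (H2 (Sstar a)) (Cmult (RtoC t2) Ci) (Sstar h)) (1 * 1)).
  - now apply l2op_expOp_phase with B.
  - apply (l2op_comp (expOp (H2 (Sstar a)) (Cmult (RtoC t2) Ci)) 1 Sstar 1).
    + apply l2op_expOp_phase with B. now apply nb_hw_Sstar.
    + apply l2op_Sstar.
Qed.

Lemma l2_xseq t1 u k N s B : nb hw (u s) B -> l2 (xseq t1 (fun N s => trunc N (u s)) k N s).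
Proof.
  intros Hu. assert (HN : nb hw (trunc N (u s)) B) by (apply nb_trunc; auto using nn_hw).
  induction k as [|k IH]; simpl; apply l2_eP with B; auto.
  - now apply nb_hw_l2 with B.
  - apply l2_eP with B; [now apply nb_hw_Sstar|now apply l2_Sstar].
Qed.

(** Convergence is needed at each fixed [s] only; uniformity in time enters through [slow]. *)
Lemma limq_xseq t1 u k s B : nb hw (u s) B ->
  limq one_w (fun N => xseq t1 (fun N s => trunc N (u s)) k N s)
    (Nat.iter k (szego_step (u s) (phase s t1) (phase t1 s)) (expOp (H2 (u s)) (phase s t1) (u s))).
Proof.
  intros Hu. assert (Hl := nb_hw_l2 _ _ Hu).
  assert (HN : forall N, nb hw (trunc N (u s)) B) by (intros; apply nb_trunc; auto using nn_hw).
  assert (Hf : l2 (expOp (H2 (u s)) (phase s t1) (u s)))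
    by (eapply l2op_l2; [now apply l2op_expOp_phase with B|easy]).
  induction k as [|k IH]; simpl.
  - apply (limq_expOp_trunc (u s) B (phase s t1) (u s) (fun N => trunc N (u s))); auto.
    + intros N. now apply nb_hw_l2 with B.
    + destruct (proj1 (l2_nb1 _) Hl) as [D HD]. eapply limq_trunc; eauto using nn_one.
  - set (X := Nat.iter k _ _) in *.
    assert (HX : l2 X).
    { apply (l2op_iter_l2 _ 1); [now apply l2op_szego_step with B|easy]. }
    set (xN := fun N => xseq t1 (fun N s => trunc N (u s)) k N s) in *.
    assert (HxN : forall N, l2 (xN N)) by (intros; now apply l2_xseq with B).
    apply (limq_expOp_trunc (u s) B (phase s t1) (expOp (K2 (u s)) (phase t1 s) (Sstar X))
      (fun N => eP (H2 (Sstar (trunc N (u s)))) (phase t1 s) N (Sstar (xN N)))); auto.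
    + rewrite K2_H2. eapply l2op_l2; [apply l2op_expOp_phase with B; now apply nb_hw_Sstar|].
      now apply l2_Sstar.
    + intros N. apply l2_eP with B; [now apply nb_hw_Sstar|now apply l2_Sstar].
    + apply (limq_expOp_Sstar_trunc (u s) B (phase t1 s) (Sstar X) (fun N => Sstar (xN N))); auto.
      * now apply l2_Sstar.
      * intros N. now apply l2_Sstar.
      * now apply limq_Sstar.
Qed.

(** * Identification of the Fourier coefficients *)

Lemma expOp_0 A x : expOp A (RtoC 0) x = x.
Proof.
  apply functional_extensionality. intros n. unfold expOp.
  rewrite (CSeries_fin _ 1).
  - change (csum (fun k => Cmult (ecoef (RtoC 0) k) (Nat.iter k A x n)) 1 = x n).
    simpl csum. rewrite ecoef_0. simpl. ring.
  - intros k Hk. change (Cmult (ecoef (RtoC 0) k) (Nat.iter k A x n) = RtoC 0).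
    destruct k as [|k]; [lia|]. rewrite ecoef_S. unfold Cdiv. ring.
Qed.

Lemma phase_diag t : phase t t = RtoC 0.
Proof. unfold phase. rewrite Rminus_diag. ring. Qed.

Lemma iter_Sstar k x n : Nat.iter k Sstar x n = x (n + k)%nat.
Proof.
  revert n. induction k as [|k IH]; intros n; simpl; [now rewrite Nat.add_0_r|].
  unfold Sstar at 1. rewrite IH. f_equal. lia.
Qed.

Lemma szego_coefficient u0 u t k : szego_solution u0 u ->
  u t k = Nat.iter k (szego_step u0 (Cmult (RtoC (- t)) Ci) (Cmult (RtoC t) Ci))
            (expOp (H2 u0) (Cmult (RtoC (- t)) Ci) u0) O.
Proof.
  intros Hs. assert (Hh := proj1 (proj1 Hs)).
  set (J s := Nat.iter k (szego_step (u s) (phase s t) (phase t s))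
                (expOp (H2 (u s)) (phase s t) (u s)) O).
  assert (HJ : J t = J 0).
  { apply (const_of_slow (fun N s => xseq t (fun N s => trunc N (u s)) k N s O)).
    - intros t0. destruct (approx_flow_trunc u0 u t0 Hs) as [R0 HR].
      apply asol_slow with (v := fun N s => trunc N (u s)). eapply asol_xseq, HR.
    - intros s. assert (H := limq_xseq t u k s _ (h12_nb _ (Hh s))).
      exact (limq_Clim _ _ O H). }
  unfold J in HJ. rewrite phase_diag, expOp_0 in HJ.
  replace (szego_step (u t) (RtoC 0) (RtoC 0)) with Sstar in HJ.
  - rewrite iter_Sstar in HJ. simpl in HJ. rewrite HJ.
    rewrite (proj1 (proj2 Hs)). unfold phase. now rewrite Rminus_0_l, Rminus_0_r.
  - apply functional_extensionality. intros h. unfold szego_step. now rewrite !expOp_0.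
Qed.

Lemma ip_one x : ip x one_fn = x O.
Proof.
  unfold ip. rewrite (CSeries_fin _ 1).
  - simpl. apply injective_projections; simpl; ring.
  - intros [|n] Hn; [lia|]. simpl. apply injective_projections; simpl; ring.
Qed.

Theorem theorem1 (u0 : seqC) (u : R -> seqC) :
  h12 u0 -> szego_solution u0 u ->
  forall (t : R) (z : C), Cmod z < 1 ->
  let T : seqC -> seqC := fun h =>
      expOp (H2 u0) (Cmult (RtoC (- t)) Ci) (expOp (K2 u0) (Cmult (RtoC t) Ci) (Sstar h)) in
  let M : seqC -> seqC := fun x => fun n => Cminus (x n) (Cmult z (T x n)) in
  let f : seqC := expOp (H2 u0) (Cmult (RtoC (- t)) Ci) u0 in
  (* I - z T is invertible on L^2_+ ... *)
  (forall y, l2 y -> exists x, l2 x /\ M x = y) /\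
  (forall x1 x2, l2 x1 -> l2 x2 -> M x1 = M x2 -> x1 = x2) /\
  (* ... and underline u(t,z) = ((I - zT)^{-1} f | 1) *)
  (forall x, l2 x -> M x = f -> uline (u t) z = ip x one_fn).
Proof.
  intros H0 Hs t z Hz T M f.
  assert (HB := h12_nb _ H0).
  assert (HT : l2op T 1) by exact (l2op_szego_step u0 _ (- t) t HB).
  assert (Hf : l2 f).
  { eapply l2op_l2; [eapply l2op_expOp_phase, HB|]. eapply nb_hw_l2, HB. }
  assert (HM : forall x, l2 x -> l2 (M x)).
  { intros x Hx. assert (HTx := l2op_l2 _ _ _ HT Hx).
    apply l2_nb1 in Hx as [B1 HB1]. apply l2_nb1 in HTx as [B2 HB2].
    eapply l2_of_nb. apply (nb_sub one_w x (seq_scal z (T x))); eauto using nn_one, nb_scal. }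
  split; [|split].
  - intros y Hy. now apply neumann_surjective.
  - intros x1 x2 Hx1 Hx2 E. apply functional_extensionality. intros n.
    (* Both solutions are coefficientwise limits of the Neumann sums of one and the same right-hand
       side. *)
    apply (Clim_unique (fun K => neumann T z (M x1) K n)).
    + now apply neumann_coord; auto.
    + rewrite E. now apply neumann_coord; auto.
  - intros x Hx E. rewrite ip_one. apply CSeries_unique.
    (* Coefficient 0 of the Neumann sums of [f] is a partial sum of the power series of [u t], term
       by term. *)
    apply Clim_ext with (1 := neumann_coord T z f x O HT Hz Hx Hf E).
    intros K. apply csum_ext. intros k _.
    rewrite (szego_coefficient u0 u t k Hs), Cmult_comm. reflexivity.
Qed.
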